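(* There exists a minimizer of $J_\infty$ over $H_\infty$, i.e. there exists $\mathbf{u}=(u_1,\dots,u_k)\in H_\infty$ such that $J_\infty(\mathbf{u})=\inf_{H_\infty}J_\infty$.
   Context: Let $N\ge 2$, $k\ge 2$, let $\Omega\subset\mathbb{R}^N$ be a bounded domain, and let $\Omega_1=\{x\in\mathbb{R}^N:\ \mathrm{dist}(x,\Omega)<1\}$. For sets $A,B$, $\mathrm{dist}(A,B)=\inf\{|x-y|: x\in A,\ y\in B\}$. For a function $v$ on $\Omega_1$, $\mathrm{supp}\,v$ is the complement in $\Omega_1$ of the largest open set on which $v=0$ a.e. Let $f_1,\dots,f_k\in H^1(\Omega_1)\cap C(\overline{\Omega_1})$ be nonnegative nontrivial functions with $\mathrm{dist}(\mathrm{supp}\,f_i,\mathrm{supp}\,f_j)\ge 1$ for all $i\ne j$ (it is assumed that $\Omega$ is such that functions of this kind exist). Define $$H_\infty=\{\mathbf{u}=(u_1,\dots,u_k)\in H^1(\Omega_1,\mathbb{R}^k):\ \mathrm{dist}(\mathrm{supp}\,u_i,\mathrm{supp}\,u_j)\ge 1\ \forall i\ne j,\ \ u_i=f_i\text{ a.e. in }\Omega_1\setminus\Omega\ \forall i\},$$ $$J_\infty(\mathbf{u})=\sum_{i=1}^k\int_\Omega|\nabla u_i|^2 .$$ *)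

(* Defs.v *)
From HB Require Import structures.
From mathcomp Require Import all_boot all_order all_algebra.
From mathcomp Require Import all_classical all_reals all_analysis.

Set Implicit Arguments.
Unset Strict Implicit.
Unset Printing Implicit Defensive.

Import Order.TTheory GRing.Theory Num.Theory.
Import numFieldNormedType.Exports.

Local Open Scope classical_set_scope.
Local Open Scope ring_scope.

(* The sigma-algebra on R^n is the product of the Borel sigma-algebras of the
   coordinates, which is also the Borel sigma-algebra of R^n. *)
Section measurable_rV.
Context {d} {T : measurableType d} (n : nat).

Let coord (i : 'I_n) (x : 'rV[T]_n) : T := x ord0 i.

Let rV_set0 : g_sigma_preimage coord set0.
Proof. exact: sigma_algebra0. Qed.

Let rV_setC A : g_sigma_preimage coord A -> g_sigma_preimage coord (~` A).
Proof. exact: sigma_algebraC. Qed.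

Let rV_bigcup (F : (set 'rV[T]_n)^nat) :
  (forall i, g_sigma_preimage coord (F i)) ->
  g_sigma_preimage coord (\bigcup_i F i).
Proof. exact: sigma_algebra_bigcup. Qed.

HB.instance Definition _ := @isMeasurable.Build (measure_tuple_display d)
  'rV[T]_n (g_sigma_preimage coord) rV_set0 rV_setC rV_bigcup.

Lemma measurable_coord (i : 'I_n) :
  measurable_fun [set: 'rV[T]_n] (fun x : 'rV[T]_n => x ord0 i).
Proof.
move=> _ Y mY; rewrite setTI; apply: sub_sigma_algebra => /=.
rewrite -bigcup_seq/=; exists i => /=; first by rewrite mem_index_enum.
by exists Y => //; rewrite setTI.
Qed.

Lemma measurable_fun_rV d' (S : measurableType d') (f : S -> 'rV[T]_n) :
  (forall i, measurable_fun [set: S] (fun s => f s ord0 i)) ->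
  measurable_fun [set: S] f.
Proof.
move=> mf.
suff: measurable `<=` [set A | measurable (f @^-1` A)].
  by move=> fm _ A mA; rewrite setTI; exact: fm.
apply: smallest_sub.
  split=> /=.
  - by rewrite preimage_set0.
  - by move=> A mA; rewrite setTD preimage_setC; exact: measurableC.
  - by move=> A mA; rewrite preimage_bigcup; exact: bigcup_measurable.
move=> A /=; rewrite -bigcup_seq => -[i _ [B mB <-]].
have := mf i measurableT B mB.
by rewrite !setTI.
Qed.

End measurable_rV.

Section lebesgue_rV.
Local Open Scope ereal_scope.
Context {R : realType}.

Definition rV_cons n (p : R * 'rV[R]_n) : 'rV[R]_n.+1 :=
  row_mx (const_mx p.1 : 'rV_1) p.2.

Definition rV_uncons n (x : 'rV[R]_n.+1) : R * 'rV[R]_n :=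
  (x ord0 ord0, rsubmx (x : 'rV_(1 + n))).

Lemma rV_unconsK n : cancel (@rV_uncons n) (@rV_cons n).
Proof.
move=> x; have e : const_mx (x ord0 ord0) = lsubmx (x : 'rV_(1 + n)).
  by apply/rowP => i; rewrite !mxE (ord1 i); congr (x _ _); apply/val_inj.
by rewrite /rV_cons /rV_uncons/= e; exact: (hsubmxK (x : 'rV_(1 + n))).
Qed.

Lemma rV_consK n : cancel (@rV_cons n) (@rV_uncons n).
Proof.
move=> [a y]; rewrite /rV_cons /rV_uncons/= row_mxKr; congr pair.
have <- : lshift n (ord0 : 'I_1) = ord0 by exact/val_inj.
by rewrite (row_mxEl (const_mx a : 'rV_1)) mxE.
Qed.

Lemma measurable_rV_cons n : measurable_fun [set: R * 'rV[R]_n] (@rV_cons n).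
Proof.
apply: measurable_fun_rV => i.
have -> : (fun s : R * 'rV[R]_n => rV_cons s ord0 i) =
    match fintype.split (i : 'I_(1 + n)) with
    | inl _ => fst | inr j => fun s => s.2 ord0 j end.
  apply/funext => s; rewrite /rV_cons mxE.
  by case: (fintype.split _) => j //; rewrite mxE.
case: (fintype.split _) => j; first exact: measurable_fst.
exact: (measurableT_comp (measurable_coord j) measurable_snd).
Qed.

Lemma measurable_rV_uncons n :
  measurable_fun [set: 'rV[R]_n.+1] (@rV_uncons n).
Proof.
apply/measurable_fun_pairP; split; first exact: measurable_coord.
apply: measurable_fun_rV => i.
rewrite (_ : (fun _ => _) =
  (fun x : 'rV[R]_n.+1 => x ord0 (rshift 1 i))); first exact: measurable_coord.
by apply/funext => x /=; rewrite mxE.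
Qed.

Section rV_product.
Variables (n : nat) (mu : {sigma_finite_measure set 'rV[R]_n -> \bar R}).

Definition lebesgue_rV_product (A : set 'rV[R]_n.+1) : \bar R :=
  pushforward (@lebesgue_measure R \x mu) (@rV_cons n) A.

Let m0 : lebesgue_rV_product set0 = 0.
Proof. by rewrite /lebesgue_rV_product /pushforward preimage_set0 measure0. Qed.

Let m_ge0 A : 0 <= lebesgue_rV_product A.
Proof. by rewrite /lebesgue_rV_product /pushforward measure_ge0. Qed.

Let m_sigma_additive : semi_sigma_additive lebesgue_rV_product.
Proof.
move=> F mF tF mUF; rewrite /lebesgue_rV_product /pushforward preimage_bigcup.
have mcons A : measurable A -> measurable (@rV_cons n @^-1` A).
  by move=> mA; rewrite -[X in measurable X]setTI; exact: measurable_rV_cons.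
apply: measure_semi_sigma_additive.
- by move=> k; exact: mcons.
- apply/trivIsetP => /= i j _ _ ij; rewrite -preimage_setI.
  by move/trivIsetP : tF => /(_ _ _ _ _ ij) ->//; rewrite preimage_set0.
- by rewrite -preimage_bigcup; exact: mcons.
Qed.

HB.instance Definition _ := isMeasure.Build _ _ _ lebesgue_rV_product
  m0 m_ge0 m_sigma_additive.

Let m_sigma_finite : sigma_finite [set: 'rV[R]_n.+1] lebesgue_rV_product.
Proof.
have /sigma_finiteP[F [UF ndF F_fin]] := sigma_finiteT (@lebesgue_measure R).
have /sigma_finiteP[G [UG ndG G_fin]] := sigma_finiteT mu.
exists (fun k => @rV_uncons n @^-1` (F k `*` G k)).
  rewrite -preimage_bigcup (_ : \bigcup_k _ = setT) ?preimage_setT//.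
  apply/seteqP; split=> // -[a y] _.
  have [i _ Fa] : (\bigcup_i F i) a by rewrite -UF.
  have [j _ Gy] : (\bigcup_i G i) y by rewrite -UG.
  exists (maxn i j) => //; split=> /=.
  - by move: a Fa; exact/subsetPset/ndF/leq_maxl.
  - by move: y Gy; exact/subsetPset/ndG/leq_maxr.
move=> k; have [mF Foo] := F_fin k; have [mG Goo] := G_fin k.
have mFG : measurable (F k `*` G k) by exact: measurableX.
split.
  by rewrite -[X in measurable X]setTI; exact: measurable_rV_uncons.
rewrite /lebesgue_rV_product /pushforward -comp_preimage.
rewrite (_ : _ \o _ = id); last by apply/funext => p; exact: rV_consK.
rewrite preimage_id product_measure1E// lte_mul_pinfty// ge0_fin_numE//.
Qed.

HB.instance Definition _ := Measure_isSigmaFinite.Build _ _ _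
  lebesgue_rV_product m_sigma_finite.

End rV_product.

(* Lebesgue measure on R^n, as the n-fold product of lebesgue_measure; R^0 is
   a point of mass 1. *)
Fixpoint lebesgue_rV n : {sigma_finite_measure set 'rV[R]_n -> \bar R} :=
  match n with
  | 0 => \d_ (0%R : 'rV[R]_0)
  | n'.+1 => lebesgue_rV_product (lebesgue_rV n')
  end.

End lebesgue_rV.

Section distance.
Context {R : realType} {N : nat}.
Implicit Types (x y : 'rV[R]_N) (A B : set 'rV[R]_N).

(* The library norm on 'rV[R]_N is the sup norm. *)
Definition euclidean_norm x : R := Num.sqrt (\sum_(i < N) (x ord0 i) ^+ 2).

(* Infimum in the extended reals: the distance to the empty set is +oo. *)
Definition set_dist A B : \bar R :=
  ereal_inf [set (euclidean_norm (x - y))%:E | x in A & y in B].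

Definition neighborhood1 (Omega : set 'rV[R]_N) : set 'rV[R]_N :=
  [set x | (set_dist [set x] Omega < 1%:E)%E].

End distance.

(* A function on a subset U of R^N is represented by a function on R^N whose
   values outside U are irrelevant. *)
Section sobolev.
Context {R : realType} {N : nat}.
Local Notation E := 'rV[R]_N.
Local Notation mu := (@lebesgue_rV R N).
Implicit Types (U : set E) (u v phi : E -> R) (j : 'I_N).

Definition partial j phi : E -> R := fun x => 'D_(delta_mx ord0 j) phi x.

(* C^infinity: all iterated partial derivatives exist and are continuous. *)
Definition smooth phi : Prop :=
  forall s : seq 'I_N, let psi := foldr partial phi s in
    continuous psi /\ forall j x, derivable psi x (delta_mx ord0 j).

Definition test_function U phi : Prop :=
  [/\ smooth phi,
      compact (closure [set x | phi x != 0]) &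
      closure [set x | phi x != 0] `<=` U].

Definition square_integrable U v : Prop :=
  measurable_fun U v /\ mu.-integrable U (fun x => ((v x) ^+ 2)%:E).

Definition weak_partial U j u v : Prop :=
  forall phi, test_function U phi ->
    (\int[mu]_(x in U) (u x * partial j phi x)%:E =
     - \int[mu]_(x in U) (v x * phi x)%:E)%E.

Definition H1 U u : Prop :=
  square_integrable U u /\
  forall j, exists v, square_integrable U v /\ weak_partial U j u v.

(* A representative of the j-th weak derivative of u : H1 U, which is unique
   up to a null set. *)
Definition weak_grad U u j : E -> R :=
  get [set v | square_integrable U v /\ weak_partial U j u v].

Definition supp U v : set E :=
  U `\` \bigcup_(V in [set V : set E |
    [/\ open V, V `<=` U & {ae mu, forall x, V x -> v x = 0}]]) V.

End sobolev.

Section problem.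
Context {R : realType} {N k : nat}.
Local Notation E := 'rV[R]_N.
Local Notation mu := (@lebesgue_rV R N).
Implicit Types (Omega : set E) (f u : 'I_k -> E -> R).

Definition bounded_domain Omega : Prop :=
  [/\ Omega !=set0, open Omega, connected Omega & bounded_set Omega].

Definition separated_supports Omega u : Prop :=
  forall i j, i != j ->
    (1%:E <= set_dist (supp (neighborhood1 Omega) (u i))
                      (supp (neighborhood1 Omega) (u j)))%E.

Definition boundary_data Omega f : Prop :=
  [/\ forall i, H1 (neighborhood1 Omega) (f i),
      forall i, {within closure (neighborhood1 Omega), continuous (f i)},
      forall i x, closure (neighborhood1 Omega) x -> 0 <= f i x,
      forall i, exists2 x, closure (neighborhood1 Omega) x & f i x != 0 &
      separated_supports Omega f].

Definition Hinfty Omega f : set ('I_k -> E -> R) :=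
  [set u | [/\ forall i, H1 (neighborhood1 Omega) (u i),
      separated_supports Omega u &
      forall i, {ae mu, forall x,
        (neighborhood1 Omega `\` Omega) x -> u i x = f i x}]].

Definition Jinfty Omega u : \bar R :=
  (\sum_(i < k) \int[mu]_(x in Omega)
     (\sum_(j < N) (weak_grad (neighborhood1 Omega) (u i) j x) ^+ 2)%R%:E)%E.

End problem.

(* Main.v *)
(**
A minimizing sequence is extracted without weak compactness. Choose an
ultrafilter on [Hinfty] containing all sublevel sets of [J] above the infimum.
For a set of the ultrafilter that is stable under midpoints, the parallelogram
identity makes almost minimizers of [J] on it pairwise close in energy; taking
the supremum of the infima of [J] over such sets, one obtains a sequence that
is Cauchy in [H^1] and stays close to almost minimizers in every further
midpoint-stable set of the ultrafilter. Now let [B] and [B'] be two balls all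
of whose points are at mutual distance less than 1. A tuple with separated
supports satisfies [u_i = 0] on [B] or [u_j = 0] on [B']. Each alternative is a
linear condition and one of them belongs to the ultrafilter, so that it passes
to the limit: the limit has separated supports.

Cauchy sequences in energy converge in [L^2] by the Poincare inequality for
differences [w] of admissible functions, which vanish outside [Omega]. Their
gradients vanish a.e. outside [Omega] as well, but this needs a proof, since the
boundary of [Omega] may have positive measure. Both facts are derived from the
identity [w x - w (x - h e_j) = \int_0^h (partial_j w) (x - s e_j) ds],
valid for a.e. [x], which replaces mollification.
*)
Require Import Defs.
From HB Require Import structures.
From mathcomp Require Import all_boot all_order all_algebra.
From mathcomp Require Import all_classical all_reals all_analysis.
From mathcomp Require Import measurable_realfun ring lra.

Set Implicit Arguments.
Unset Strict Implicit.
Unset Printing Implicit Defensive.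

Import Order.TTheory GRing.Theory Num.Theory.
Import numFieldNormedType.Exports.

Local Open Scope classical_set_scope.
Local Open Scope ring_scope.

(** * Open boxes, a countable base, and the sigma-algebra they generate *)

Section cubes.
Context {R : realType} {n : nat}.
Local Notation E := 'rV[R]_n.
Implicit Types (x y : E) (V : set E).

(** The obstacle is that [Hinfty] is not stable under midpoints: for every pair of balls its
    constraint is a disjunction. There are infinitely many pairs, and each choice has to hold along
    a whole minimizing sequence; an ultrafilter makes all the choices at once. The price is that the
    members of the resulting sequence need not lie in [Hinfty]; only the limit does, which is why
    nearby elements satisfying each selected alternative are carried along.

    The identity on segments is tested against products of one-variable bumps, so that smoothness,
    supports and derivatives reduce to calculus on the line. It is available only for steps short
    enough to stay inside [neighborhood1 Omega]; the Poincare inequality therefore crosses [Omega]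
    in many small steps.

    Functions are extended by zero outside [neighborhood1 Omega], because translations and Fubini
    act on the whole space. As [weak_grad] is a chosen representative, gradients are computed only
    up to null sets, through uniqueness of weak derivatives. That uniqueness is in turn the
    vanishing of the gradient on the zero set, applied to the zero function. *)

Definition box (a b : E) : set E :=
  [set x | forall i, a ord0 i < x ord0 i < b ord0 i].

(** The library metric is the sup metric, so balls are cubes. The conjunct [0 < e] matters in
    dimension 0, where the coordinate condition is void. *)
Lemma rV_ballP x e y :
  ball x e y <-> 0 < e /\ forall i, `|x ord0 i - y ord0 i| < e.
Proof.
split=> [[e0 h]|[e0 h]]; split=> // i; first exact: h.
by move=> j; rewrite (ord1 i); exact: h.
Qed.

(** Boxes with rational corners form a countable base of the topology. *)
Definition rat_box (p : 'rV[rat]_n * 'rV[rat]_n) : set E :=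
  box (map_mx ratr p.1) (map_mx ratr p.2).

Lemma ball_rat_box x e : 0 < e ->
  exists p, rat_box p x /\ rat_box p `<=` ball x e.
Proof.
move=> e0.
have lo i : {q : rat | ratr q \in `]x ord0 i - e, x ord0 i[}.
  by apply: cid; apply: (rat_in_itvoo (y := x ord0 i)); rewrite ltrBlDr ltrDl.
have hi i : {q : rat | ratr q \in `]x ord0 i, x ord0 i + e[}.
  by apply: cid; apply: rat_in_itvoo; rewrite ltrDl.
exists (\row_i sval (lo i), \row_i sval (hi i)); split.
  move=> i; rewrite !mxE; case: (lo i) (hi i) => q /= + [r /=].
  by rewrite !in_itv/= => /andP[_ ->] /andP[-> _].
move=> y yp; apply/rV_ballP; split=> // i; have := yp i.
rewrite !mxE; case: (lo i) (hi i) => q /= + [r /=].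
rewrite !in_itv/= => /andP[q1 q2] /andP[r1 r2] /andP[y1 y2].
rewrite ltr_distlC; apply/andP; split; lra.
Qed.

Lemma open_rat_box V : open V ->
  V = \bigcup_(p in [set p | rat_box p `<=` V]) rat_box p.
Proof.
move=> oV; apply/seteqP; split=> [x Vx|x [p /= pV px]]; last exact: pV.
have /nbhs_ballP[e /= e0 xeV] := open_nbhs_nbhs (conj oV Vx).
have [p [px pe]] := ball_rat_box x e0.
by exists p => //=; exact: subset_trans xeV.
Qed.

Lemma measurable_box (a b : E) : measurable (box a b).
Proof.
rewrite (_ : box a b = \bigcap_(i in [set: 'I_n])
   ((fun x : E => x ord0 i) @^-1` `]a ord0 i, b ord0 i[)); last first.
  apply/seteqP; split=> [x xab i _|x xab i] /=; first by rewrite in_itv/= xab.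
  by have /= := xab i I; rewrite in_itv.
apply: fin_bigcap_measurable => [|i _]; first exact: finite_finset.
by rewrite -[X in measurable X]setTI; exact: measurable_coord.
Qed.

Lemma rV_open_measurable V : open V -> measurable V.
Proof.
move=> /open_rat_box ->; rewrite bigcup_mkcond.
apply: countable_bigcupT_measurable => [|p]; first exact: countableP.
by case: ifP => _ //; exact: measurable_box.
Qed.

Lemma rV_continuous_measurable (phi : E -> R) :
  continuous phi -> measurable_fun setT phi.
Proof.
move=> cphi; apply: (measurability _ (RGenOpens.measurableE R)).
move=> _ [_ [a [b ->] <-]]; rewrite setTI; apply: rV_open_measurable.
by move/continuousP : cphi; apply; exact: interval_open.
Qed.

(** A Lindelof argument: each point has a rational box on which [Z] is null, and there are only
    countably many rational boxes. *)
Lemma negligible_locally (mu : {measure set E -> \bar R}) (V Z : set E) :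
  (forall x, V x -> exists2 e, 0 < e & mu.-negligible (ball x e `&` Z)) ->
  mu.-negligible (V `&` Z).
Proof.
move=> h; pose good p := mu.-negligible (rat_box p `&` Z).
apply: (@negligibleS _ _ _ _ (\bigcup_k (if unpickle k is Some p then
   (if `[< good p >] then rat_box p `&` Z else set0) else set0))).
  move=> x [Vx Zx]; have [e e0 ne] := h x Vx.
  have [p [px pe]] := ball_rat_box x e0.
  exists (pickle p) => //; rewrite pickleK ifT//; apply/asboolP.
  by apply: negligibleS ne; exact: setSI.
apply: negligible_bigcup => k; case: unpickle => [p|]; last exact: negligible_set0.
by case: ifPn => [/asboolP//|_]; exact: negligible_set0.
Qed.

(** The sigma-algebra is generated by coordinate preimages of Borel sets. The preimage of an open
    interval is open, hence a countable union of rational boxes. *)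
Lemma g_sigma_rat_box :
  @measurable _ E = <<s range (fun p => rat_box p) >>.
Proof.
apply/seteqP; split; last first.
  apply: smallest_sub; first exact: sigma_algebra_measurable.
  by move=> _ [p _ <-]; exact: measurable_box.
have sO V : open V -> <<s range (fun p => rat_box p) >> V.
  move=> /open_rat_box ->.
  rewrite (_ : \bigcup_(_ in _) _ = \bigcup_k (if unpickle k is Some p then
     (if `[< rat_box p `<=` V >] then rat_box p else set0) else set0)).
    apply: sigma_algebra_bigcup => k; case: unpickle => [p|]; last first.
      exact: sigma_algebra0.
    case: ifPn => _; last exact: sigma_algebra0.
    by apply: sub_sigma_algebra; exists p.
  apply/seteqP; split=> x.
    by move=> [p /= pV px]; exists (pickle p) => //; rewrite pickleK asboolT.
  move=> [k _]; case: unpickle => // p; case: ifPn => // /asboolP pV px.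
  by exists p.
apply: smallest_sub; first exact: smallest_sigma_algebra.
move=> A /=; rewrite -bigcup_seq => -[i _ [B mB <-]]; rewrite setTI.
suff : <<s @RGenOpens.G R >> `<=`
    [set B | <<s range (fun p => rat_box p) >> ((fun x : E => x ord0 i) @^-1` B)].
  have mE := RGenOpens.measurableE R.
  by move=> h; apply: h; move: mB; have <- : (@ocitv R).-sigma.-measurable = <<s @RGenOpens.G R >> by exact: mE.
apply: smallest_sub => /=; first split => /=.
- by rewrite preimage_set0; exact: sigma_algebra0.
- by move=> C mC; rewrite setTD preimage_setC; exact: sigma_algebraC.
- by move=> C mC; rewrite preimage_bigcup; exact: sigma_algebra_bigcup.
move=> _ [a [b ->]]; apply: sO; move: (@coord_continuous R 1 n ord0 i).
by move/continuousP; apply; exact: interval_open.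
Qed.

End cubes.

(** * Translation invariance of Lebesgue measure on R^n *)

Section translation.
Context {R : realType}.
Local Open Scope ereal_scope.

(** By uniqueness of Lebesgue measure: its image under the translation has the same values on
    half-open intervals. *)
Lemma lebesgue_measure_shift (a : R) (A : set R) : measurable A ->
  lebesgue_measure ((fun t : R => t + a)%R @^-1` A) = lebesgue_measure A.
Proof.
move=> mA.
pose phi : measurableTypeR R -> measurableTypeR R := fun t => (t + a)%R.
have mphi : measurable_fun setT phi by exact: measurable_funD.
pose phim : {mfun _ >-> _} := HB.pack phi (isMeasurableFun.Build _ _ _ _ _ mphi).
apply/esym; apply: (lebesgue_measure_unique (mu := pushforward lebesgue_measure phim)) => //.
move=> _ [[b c]] _ <-; rewrite /pushforward/=.
transitivity (lebesgue_measure `](b - a)%R, (c - a)%R]%classic).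
  rewrite !lebesgue_measure_itv/= !lte_fin ltrD2r -!EFinB.
  by congr (if _ then _%:E else _); lra.
congr (lebesgue_measure _); apply/seteqP; split=> x; rewrite /phi /= !in_itv/= => /andP[? ?];
  by apply/andP; split; lra.
Qed.

Lemma rV_cons_shift n (v : 'rV[R]_n.+1) (t : R) (y : 'rV[R]_n) :
  (rV_cons (t, y) + v = rV_cons (t + v ord0 ord0, y + (rV_uncons v).2))%R.
Proof.
apply/rowP => i; rewrite mxE -[v in LHS](rV_unconsK v) /rV_cons.
by rewrite 3!mxE; case: (fintype.split _) => j /=; rewrite !mxE.
Qed.

Lemma measurable_shift n (v : 'rV[R]_n) :
  measurable_fun setT (fun x : 'rV[R]_n => x + v)%R.
Proof.
apply: measurable_fun_rV => i.
rewrite (_ : (fun _ => _) = fun s : 'rV[R]_n => (s ord0 i + v ord0 i)%R).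
  by apply: measurable_funD => //; exact: measurable_coord.
by apply/funext => x; rewrite mxE.
Qed.

(** Induction on the dimension: the induction hypothesis translates each slice by the tail of [v],
    and the one-dimensional case translates the slicing variable. *)
Lemma lebesgue_rV_shift n (v : 'rV[R]_n) (A : set 'rV[R]_n) : measurable A ->
  lebesgue_rV n ((fun x => x + v)%R @^-1` A) = lebesgue_rV n A.
Proof.
elim: n v A => [|n IH] v A mA.
  congr (lebesgue_rV 0 _); apply/seteqP; split=> x /=; rewrite (_ : (x + v)%R = x)//;
  by apply/rowP; case.
rewrite /= /lebesgue_rV_product /pushforward /= /product_measure1.
set B := @rV_cons R n @^-1` A.
have mB : measurable B.
  by rewrite -[X in measurable X]setTI; apply: measurable_rV_cons.
pose F t := lebesgue_rV n (xsection B t).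
have mF : measurable_fun setT F by exact: measurable_fun_xsection.
transitivity (\int[lebesgue_measure]_t F (t + v ord0 ord0)%R).
  apply: eq_integral => t _ /=.
  rewrite /F -(IH (rV_uncons v).2 (xsection B (t + v ord0 ord0)%R)); last first.
    exact: measurable_xsection.
  congr (lebesgue_rV n _); apply/seteqP; split=> y; rewrite /xsection/= !inE /B /=;
  by rewrite rV_cons_shift.
pose phi : measurableTypeR R -> measurableTypeR R := fun t => (t + v ord0 ord0)%R.
have mphi : measurable_fun setT phi by exact: measurable_funD.
have := ge0_integral_pushforward mphi lebesgue_measure measurableT mF.
rewrite preimage_setT => <- //; apply: eq_measure_integral => /= C mC _.
exact: lebesgue_measure_shift.
Qed.

Section integral_shift.
Context {n : nat} (v : 'rV[R]_n).
Local Notation mu := (@lebesgue_rV R n).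

Lemma ge0_integral_shift (f : 'rV[R]_n -> \bar R) :
  measurable_fun setT f -> (forall x, 0 <= f x) ->
  \int[mu]_x f (x + v)%R = \int[mu]_x f x.
Proof.
move=> mf f0.
have := ge0_integral_pushforward (measurable_shift v) mu measurableT mf.
rewrite preimage_setT => <- //; apply: eq_measure_integral => [|? C mC _]; first exact: measurable_shift.
exact: (lebesgue_rV_shift v mC).
Qed.

Lemma integrable_shift (f : 'rV[R]_n -> \bar R) :
  mu.-integrable setT f -> mu.-integrable setT (fun x => f (x + v)%R).
Proof.
move=> /integrableP[mf fi]; apply/integrableP; split.
  exact: (measurableT_comp mf (measurable_shift v)).
rewrite (ge0_integral_shift (f := fun x => `|f x|))//.
exact: measurableT_comp.
Qed.

Lemma integral_shift (f : 'rV[R]_n -> \bar R) :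
  mu.-integrable setT f -> \int[mu]_x f (x + v)%R = \int[mu]_x f x.
Proof.
move=> fi; have mf := measurable_int mu fi.
have := @integral_pushforward _ _ _ _ _ _ (measurable_shift v) mu setT f mf.
rewrite preimage_setT => /(_ (integrable_shift fi) measurableT) <-.
apply: eq_measure_integral => [|? C mC _]; first exact: measurable_shift.
exact: (lebesgue_rV_shift v mC).
Qed.

End integral_shift.

Lemma negligible_shift n (v : 'rV[R]_n) (A : set 'rV[R]_n) :
  (lebesgue_rV n).-negligible A ->
  (lebesgue_rV n).-negligible ((fun x => x + v)%R @^-1` A).
Proof.
move=> [B [mB B0 AB]]; exists ((fun x => x + v)%R @^-1` B); split.
- by rewrite -[X in measurable X]setTI; exact: measurable_shift.
- by rewrite lebesgue_rV_shift.
- by move=> x /=; exact: AB.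
Qed.

Lemma lebesgue_rV_box n (a b : 'rV[R]_n) : lebesgue_rV n (box a b) < +oo.
Proof.
elim: n a b => [|n IH] a b; first by rewrite /= diracE ltry.
rewrite /= /lebesgue_rV_product /pushforward.
have := @product_measure1E _ _ _ _ R lebesgue_measure (lebesgue_rV n)
  `]a ord0 ord0, b ord0 ord0[%classic (box (rV_uncons a).2 (rV_uncons b).2).
rewrite (_ : _ `*` _ = @rV_cons R n @^-1` box a b).
  move=> ->//; last exact: measurable_box.
  apply: lte_mul_pinfty => //; rewrite ge0_fin_numE//.
  have : lebesgue_measure `]a ord0 ord0, b ord0 ord0[%classic < +oo.
    by rewrite lebesgue_measure_itv/=; case: ifP; rewrite ltry.
  by [].
apply/seteqP; split=> -[t y]/=; rewrite in_itv/=.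
  move=> [th yh] i; rewrite -(rV_unconsK a) -(rV_unconsK b).
  rewrite /rV_cons !mxE /=; case: splitP => j ij; rewrite !mxE//.
  by have := yh j; rewrite !mxE.
move=> h; split.
  by have := h ord0; rewrite /rV_cons mxE; case: splitP => j //; rewrite mxE.
move=> i; have := h (rshift 1 i); rewrite /rV_cons !mxE /=.
case: splitP => [j /= ij|j /= ij]; first by have := ltn_ord j; rewrite -ij.
by rewrite (_ : j = i) // ; apply/val_inj; move: ij => [].
Qed.

End translation.

(** * Smooth functions of one variable: bumps and moving integrals *)

Section smooth1.
Context {R : realType}.
Implicit Types (b c : R -> R) (n m : nat).

(** [Cn n] provides [n + 1] derivatives, [Cn 0] being differentiability. Continuity is not listed,
    since differentiability implies it. *)
Fixpoint Cn n b : Prop :=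
  (forall x, derivable b x 1) /\ if n is m.+1 then Cn m (derive1 b) else True.

Definition smooth1 b := forall n, Cn n b.

Lemma CnW n b : Cn n.+1 b -> Cn n b.
Proof.
elim: n b => [|n IH] b [db]; first by [].
by move=> h; split=> //; exact: IH.
Qed.

Lemma Cn_derivable n b x : Cn n b -> derivable b x 1.
Proof. by case: n => [|n] []. Qed.

Lemma smooth1_derivable b x : smooth1 b -> derivable b x 1.
Proof. by move=> /(_ 0%N)/Cn_derivable. Qed.

Lemma smooth1_derive b : smooth1 b -> smooth1 (derive1 b).
Proof. by move=> sb n; have [] := sb n.+1. Qed.

Lemma smooth1_continuous b : smooth1 b -> continuous b.
Proof.
move=> sb x; apply: differentiable_continuous.
by apply/derivable1_diffP; exact: smooth1_derivable.
Qed.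

Lemma CnD n b c : Cn n b -> Cn n c -> Cn n (fun x => b x + c x).
Proof.
elim: n b c => [|n IH] b c [db Cb] [dc Cc]; (split=> [x|]; first exact: derivableD) => //.
rewrite (_ : derive1 _ = fun x => (derive1 b) x + (derive1 c) x); first exact: IH.
by apply/funext => x; rewrite !derive1E deriveD.
Qed.

Lemma CnZ n (k : R) b : Cn n b -> Cn n (fun x => k * b x).
Proof.
elim: n b => [|n IH] b [db Cb]; (split=> [x|]; first exact: derivableZ) => //.
rewrite (_ : derive1 _ = fun x => k * (derive1 b) x); first exact: IH.
by apply/funext => x; rewrite !derive1E deriveZ.
Qed.

Lemma CnM n b c : Cn n b -> Cn n c -> Cn n (fun x => b x * c x).
Proof.
elim: n b c => [|n IH] b c /[dup] Cnb [db Cb] /[dup] Cnc [dc Cc];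
  (split=> [x|]; first exact: derivableM) => //.
rewrite (_ : derive1 _ = fun x => b x * (derive1 c) x + c x * (derive1 b) x).
  by apply: CnD; apply: IH => //; exact: CnW.
by apply/funext => x; rewrite !derive1E deriveM.
Qed.

Lemma is_derive_affine b (k l x : R) : derivable b (k * x + l) 1 ->
  is_derive x 1 (fun x => b (k * x + l)) (k * (derive1 b) (k * x + l)).
Proof.
move=> db.
have da : is_derive x 1 (fun x : R => k * x + l) k.
  by apply: is_derive_eq; rewrite addr0 /GRing.scale/= mulr1.
have db' : is_derive (k * x + l) 1 b ((derive1 b) (k * x + l)).
  by rewrite derive1E; exact: derivableP.
by rewrite mulrC; exact: (@is_derive1_comp _ b (fun x : R => k * x + l)).
Qed.

Lemma Cn_affine n b (k l : R) : Cn n b -> Cn n (fun x => b (k * x + l)).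
Proof.
elim: n b => [|n IH] b [db Cb];
  (split=> [x|]; first by have [] := is_derive_affine (db (k * x + l))) => //.
rewrite (_ : derive1 _ = fun x => k * (derive1 b) (k * x + l)).
  by apply: CnZ; exact: (IH (derive1 b)).
apply/funext => y; rewrite derive1E.
by have [_ ->] := is_derive_affine (db (k * y + l)).
Qed.

(* The functions [x^-m exp (-1/x)] on [x > 0] span a space stable under derivation. *)
Definition em m (x : R) : R := if 0 < x then x ^- m * expR (- x^-1) else 0.

(** The exponential at [1/x] dominates the term of degree [m + 2] of its series. The two spare
    powers of [x] give derivative 0 at the origin. *)
Lemma em_bound m (x : R) : `|em m x| <= m.+2`!%:R * x ^+ 2.
Proof.
rewrite /em; case: ifPn => [x0|_]; last first.
  by rewrite normr0 mulr_ge0// ?ler0n ?sqr_ge0.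
rewrite ger0_norm; last first.
  by rewrite mulr_ge0 ?expR_ge0// invr_ge0 exprn_ge0// ltW.
rewrite expRN ler_pdivrMr ?expR_gt0//.
have := @expR_ge1Dxn R x^-1 m.+1; rewrite invr_ge0 => /(_ (ltW x0)) h.
have F0 : 0 < m.+2`!%:R :> R by rewrite ltr0n fact_gt0.
have h' : x^-1 ^+ m.+2 <= m.+2`!%:R * expR x^-1.
  by rewrite -ler_pdivrMl// mulrC; apply: le_trans h; rewrite lerDr.
have -> : x ^- m = x ^+ 2 * x^-1 ^+ m.+2.
  rewrite -[m.+2]addn2 exprD mulrCA !exprVn mulfV ?mulr1//.
  by rewrite expf_neq0// gt_eqF.
by have := ler_wpM2l (sqr_ge0 x) h'; rewrite [X in _ <= X -> _]mulrCA mulrA.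
Qed.

(** To the right of 0 this is the chain rule for [z^m exp (-z)] composed with the inverse; to the
    left the function is locally null; at 0 the difference quotient is [O(|h|)] by [em_bound]. *)
Lemma is_derive_em m (x : R) :
  is_derive x 1 (em m) (em m.+2 x - m%:R * em m.+1 x).
Proof.
have [x0|x0|->] := ltgtP x 0.
- apply: (@near_eq_is_derive _ _ _ (cst 0)); rewrite ?oner_eq0//.
    near=> y; rewrite /em/= ltNge (_ : y <= 0)//; apply/ltW.
    by near: y; exact: lt_nbhsl.
  rewrite /em ltNge (ltW x0)/= mulr0 subr0; exact: is_derive_cst.
- pose f (y : R) := y ^- m * expR (- y^-1).
  apply: (@near_eq_is_derive _ _ _ f); rewrite ?oner_eq0//.
    near=> y; rewrite /em/= (_ : 0 < y)//.
    by near: y; exact: lt_nbhsr.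
  rewrite /em x0.
  have x0' : x != 0 by rewrite gt_eqF.
  have dV : is_derive x 1 (@GRing.inv R) (- x ^- 2).
    apply: DeriveDef; first exact: (@derivableV _ _ idfun x 1 x0' (@derivable_id _ _ _ _)).
    rewrite (@deriveV _ _ idfun x 1 x0' (@derivable_id _ _ _ _)) derive_id.
    by rewrite /GRing.scale/= mulr1.
  have dE : is_derive x^-1 1 (fun z : R => expR (- z)) (- expR (- x^-1)).
    apply: (is_derive_eq (@is_derive1_comp _ expR -%R x^-1 _ _ _ _)).
    by rewrite mulrN1.
  have dg := is_deriveM (is_deriveX m (is_derive_id x^-1 (1 : R))) dE.
  have -> : f = (id ^+ m * (fun z : R => expR (- z))) \o @GRing.inv R.
    by apply/funext => y; rewrite /f/= !fctE -exprVn.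
  apply: (is_derive_eq (@is_derive1_comp _ _ _ x _ _ dg dV)).
  rewrite !fctE /GRing.scale /= mulr1 -!exprVn.
  by case: m {f dg} => [|m] /=; rewrite ?expr0 ?exprS; ring.
- have h0 : h^-1 *: (em m (h *: (1 : R) + 0) - em m 0) @[h --> (0 : R)^'] --> (0 : R).
    apply/cvgrPdist_le => /= e e0.
    near=> h.
    have hn0 : h != 0 by near: h; exact: nbhs_dnbhs_neq.
    rewrite sub0r normrN [em m 0]/em ltxx subr0 addr0 /GRing.scale/= mulr1.
    rewrite normrM normfV ler_pdivrMl ?normr_gt0//.
    apply: le_trans (em_bound m h) _.
    rewrite -real_normK ?num_real// expr2 mulrA mulrC ler_wpM2l//.
    rewrite -ler_pdivlMl ?ltr0n ?fact_gt0//.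
    near: h; apply: dnbhs0_le.
    by rewrite mulr_gt0// invr_gt0 ltr0n fact_gt0.
  apply: DeriveDef; first by apply/cvg_ex; exists 0.
  rewrite /em ltxx mulr0 subr0; exact: cvg_lim h0.
Unshelve. all: by end_near. Qed.

Lemma smooth1_em m : smooth1 (em m).
Proof.
move=> n; elim: n m => [|n IH] m; (split=> [x|]; first by have [] := is_derive_em m x) => //.
rewrite (_ : derive1 _ = fun x => em m.+2 x + (- m%:R) * em m.+1 x).
  by apply: CnD => //; exact: CnZ.
by apply/funext => x; rewrite derive1E mulNr; have [_ ->] := is_derive_em m x.
Qed.

(** The product of [exp (-1 / ((k+1)(x-a)))] and [exp (-1 / ((k+1)(b-x)))] on []a, b[], and 0
    elsewhere. Since [k + 1] drives both exponents to 0, the bumps tend to the indicator of []a,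
    b[]. The arguments have the form required by [Cn_affine]. *)
Definition bump (a b : R) (k : nat) (x : R) : R :=
  em 0 (k.+1%:R * x + - (k.+1%:R * a)) * em 0 (- k.+1%:R * x + k.+1%:R * b).

Lemma smooth1_bump (a b : R) k : smooth1 (bump a b k).
Proof. by move=> n; apply: CnM; apply: Cn_affine; exact: smooth1_em. Qed.

Lemma em0_ge0 x : 0 <= em 0 x.
Proof.
by rewrite /em; case: ifP => // _; rewrite mulr_ge0 ?expR_ge0// invr_ge0 expr0.
Qed.

Lemma em0_le1 x : em 0 x <= 1.
Proof.
rewrite /em; case: ifP => // x0; rewrite expr0 invr1 mul1r -expR0 ler_expR.
by rewrite oppr_le0 invr_ge0 ltW.
Qed.

Lemma bump_ge0 (a b : R) k x : 0 <= bump a b k x.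
Proof. by rewrite mulr_ge0 ?em0_ge0. Qed.

Lemma bump_le1 (a b : R) k x : bump a b k x <= 1.
Proof. by rewrite mulr_ile1 ?em0_ge0 ?em0_le1. Qed.

Lemma bump_supp (a b : R) k x : bump a b k x != 0 -> a < x < b.
Proof.
have k0 : 0 < k.+1%:R :> R by rewrite ltr0n.
apply: contraNT; rewrite negb_and -!leNgt /bump /em => /orP[xa|bx].
  rewrite (_ : _ < _ = false) ?mul0r//; apply/negbTE; rewrite -leNgt.
  by rewrite subr_le0 ler_pM2l.
rewrite [X in _ * (if X then _ else _)](_ : _ = false) ?mulr0//.
apply/negbTE; rewrite -leNgt mulNr addrC subr_le0.
by rewrite ler_pM2l.
Qed.

Lemma em0_cvg (y : R) : 0 < y -> em 0 (k.+1%:R * y) @[k --> \oo] --> (1 : R).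
Proof.
move=> y0.
rewrite (_ : (fun k => _) = fun k => expR (- (harmonic k * y^-1))).
  rewrite -[X in _ --> X]expR0 -oppr0 -(mul0r y^-1).
  apply: continuous_cvg; first exact: continuous_expR.
  by apply: cvgN; apply: cvgMl; exact: cvg_harmonic.
apply/funext => k; rewrite /em pmulr_rgt0 ?ltr0n// y0 expr0 invr1 mul1r.
by rewrite invfM.
Qed.

Lemma bump_cvg (a b : R) x : a < x < b -> bump a b k x @[k --> \oo] --> (1 : R).
Proof.
move=> /andP[ax xb]; rewrite -[X in _ --> X]mulr1.
rewrite (_ : (fun k => _) = fun k => em 0 (k.+1%:R * (x - a)) * em 0 (k.+1%:R * (b - x))).
  by apply: cvgM; apply: em0_cvg; rewrite subr_gt0.
by apply/funext => k; rewrite /bump mulrBr mulrBr mulNr [X in _ * em 0 X]addrC.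
Qed.

Section window.
Local Notation mu := (@lebesgue_measure R).

Lemma integral_shift1 (f : R -> \bar R) (a : R) : mu.-integrable setT f ->
  (\int[mu]_x f (x + a)%R = \int[mu]_x f x)%E.
Proof.
move=> fi; have mf := measurable_int mu fi.
pose phi : measurableTypeR R -> measurableTypeR R := fun t => (t + a)%R.
have mphi : measurable_fun setT phi by exact: measurable_funD.
have fi' : mu.-integrable setT (f \o phi).
  have mfp : measurable_fun setT (f \o phi) by exact: (measurableT_comp mf mphi).
  apply/integrableP; split => //.
  have maf : measurable_fun setT (fun x => `|f x|)%E by exact: measurableT_comp.
  have := ge0_integral_pushforward mphi mu measurableT maf.
  rewrite preimage_setT /= => <- //; rewrite (eq_measure_integral mu) => [|C mC _].
    by move/integrableP : fi => [].
  exact: lebesgue_measure_shift.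
have := @integral_pushforward _ _ _ _ _ _ mphi mu setT f mf.
rewrite preimage_setT => /(_ fi' measurableT) /= <-.
apply: eq_measure_integral => C mC _; exact: lebesgue_measure_shift.
Qed.

Definition window (h : R) b (t : R) : R := \int[mu]_(s in `[0, h]) b (t + s).

(** The window is the increment [F (t + h) - F t] of a primitive [F] of [b]. *)
Lemma is_derive_window (h : R) b (t : R) : 0 <= h -> continuous b ->
  mu.-integrable setT (EFin \o b) ->
  is_derive t 1 (window h b) (b (t + h) - b t).
Proof.
move=> h0 cb ib.
(* Integrability on the whole line allows a primitive starting at -oo, which avoids a case
   distinction on the sign of [t]. *)
pose F (x : R) := \int[mu]_(s in `]-oo, x]) b s.
have wE (x : R) : window h b x = F (x + h) - F x.
  rewrite /F Rintegral_itvB.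
  - rewrite /window /Rintegral; congr fine.
    rewrite -integral_itv_obnd_cbnd; last first.
      apply: measurable_funTS; apply/measurable_EFinP.
      apply: measurableT_comp; first exact: continuous_measurable_fun.
      exact: measurable_funD.
    rewrite [LHS]integral_mkcond [RHS]integral_mkcond -[RHS](integral_shift1 x); last first.
      by apply: (integrable_mkcond _ _).1 => //; apply: integrableS ib.
    apply: eq_integral => s _; rewrite !patchE [x + s]addrC /=.
    congr (if _ then _ else _); rewrite !mem_setE /= !in_itv/=.
    by rewrite ltrDr addrC lerD2l.
  - by apply: integrableS ib.
  - by [].
  - by rewrite bnd_simp lerDl.
have dF (x : R) : is_derive x 1 F (b x).
  have xx : x < x + 1 by rewrite ltrDl.
  have ix : mu.-integrable [set` Interval -oo%O (BRight (x + 1))] (EFin \o b).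
    by apply: integrableS ib.
  have /(_ _ (cb x))[|dFx <-] := continuous_FTC1 xx ix; first by rewrite ltNyr.
  by rewrite derive1E; exact: derivableP.
rewrite (_ : window h b = (fun x => F (1 * x + h)) - F).
  have := is_derive_affine (k := 1) (l := h) (x := t) (b := F).
  have [dF1 dF2] := dF (t + h).
  rewrite !mul1r => /(_ dF1) dFh.
  apply: (is_derive_eq (is_deriveB dFh (dF t))).
  by rewrite derive1E dF2.
by apply/funext => x; rewrite wE fctE mul1r.
Qed.

End window.

End smooth1.

(** * Test functions that are products of one-variable functions *)

Section tensor.
Context {R : realType} {N : nat}.
Local Notation E := 'rV[R]_N.
Implicit Types (b : 'I_N -> R -> R) (x : E) (j : 'I_N).

Definition tensor b x : R := \prod_i b i (x ord0 i).

Definition upd b j (c : R -> R) : 'I_N -> R -> R :=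
  fun i => if i == j then c else b i.

Lemma tensorD1 b j x :
  tensor b x = b j (x ord0 j) * \prod_(i | i != j) b i (x ord0 i).
Proof. by rewrite /tensor (bigD1 j). Qed.

Lemma tensor_upd b j c x :
  tensor (upd b j c) x = c (x ord0 j) * \prod_(i | i != j) b i (x ord0 i).
Proof.
rewrite (tensorD1 _ j) /upd eqxx; congr (_ * _).
by apply: eq_bigr => i /negbTE ->.
Qed.

Lemma tensor_shift b j x (t : R) : tensor b (x + t *: delta_mx ord0 j) =
  b j (x ord0 j + t) * \prod_(i | i != j) b i (x ord0 i).
Proof.
rewrite (tensorD1 _ j) !mxE !eqxx mulr1; congr (_ * _).
by apply: eq_bigr => i ij; rewrite !mxE (negbTE ij) mulr0 addr0.
Qed.

Lemma is_derive_tensor b j x (d : R) : is_derive (x ord0 j) 1 (b j) d ->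
  is_derive x (delta_mx ord0 j) (tensor b)
    (d * \prod_(i | i != j) b i (x ord0 i)).
Proof.
move=> [db <-]; set C := \prod_(i | _) _.
suff h : h^-1 *: ((tensor b \o shift x) (h *: delta_mx ord0 j) - tensor b x)
    @[h --> (0 : R)^'] --> 'D_1 (b j) (x ord0 j) * C.
  apply: DeriveDef; first by apply/cvg_ex; exists ('D_1 (b j) (x ord0 j) * C).
  by apply: cvg_lim h.
rewrite (_ : (fun h : R => _) = fun h => (h^-1 *: ((b j \o shift (x ord0 j)) (h *: (1 : R)) - b j (x ord0 j))) * C).
  by apply: cvgMl; exact: db.
apply/funext => h /=; rewrite [_ *: delta_mx _ _ + _]addrC tensor_shift -/C (tensorD1 _ j) -/C.
by rewrite /GRing.scale/= mulr1 [h + _]addrC -mulrBl mulrA.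
Qed.

Lemma partial_tensor b j : (forall t, derivable (b j) t 1) ->
  partial j (tensor b) = tensor (upd b j (derive1 (b j))).
Proof.
move=> db; apply/funext => x; rewrite /partial tensor_upd derive1E.
have db' : is_derive (x ord0 j) 1 (b j) ('D_1 (b j) (x ord0 j)) by exact: derivableP.
by have [_ ->] := is_derive_tensor db'.
Qed.

Lemma continuous_tensor b : (forall i, continuous (b i)) -> continuous (tensor b).
Proof.
move=> cb; rewrite /tensor.
elim: (index_enum _) => [|i r IH] x.
  under eq_fun do rewrite big_nil.
  exact: cst_continuous.
under eq_fun do rewrite big_cons.
apply: continuousM; last exact: IH.
apply: continuous_comp; last exact: cb.
exact: coord_continuous.
Qed.

(** A partial derivative of a product is again a product, with one factor differentiated, so all
    iterated partial derivatives stay in this class. *)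
Lemma smooth_tensor b : (forall i, smooth1 (b i)) -> smooth (tensor b).
Proof.
move=> sb s; have [c sc ->] : exists2 c, (forall i, smooth1 (c i)) &
    foldr partial (tensor b) s = tensor c.
  elim: s => [|j s [c sc /= ->]]; first by exists b.
  exists (upd c j (derive1 (c j))).
    by move=> i; rewrite /upd; case: eqP => // _; exact: smooth1_derive.
  by apply: partial_tensor => t; exact: smooth1_derivable.
split; first by apply: continuous_tensor => i; exact: smooth1_continuous.
move=> j x; have db' : is_derive (x ord0 j) 1 (c j) ('D_1 (c j) (x ord0 j)).
  by apply: derivableP; exact: smooth1_derivable.
by have [] := is_derive_tensor db'.
Qed.

Definition cbox (a c : E) : set E :=
  [set x | forall i, a ord0 i <= x ord0 i <= c ord0 i].

Lemma compact_cbox (a c : E) : compact (cbox a c).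
Proof.
rewrite (_ : cbox a c = [set v : E | forall i,
    `[a ord0 i, c ord0 i]%classic (v ord0 i)]).
  apply: (@rV_compact _ _ (fun i => `[a ord0 i, c ord0 i]%classic)) => i;
   exact: segment_compact.
by apply/seteqP; split=> x xac i; have := xac i; rewrite /= in_itv.
Qed.

Lemma test_tensor (U : set E) b (a c : E) : cbox a c `<=` U ->
  (forall i, smooth1 (b i)) ->
  (forall i t, b i t != 0 -> a ord0 i <= t <= c ord0 i) ->
  test_function U (tensor b).
Proof.
move=> acU sb bac.
have cac : closed (cbox a c).
  by apply: compact_closed; [exact: norm_hausdorff|exact: compact_cbox].
have supp_ac : closure [set x | tensor b x != 0] `<=` cbox a c.
  apply: (@subset_trans _ (closure (cbox a c))); last by move/closure_id : cac => <-.
  apply: closureS => x /= bx i; apply: bac; apply: contraNN bx => /eqP bi.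
  by rewrite (tensorD1 _ i) bi mul0r.
split; [exact: smooth_tensor| |exact: subset_trans acU].
by apply: subclosed_compact (@compact_cbox a c) supp_ac; exact: closed_closure.
Qed.

End tensor.

(** * The fundamental lemma of the calculus of variations on a box *)

Section fundamental_lemma.
Context {R : realType} {N : nat}.
Local Notation E := 'rV[R]_N.
Local Notation mu := (@lebesgue_rV R N).
Implicit Types (x a c : E) (v : E -> R).

Definition bump_rV a c k : E -> R :=
  tensor (fun i => bump (a ord0 i) (c ord0 i) k).

Lemma bump_rV_ge0 a c k x : 0 <= bump_rV a c k x.
Proof. by apply: prodr_ge0 => i _; exact: bump_ge0. Qed.

Lemma bump_rV_le1 a c k x : bump_rV a c k x <= 1.
Proof.
rewrite /bump_rV /tensor.
by apply: prodr_ile1 => i _; rewrite bump_ge0 bump_le1.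
Qed.

Lemma continuous_bump_rV a c k : continuous (bump_rV a c k).
Proof.
by apply: continuous_tensor => i; apply: smooth1_continuous; exact: smooth1_bump.
Qed.

Lemma bump_rV_cvg a c x :
  bump_rV a c k x @[k --> \oo] --> (\1_(box a c) x : R).
Proof.
rewrite indicE; have [|] := boolP (x \in box a c); rewrite ?notin_setE ?inE.
  move=> xac; rewrite /bump_rV /tensor.
  elim: (index_enum _) => [|i r IH].
    under eq_fun do rewrite big_nil.
    exact: cvg_cst.
  under eq_fun do rewrite big_cons.
  by have := cvgM (bump_cvg (xac i)) IH; rewrite mulr1; exact.
move=> xac; rewrite (_ : (fun k => _) = cst 0); first exact: cvg_cst.
apply/funext => k; apply/eqP; apply: contra_notT xac => h i.
apply: bump_supp (k) _ _; apply: contraNN h => /eqP h.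
by rewrite /bump_rV (tensorD1 _ i) h mul0r.
Qed.

Lemma boxI (a c a' c' : E) : box a c `&` box a' c' =
  box (\row_i Num.max (a ord0 i) (a' ord0 i)) (\row_i Num.min (c ord0 i) (c' ord0 i)).
Proof.
apply/seteqP; split=> x.
  by move=> [h h'] i; rewrite !mxE gt_max lt_min; move: (h i) (h' i) => /andP[-> ->] /andP[-> ->].
by move=> h; split=> i; have := h i; rewrite !mxE gt_max lt_min => /andP[/andP[? ?] /andP[? ?]];
  apply/andP.
Qed.

Lemma g_sigma_box : @measurable _ E = <<s [set box p.1 p.2 | p in [set: E * E]] >>.
Proof.
apply/seteqP; split.
  rewrite {1}(@g_sigma_rat_box R N); apply: smallest_sub; first exact: smallest_sigma_algebra.
  move=> _ [p _ <-]; apply: sub_sigma_algebra.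
  by exists (map_mx ratr p.1, map_mx ratr p.2).
apply: smallest_sub; first exact: sigma_algebra_measurable.
by move=> _ [p _ <-]; exact: measurable_box.
Qed.

(** Bumps tend to indicators, so by dominated convergence [v] has integral 0 over every sub-box.
    Boxes are a pi-system generating the sigma-algebra; by Dynkin induction the integral vanishes
    over every measurable set. *)
Lemma fundamental_lemma_box a c v : mu.-integrable (box a c) (EFin \o v) ->
  (forall a' c' k, (forall i, a ord0 i <= a' ord0 i) ->
    (forall i, c' ord0 i <= c ord0 i) ->
    (\int[mu]_(x in box a c) (v x * bump_rV a' c' k x)%:E = 0)%E) ->
  {ae mu, forall x, box a c x -> v x = 0}.
Proof.
move=> iv v0; set B := box a c.
have {}iv : mu.-integrable B (EFin \o v) := iv.
have mB : measurable B by exact: measurable_box.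
have vB S : measurable S -> mu.-integrable (B `&` S) (EFin \o v).
  move=> mS; exact: (integrableS mB (measurableI B S mB mS) (@subIsetl _ B S) iv).
have mv : measurable_fun B v by apply/measurable_EFinP; exact: (measurable_int mu iv).
have sub a' c' : (forall i, a ord0 i <= a' ord0 i) ->
    (forall i, c' ord0 i <= c ord0 i) ->
    (\int[mu]_(x in B `&` box a' c') (v x)%:E = 0)%E.
  move=> aa' c'c.
  have := @dominated_convergence _ _ R mu B mB
    (fun k x => (v x * bump_rV a' c' k x)%:E)
    (fun x => (v x * \1_(box a' c') x)%:E) (abse \o (EFin \o v)).
  case.
  - move=> k; apply/measurable_EFinP; apply: measurable_funM => //.
    apply: measurable_funTS; apply: rV_continuous_measurable.
    exact: continuous_bump_rV.
  - apply/measurable_EFinP; apply: measurable_funM => //.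
    by apply: measurable_funTS; apply: measurable_indic; exact: measurable_box.
  - apply: aeW => x _; apply: cvg_EFin; first exact: nearW.
    by apply: cvgMr; exact: bump_rV_cvg.
  - exact: integrable_abse.
  - apply: aeW => x k _ /=; rewrite lee_fin normrM ler_piMr//.
    by rewrite ger0_norm ?bump_rV_ge0 ?bump_rV_le1.
  move=> _ _ /=; under eq_fun do rewrite v0//.
  move=> /(cvg_unique _ (cvg_cst _)) h; rewrite integral_mkcondr h//.
  by apply: eq_integral => x _; rewrite patchE indicE; case: ifP; rewrite ?mulr1 ?mulr0.
have all : forall S, measurable S -> (\int[mu]_(x in B `&` S) (v x)%:E = 0)%E.
  move=> S; rewrite {1}g_sigma_box; move: S.
  apply: (dynkin_induction (P := fun S => \int[mu]_(x in B `&` S) (v x)%:E = 0)%E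
    g_sigma_box).
  - move=> _ _ [[a1 c1] _ <-] [[a2 c2] _ <-] /=; rewrite boxI.
    by eexists (_, _).
  - by rewrite setIT -(setIid B); exact: sub.
  - move=> _ [[a1 c1] _ <-] /=.
    (* The box of the pi-system is cut down to [B], since only sub-boxes of [B] are tested. *)
    rewrite -[X in X `&` _]setIid -setIA {2}/B boxI.
    apply: sub => i; rewrite mxE; first by rewrite le_max lexx.
    by rewrite ge_min lexx.
  - move=> S mS S0.
    have : (\int[mu]_(x in B) (v x)%:E = 0)%E by rewrite -(setIid B); exact: sub.
    rewrite -{1}(setIT B) -(setUv S) setIUr integral_setU//.
    + by rewrite S0 add0e.
    + exact: measurableI.
    + by apply: measurableI => //; exact: measurableC.
    + rewrite -setIUr setUv setIT; exact: (measurable_int mu).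
    + by apply/disj_setPS => x [[_ Sx] [_]].
  - move=> F mF tF F0.
    rewrite setI_bigcupr integral_bigcup.
    + by apply: eseries0 => k _ _.
    + by apply: trivIset_setIl.
    + by move=> k; exact: measurableI.
    + rewrite -setI_bigcupr; apply: vB; exact: bigcup_measurable.
have v_ae : ae_eq mu B (EFin \o v) (cst 0%E).
  apply: integral_ae_eq => // S SB mS; rewrite integral0.
  have -> : S = B `&` S by apply/esym/setIidPr.
  exact: all.
by apply: filterS v_ae => x /= h /h [].
Qed.

End fundamental_lemma.

(** * Integrals along segments parallel to a coordinate axis *)

Section integrable_EFin.
Context {R : realType} d (T : measurableType d) (m : {measure set T -> \bar R}).
Context (D : set T) (mD : measurable D).
Implicit Types f g : T -> R.

Lemma integrableB_EFin f g : m.-integrable D (EFin \o f) ->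
  m.-integrable D (EFin \o g) -> m.-integrable D (EFin \o (fun x => f x - g x)).
Proof. by move=> fi gi; exact: (integrableB mD fi gi). Qed.

Lemma integrableD_EFin f g : m.-integrable D (EFin \o f) ->
  m.-integrable D (EFin \o g) -> m.-integrable D (EFin \o (fun x => f x + g x)).
Proof. by move=> fi gi; exact: (integrableD mD fi gi). Qed.

Lemma integrableZl_EFin (r : R) f : m.-integrable D (EFin \o f) ->
  m.-integrable D (EFin \o (fun x => r * f x)).
Proof. by move=> fi; exact: (integrableZl mD r fi). Qed.

End integrable_EFin.

Section line_average.
Context {R : realType} {N : nat} (j : 'I_N).
Local Notation E := 'rV[R]_N.
Local Notation mu := (@lebesgue_rV R N).
Local Notation leb := (@lebesgue_measure R).
Local Notation EL := (E * measurableTypeR R)%type.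
Local Notation e := (delta_mx ord0 j : E).
Implicit Types (f g phi : E -> R) (x : E) (s h : R).

Lemma measurable_line : measurable_fun setT (fun p : EL => p.1 - p.2 *: e).
Proof.
apply: measurable_fun_rV => i.
under eq_fun do rewrite !mxE.
apply: measurable_funB.
  exact: (measurableT_comp (measurable_coord i) measurable_fst).
apply: measurable_funM => //; exact: measurable_snd.
Qed.

Lemma integrableM_bounded d (T : measurableType d) (m : {measure set T -> \bar R})
    (f phi : T -> R) (M : R) : m.-integrable setT (EFin \o f) ->
  measurable_fun setT phi -> (forall x : T, `|phi x| <= M) ->
  m.-integrable setT (EFin \o (fun x : T => f x * phi x)).
Proof.
move=> fi mphi phiM.
apply: (integrableMl measurableT fi mphi); exists M; split; first exact: num_real.
by move=> y My x _ /=; exact: le_trans (phiM x) (ltW My).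
Qed.

Lemma segment_lty h : (leb `[0%R, h]%classic < +oo)%E.
Proof. by rewrite lebesgue_measure_itv/=; case: ifP; rewrite ltry. Qed.

(** There is no division by [h]: this is the increment, from [x - h e] to [x], expected of a
    function whose [j]-th derivative is [g]. *)
Definition line_avg g h x : R := \int[leb]_(s in `[0, h]) g (x - s *: e).

Definition line_kernel g h (p : EL) : R :=
  \1_(`[0, h]%classic) p.2 * g (p.1 - p.2 *: e).

Lemma line_avgE g h x : line_avg g h x = \int[leb]_s line_kernel g h (x, s).
Proof.
rewrite /line_avg Rintegral_mkcond; apply: eq_Rintegral => s _.
by rewrite patchE /line_kernel indicE /=; case: ifP; rewrite ?mul1r ?mul0r.
Qed.

(** By Tonelli: integrating in the space variable first, translation invariance removes [tau] and
    leaves the integral of [|g|] times the length of the segment. A general [tau] covers both the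
    moving segment and the constant shift 0. *)
Lemma slab_integrable g h (tau : R -> E) : mu.-integrable setT (EFin \o g) ->
  measurable_fun setT (fun p : EL => p.1 + tau p.2) ->
  (mu \x leb)%E.-integrable setT
    (fun p => (\1_(`[0, h]%classic) p.2 * g (p.1 + tau p.2))%:E).
Proof.
move=> ig mtau; have mg : measurable_fun setT g.
  by apply/measurable_EFinP; exact: (measurable_int mu ig).
have mK : measurable_fun setT
    (fun p : EL => \1_(`[0, h]%classic) p.2 * g (p.1 + tau p.2) : R).
  apply: measurable_funM.
    by apply: (measurableT_comp (measurable_indic _)) => //; exact: measurable_snd.
  exact: (measurableT_comp mg mtau).
apply/integrable21ltyP; first exact/measurable_EFinP.
rewrite (eq_integral (fun s : measurableTypeR R => (\1_(`[0, h]%classic) s)%:E * \int[mu]_x `|g x|%:E)%E).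
  rewrite ge0_integralZr//; last 2 first.
  - by apply/measurable_EFinP; exact: measurable_indic.
  - by apply: integral_ge0.
  move/integrableP : ig => [_ ig].
  rewrite integral_indic// setIT muleC lte_mul_pinfty//.
  - by apply: integral_ge0.
  - by rewrite ge0_fin_numE// integral_ge0.
  - exact: segment_lty.
move=> s _; under eq_integral => x _ do rewrite /= normrM EFinM.
rewrite ge0_integralZl//; last first.
  apply/measurable_EFinP; apply: measurableT_comp => //.
  exact: (measurableT_comp mg (measurable_shift (tau s))).
rewrite (ge0_integral_shift (tau s) (f := fun x => `|g x|%:E))//.
  by rewrite ger0_norm.
by apply/measurable_EFinP; exact: measurableT_comp.
Qed.

Lemma line_kernel_integrable g h : mu.-integrable setT (EFin \o g) ->
  (mu \x leb)%E.-integrable setT (EFin \o line_kernel g h).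
Proof. by move=> ig; exact: (slab_integrable (tau := fun s => - (s *: e)) h ig measurable_line). Qed.

Lemma line_avg_integrable g h : mu.-integrable setT (EFin \o g) ->
  mu.-integrable setT (EFin \o line_avg g h).
Proof.
move=> ig; have iK := line_kernel_integrable h ig.
have iF := integrable_fubini_F iK.
have mF := measurable_int _ iF.
apply: (le_integrable _ _ _ iF) => //.
  apply/measurable_EFinP.
  have -> : line_avg g h = fine \o fubini_F leb (EFin \o line_kernel g h).
    by apply/funext => x; rewrite line_avgE.
  exact: (measurableT_comp (fine_measurable measurableT) mF).
move=> x _ /=; rewrite line_avgE /Rintegral /fubini_F /=.
by case: (\int[_]_ _ _)%E => [r| |] //=; rewrite normr0 ?leey.
Qed.

(** Integration along segments has as adjoint the integration along reversed segments, by Fubini and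
    a translation for each [s]. *)
Lemma integral_line_avg g phi h (M : R) : mu.-integrable setT (EFin \o g) ->
  measurable_fun setT phi -> (forall x, `|phi x| <= M) ->
  \int[mu]_x (line_avg g h x * phi x) =
  \int[mu]_x (g x * \int[leb]_(s in `[0, h]) phi (x + s *: e)).
Proof.
move=> ig mphi phiM.
have mg : measurable_fun setT g.
  by apply/measurable_EFinP; exact: (measurable_int mu ig).
have iK := line_kernel_integrable h ig.
have iKphi : (mu \x leb)%E.-integrable setT
    (fun p => (line_kernel g h p * phi p.1)%:E).
  apply: (integrableM_bounded (phi := phi \o fst) (M := M) iK) => [|p].
    exact: (measurableT_comp mphi measurable_fst).
  exact: phiM.
have mline : measurable_fun setT (fun p : EL => p.1 + p.2 *: e).
  apply: measurable_fun_rV => i; under eq_fun do rewrite !mxE.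
  apply: measurable_funD.
    exact: (measurableT_comp (measurable_coord i) measurable_fst).
  by apply: measurable_funM => //; exact: measurable_snd.
pose K' (p : EL) := \1_(`[0, h]%classic) p.2 * (g p.1 * phi (p.1 + p.2 *: e)).
have inner s : (\int[mu]_x (line_kernel g h (x, s) * phi x)%:E =
                \int[mu]_x (K' (x, s))%:E)%E.
  have := @integral_shift R N (- (s *: e))
    (fun x => (\1_(`[0, h]%classic) s * (g x * phi (x + s *: e)))%:E).
  rewrite /K' /line_kernel /= => <-.
    by apply: eq_integral => x _; rewrite subrK mulrA.
  under eq_fun do rewrite EFinM.
  apply: integrableZl => //.
  apply: (integrableM_bounded (phi := fun x => phi (x + s *: e)) (M := M) ig) => //.
  exact: (measurableT_comp mphi (measurable_shift _)).
have mK' : measurable_fun setT K'.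
  apply: measurable_funM.
    by apply: (measurableT_comp (measurable_indic _)) => //; exact: measurable_snd.
  apply: measurable_funM; first exact: (measurableT_comp mg measurable_fst).
  exact: (measurableT_comp mphi mline).
have iK' : (mu \x leb)%E.-integrable setT (EFin \o K').
  rewrite (_ : EFin \o K' = fun p => (\1_(`[0, h]%classic) p.2 * g (p.1 + cst 0 p.2) *
      phi (p.1 + p.2 *: e))%:E); last first.
    by apply/funext => p; rewrite /K' /= addr0 mulrA.
  have mfst : measurable_fun setT (fun p : EL => p.1 + (cst 0 : R -> E) p.2).
    by under eq_fun do rewrite addr0; exact: measurable_fst.
  have iS : (mu \x leb)%E.-integrable setT (EFin \o
      (fun p => \1_(`[0, h]%classic) p.2 * g (p.1 + (cst 0 : R -> E) p.2))).
    exact: (slab_integrable h ig mfst).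
  apply: (integrableM_bounded (phi := fun p : EL => phi (p.1 + p.2 *: e)) (M := M) iS) => //.
  exact: (measurableT_comp mphi mline).
rewrite /Rintegral; congr fine.
transitivity (\int[mu]_x \int[leb]_s (line_kernel g h (x, s) * phi x)%:E)%E.
  (* [line_avg] is the [fine] of an extended integral, so it is known to equal the inner integral
     only where the slice is integrable, that is, almost everywhere. *)
  apply: ae_eq_integral => //.
  - apply/measurable_EFinP; apply: measurable_funM => //; apply/measurable_EFinP.
    exact: (measurable_int _ (line_avg_integrable h ig)).
  - exact: (measurable_int _ (integrable_fubini_F iKphi)).
  - apply: filterS (ae_integrable1 iK) => x ix _.
    rewrite line_avgE EFinM /Rintegral fineK; last exact: integrable_fin_num.
    by rewrite -integralZr.
rewrite (Fubini iKphi) /=.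
under eq_integral do rewrite inner.
rewrite -(Fubini iK').
apply: eq_integral => x _.
have ip : leb.-integrable setT (fun s => (\1_(`[0, h]%classic) s * phi (x + s *: e))%:E).
  have i1 : leb.-integrable setT (EFin \o (\1_(`[0, h]%classic) : measurableTypeR R -> R)).
    exact: integrable_indic_itv.
  apply: (integrableM_bounded (phi := fun s : measurableTypeR R => phi (x + s *: e)) (M := M) i1) => //.
  apply: (measurableT_comp mphi); apply: measurable_fun_rV => i.
  under eq_fun do rewrite !mxE.
  by apply: measurable_funD => //; exact: measurable_funM.
under eq_integral do rewrite /K' /= mulrCA EFinM.
rewrite integralZl// EFinM; congr (_ * _)%E.
rewrite -[LHS]fineK; last exact: integrable_fin_num.
congr (_%:E); congr fine; rewrite [RHS]integral_mkcond; apply: eq_integral => s _.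
by rewrite patchE indicE; case: ifP; rewrite ?mul1r ?mul0r.
Qed.

End line_average.

(** * Increments of a function as line integrals of its weak derivative *)

Section window_bump.
Context {R : realType}.
Local Notation leb := (@lebesgue_measure R).
Implicit Types (a c h t : R).

Lemma bump_integrable a c k : leb.-integrable setT (EFin \o bump a c k).
Proof.
have i1 : leb.-integrable setT (EFin \o (\1_(`]a, c[%classic) : measurableTypeR R -> R)).
  exact: integrable_indic_itv.
apply: (le_integrable _ _ _ i1) => //.
  apply/measurable_EFinP; apply: continuous_measurable_fun.
  by apply: smooth1_continuous; exact: smooth1_bump.
move=> t _ /=; rewrite lee_fin !ger0_norm ?bump_ge0// indicE mem_setE in_itv/=.
have [/bump_supp ->|] := boolP (bump a c k t != 0); first exact: bump_le1.
by rewrite negbK => /eqP ->.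
Qed.

(** The derivative is a difference of two translates of the bump, hence smooth. *)
Lemma smooth1_window a c k h : 0 <= h -> smooth1 (window h (bump a c k)).
Proof.
move=> h0; have cb := smooth1_continuous (@smooth1_bump R a c k).
have dw t := is_derive_window t h0 cb (bump_integrable a c k).
case=> [|n]; (split=> [t|]; first by have [] := dw t) => //.
rewrite (_ : derive1 _ = fun t => bump a c k (1 * t + h) + (-1) * bump a c k t).
  apply: CnD; first by apply: Cn_affine; exact: smooth1_bump.
  by apply: CnZ; exact: smooth1_bump.
by apply/funext => t; rewrite derive1E; have [_ ->] := dw t; rewrite mul1r mulN1r.
Qed.

Lemma window_bump_supp a c k h t :
  window h (bump a c k) t != 0 -> a - h <= t <= c.
Proof.
apply: contraNT; rewrite negb_and -!ltNge => ht.
rewrite /window /Rintegral (eq_integral (cst 0%E)) ?integral0//.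
move=> s; rewrite inE/= in_itv/= => /andP[s0 sh].
apply/eqP; rewrite eqe; apply: contraPT (ht) => /bump_supp /andP[h1 h2].
by apply/negP; rewrite negb_or -!leNgt; apply/andP; split; lra.
Qed.

End window_bump.

Section local_identity.
Context {R : realType} {N : nat} (j : 'I_N).
Local Notation E := 'rV[R]_N.
Local Notation mu := (@lebesgue_rV R N).
Local Notation leb := (@lebesgue_measure R).
Local Notation e := (delta_mx ord0 j : E).

(* Test the weak derivative against [x |-> \int_0^h phi (x + s e_j) ds], whose
   partial derivative is the difference quotient of [phi]. *)
Lemma local_identity (U : set E) (w g : E -> R) (a c : E) (h : R) : 0 <= h ->
  measurable U ->
  mu.-integrable setT (EFin \o w) -> mu.-integrable setT (EFin \o g) ->
  weak_partial U j w g -> cbox (a - h *: e) c `<=` U ->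
  {ae mu, forall x, box a c x -> w x - w (x - h *: e) = line_avg j g h x}.
Proof.
move=> h0 mU iw ig wg acU.
have iv : mu.-integrable setT (EFin \o (fun x => w x - w (x - h *: e) - line_avg j g h x)).
  apply: integrableB_EFin => //; last exact: line_avg_integrable.
  by apply: integrableB_EFin => //; exact: (integrable_shift (- (h *: e)) iw).
suff : {ae mu, forall x, box a c x -> w x - w (x - h *: e) - line_avg j g h x = 0}.
  by apply: filterS => x /= H /H /eqP; rewrite subr_eq0 => /eqP.
apply: fundamental_lemma_box; first exact: (integrableS measurableT (measurable_box a c) (@subsetT _ _) iv).
move=> a' c' k aa' c'c.
set phi := bump_rV a' c' k.
have mphi : measurable_fun setT phi.
  by apply: rV_continuous_measurable; exact: continuous_bump_rV.
have phi1 x : `|phi x| <= 1 by rewrite ger0_norm ?bump_rV_ge0 ?bump_rV_le1.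
have phi_supp x : phi x != 0 -> box a' c' x.
  move=> phi0 i; apply: (@bump_supp R _ _ k); apply: contraNN phi0 => /eqP b0.
  by rewrite /phi /bump_rV (tensorD1 _ i) b0 mul0r.
pose b i := bump (a' ord0 i) (c' ord0 i) k.
(* The window acts on the [j]-th factor only, so [psi] is again a product and a test function by
   one-variable arguments. *)
pose psi := tensor (upd b j (window h (b j))).
have sb i : smooth1 (upd b j (window h (b j)) i).
  by rewrite /upd; case: eqP => _; [exact: smooth1_window|exact: smooth1_bump].
have psiE x : psi x = \int[leb]_(s in `[0, h]) phi (x + s *: e).
  rewrite /psi tensor_upd /window -RintegralZr//.
    by apply: eq_Rintegral => s _; rewrite /phi /bump_rV tensor_shift.
  apply: measurable_bounded_integrable => //; first exact: segment_lty.
    apply: measurable_funTS; apply: measurableT_comp.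
      by apply: continuous_measurable_fun; apply: smooth1_continuous; exact: smooth1_bump.
    exact: measurable_funD.
  exists 1; split; first exact: num_real.
  by move=> M M1 s _ /=; rewrite ger0_norm ?bump_ge0// (le_trans (bump_le1 _ _ _ _)) ?ltW.
have tpsi : test_function U psi.
  apply: (test_tensor (a := a' - h *: e) (c := c')) => //.
    apply: subset_trans acU => x xac i; have := xac i.
    rewrite !mxE => /andP[h1 h2]; apply/andP; split; last exact: le_trans (c'c i).
    by apply: le_trans h1; rewrite lerD2r.
  move=> i t; rewrite /upd; have [->|ij] := eqVneq i j; rewrite !mxE.
    by rewrite !eqxx mulr1; exact: window_bump_supp.
  rewrite (negbTE ij) andbF mulr0 subr0.
  by move=> /bump_supp/andP[? ?]; apply/andP; split; exact: ltW.
have dpsi x : partial j psi x = phi (x + h *: e) - phi x.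
  rewrite partial_tensor; last by move=> t; exact: smooth1_derivable.
  rewrite tensor_upd {1}/upd eqxx /phi /bump_rV tensor_shift (tensorD1 _ j) -mulrBl.
  congr (_ * _).
    have cb := smooth1_continuous (@smooth1_bump R (a' ord0 j) (c' ord0 j) k).
    have [_] := is_derive_window (x ord0 j) h0 cb (bump_integrable _ _ k).
    by rewrite derive1E.
  by apply: eq_bigr => i /negbTE ij; rewrite /upd ij.
(* Outside [U] both [psi] and its derivative vanish, so that the integrals over [U] extend to the
   whole space, where translations are allowed. *)
have boxU x : ~ U x -> forall s : R, 0 <= s <= h -> phi (x + s *: e) = 0.
  move=> Ux s /andP[s0 sh]; apply: contra_notP Ux => /eqP/phi_supp xs; apply: acU => i.
  have := xs i; rewrite !mxE; have := aa' i; have := c'c i.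
  case: (i == j); rewrite ?andbF ?andbT /= ?mulr1 ?mulr0 => h1 h2 /andP[h3 h4]; apply/andP; split; lra.
have psi_off x : ~ U x -> psi x = 0.
  move=> Ux; rewrite psiE /Rintegral (eq_integral (cst 0%E)) ?integral0//.
  by move=> s; rewrite inE/= in_itv/= => sh; rewrite boxU.
have dpsi_off x : ~ U x -> partial j psi x = 0.
  move=> Ux; rewrite dpsi boxU ?h0 ?lexx//.
  by have := boxU x Ux 0; rewrite lexx h0 scale0r addr0 => ->//; rewrite subr0.
have onU (f : E -> R) : (forall x, ~ U x -> f x = 0) ->
   (\int[mu]_(x in U) (f x)%:E = \int[mu]_x (f x)%:E)%E.
  move=> f0; rewrite integral_mkcond; apply: eq_integral => x _.
  by rewrite patchE; case: ifPn => //; rewrite notin_setE => /f0 ->.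
have := wg _ tpsi.
rewrite !onU; last 2 first.
- by move=> x Ux; rewrite psi_off// mulr0.
- by move=> x Ux; rewrite dpsi_off// mulr0.
have mphi' : measurable_fun setT (fun x : E => phi (x + h *: e)).
  exact: (measurableT_comp mphi (measurable_shift _)).
have mpsi : measurable_fun setT psi.
  apply: rV_continuous_measurable; apply: continuous_tensor => i.
  exact: smooth1_continuous.
have iwphi := integrableM_bounded iw mphi phi1.
have iwphi' := integrableM_bounded (phi := fun x : E => phi (x + h *: e)) iw mphi' (fun x => phi1 _).
have iwsphi : mu.-integrable setT (EFin \o (fun x : E => w (x - h *: e) * phi x)).
  by apply: (integrableM_bounded _ mphi phi1); exact: (integrable_shift (- (h *: e)) iw).
have igphi := integrableM_bounded (line_avg_integrable j h ig) mphi phi1.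
have wsE : \int[mu]_x (w (x - h *: e) * phi x) = \int[mu]_x (w x * phi (x + h *: e)).
  rewrite /Rintegral; congr fine.
  rewrite -(integral_shift (- (h *: e)) iwphi').
  by apply: eq_integral => x _ /=; rewrite subrK.
have gE := integral_line_avg j h ig mphi phi1.
move=> wgT.
have {}wgT : \int[mu]_x (w x * phi (x + h *: e)) - \int[mu]_x (w x * phi x) =
    - \int[mu]_x (g x * psi x).
  rewrite -RintegralB//.
  transitivity (fine (\int[mu]_x (w x * partial j psi x)%:E)%E).
    by congr fine; apply: eq_integral => x _; rewrite dpsi mulrBr.
  by rewrite wgT fineN.
rewrite (_ : (\int[mu]_(x in box a c) _)%E = (\int[mu]_x
    ((w x - w (x - h *: e) - line_avg j g h x) * phi x)%:E)%E); last first.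
  rewrite integral_mkcond; apply: eq_integral => x _; rewrite patchE; case: ifPn => //.
  rewrite notin_setE => xac; rewrite (_ : phi x = 0) ?mulr0//.
  apply: contra_notP xac => /eqP/phi_supp xac i.
  by have /andP[h1 h2] := xac i; rewrite (le_lt_trans (aa' i) h1) (lt_le_trans h2 (c'c i)).
rewrite -[LHS]fineK; last exact/integrable_fin_num/(integrableM_bounded iv mphi phi1).
congr (_%:E).
transitivity (\int[mu]_x (w x * phi x - w (x - h *: e) * phi x - line_avg j g h x * phi x)).
  by congr fine; apply: eq_integral => x _; congr (_%:E); rewrite !mulrBl.
rewrite RintegralB//; last exact: integrableB_EFin.
rewrite RintegralB// wsE gE.
rewrite (_ : \int[mu]_x (g x * \int[leb]_(s in `[0, h]) phi (x + s *: e)) =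
    \int[mu]_x (g x * psi x)).
  by lra.
by apply: eq_Rintegral => x _; rewrite psiE.
Qed.

End local_identity.

(** * The weak derivative vanishes a.e. on the zero set *)

Section null_sections.
Context {R : realType} d1 d2 (T1 : measurableType d1) (T2 : measurableType d2).
Context (m1 : {sigma_finite_measure set T1 -> \bar R}).
Context (m2 : {sigma_finite_measure set T2 -> \bar R}).

Lemma integral_xsection_ysection (A : set (T1 * T2)) : measurable A ->
  (\int[m1]_x m2 (xsection A x) = \int[m2]_y m1 (ysection A y))%E.
Proof.
move=> mA; have := indic_fubini_tonelli m1 m2 mA.
rewrite (_ : (fun x => _) = m2 \o xsection A); last first.
  by rewrite -indic_fubini_tonelli_FE.
move=> ->; apply: eq_integral => y _.
by rewrite -[LHS]/(_ y) indic_fubini_tonelli_GE.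
Qed.

Lemma ae_xsection0_ysection0 (A : set (T1 * T2)) : measurable A ->
  {ae m1, forall x, m2 (xsection A x) = 0%E} ->
  {ae m2, forall y, m1 (ysection A y) = 0%E}.
Proof.
move=> mA h.
have h0 : (\int[m1]_x m2 (xsection A x) = 0)%E.
  rewrite (ae_eq_integral (cst 0%E)) ?integral0//.
    exact: measurable_fun_xsection.
  by apply: filterS h => x /= -> _.
have : (\int[m2]_y `|m1 (ysection A y)| = 0)%E.
  by under eq_integral do rewrite gee0_abs//; rewrite -integral_xsection_ysection.
move/(ae_eq_integral_abs m2 measurableT (measurable_fun_ysection m1 mA)).
by apply: filterS => y /= ->.
Qed.

Lemma ae_ysection0_xsection0 (A : set (T1 * T2)) : measurable A ->
  {ae m2, forall y, m1 (ysection A y) = 0%E} ->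
  {ae m1, forall x, m2 (xsection A x) = 0%E}.
Proof.
move=> mA h.
have h0 : (\int[m2]_x m1 (ysection A x) = 0)%E.
  rewrite (ae_eq_integral (cst 0%E)) ?integral0//.
    exact: measurable_fun_ysection.
  by apply: filterS h => x /= -> _.
have : (\int[m1]_y `|m2 (xsection A y)| = 0)%E.
  by under eq_integral do rewrite gee0_abs//; rewrite integral_xsection_ysection.
move/(ae_eq_integral_abs m1 measurableT (measurable_fun_xsection m2 mA)).
by apply: filterS => y /= ->.
Qed.

End null_sections.

Section one_dimensional.
Context {R : realType}.
Local Notation leb := (@lebesgue_measure R).

(** Each point is the only element of [Z] in some interval with rational ends, so [Z] is covered by
    countably many singletons. *)
Lemma negligible_isolated (Z : set R) :
  (forall t, Z t -> exists2 e : R, 0 < e & forall u, Z u -> `|t - u| < e -> u = t) ->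
  leb.-negligible Z.
Proof.
move=> isoZ.
pose I (p : rat * rat) : set R := Z `&` `]ratr p.1, ratr p.2[%classic.
pose single p := forall u v, I p u -> I p v -> u = v.
apply: (@negligibleS _ (measurableTypeR R) _ leb (\bigcup_k (if unpickle k is Some p then
   (if `[< single p >] then I p else set0) else set0))).
  move=> t Zt; have [e e0 isot] := isoZ t Zt.
  have [q] : {q : rat | ratr q \in `]t - e / 2, t[}.
    by apply: cid; apply: rat_in_itvoo; rewrite ltrBlDr ltrDl divr_gt0.
  rewrite in_itv/= => /andP[q1 q2].
  have [r] : {r : rat | ratr r \in `]t, t + e / 2[}.
    by apply: cid; apply: rat_in_itvoo; rewrite ltrDl divr_gt0.
  rewrite in_itv/= => /andP[r1 r2].
  exists (pickle (q, r)); first by [].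
  rewrite pickleK ifT; last first.
    apply/asboolP => u v [Zu +] [Zv +]; rewrite /= !in_itv/= => /andP[u1 u2] /andP[v1 v2].
    have ut : u = t.
      apply: (isot u Zu); rewrite ltr_distlC.
      move: (ratr q) (ratr r) q1 r2 u1 u2 => q' r' *; apply/andP; split; lra.
    rewrite ut; apply/esym/(isot v Zv); rewrite ltr_distlC.
    move: (ratr q) (ratr r) q1 r2 v1 v2 => q' r' *; apply/andP; split; lra.
  by split=> //=; rewrite in_itv/= q2.
apply: negligible_bigcup => k; case: unpickle => [p|]; last exact: negligible_set0.
case: ifPn => [/asboolP sp|_]; last exact: negligible_set0.
have [[t It]|I0] := pselect (exists t, I p t); last first.
  rewrite (_ : I p = set0); first exact: negligible_set0.
  by apply/seteqP; split=> // t It; apply: I0; exists t.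
rewrite (_ : I p = [set t]); last by apply/seteqP; split=> [u /sp/(_ It) ->|u ->].
by apply/negligibleP; [exact: measurable_set1|exact: lebesgue_measure_set1].
Qed.

(** At such a zero the difference quotient has a nonzero limit, so [F] has no other zero nearby. *)
Lemma negligible_zero_derive (F : R -> R) :
  leb.-negligible [set t | F t = 0 /\ derivable F t 1 /\ derive1 F t != 0].
Proof.
apply: negligible_isolated => t [Ft0 [dF dF0]].
have : (fun h => h^-1 *: ((F \o shift t) (h *: (1 : R)) - F t)) @ (0 : R)^' --> derive1 F t.
  by rewrite derive1E; exact: dF.
move=> /cvgr_neq0 /(_ dF0) [e /= e0 he].
exists e => // u [Fu0 _] tu; apply/eqP; apply: contraT => ut.
have := he (u - t); rewrite /= sub0r normrN distrC subr_eq0 => /(_ tu ut).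
by rewrite /shift/= /GRing.scale/= mulr1 subrK Fu0 Ft0 subrr mulr0 eqxx.
Qed.

(* An absolutely continuous function has derivative 0 at almost every zero, since
   its zeros with nonzero derivative are isolated. *)
Lemma stampacchia1 (gamma omega : R -> R) (c r : R) : 0 < r ->
  leb.-integrable setT (EFin \o gamma) ->
  {ae leb, forall h, 0 < h < r -> omega h = c - \int[leb]_(s in `[0, h]) gamma s} ->
  {ae leb, forall h, 0 < h < r -> omega h = 0 -> gamma h = 0}.
Proof.
move=> r0 ig homega.
have ig' y : leb.-integrable [set` Interval (BLeft 0) (BRight y)] (EFin \o gamma).
  exact: (integrableS measurableT _ (@subsetT _ _) ig).
have lg : locally_integrable setT gamma.
  by have := integrable_locally measurableT ig; rewrite patch_setT.
have := FTC1 ig' lg.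
set F := (fun x => \int[leb]_(t in [set` Interval (BLeft 0) (BRight x)]) gamma t) => hF.
(* [H] agrees with [omega] almost everywhere on []0, r[], and by Lebesgue differentiation its
   derivative is [- gamma] almost everywhere there. *)
pose H := cst c - F.
have := negligible_zero_derive H.
move=> hZ.
have {}hZ : {ae leb, forall t, ~ (H t = 0 /\ derivable H t 1 /\ derive1 H t != 0)}.
  by apply: negligibleS hZ => t /= /contrapT.
apply: (@filterS3 _ _ (ae_filter_ringOfSetsType leb) _ _ _ _ _ homega hF hZ) => h {}homega {}hF {}hZ h0r.
have [h0 hr] := andP h0r.
have [|dF F'E] := hF; first by rewrite lte_fin.
rewrite homega// => H0; apply/eqP; apply: contra_notT hZ => gamma0; split=> //.
have dH : is_derive h 1 H (0 - gamma h).
  by rewrite -F'E derive1E; apply: is_deriveB; exact: derivableP.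
have [dH1 dH2] := dH.
by split=> //; rewrite derive1E dH2 sub0r oppr_eq0.
Qed.

End one_dimensional.

Section stampacchia.
Context {R : realType} {N : nat} (j : 'I_N).
Local Notation E := 'rV[R]_N.
Local Notation mu := (@lebesgue_rV R N).
Local Notation leb := (@lebesgue_measure R).
Local Notation EL := (E * measurableTypeR R)%type.
Local Notation e := (delta_mx ord0 j : E).

(** Joint measurability in [x] and [h], for applying Fubini to the set of pairs where the identity
    fails. The length [h] becomes a variable of the kernel. As [g] is only measurable, the positive
    and negative parts are integrated separately. *)
Lemma measurable_line_avg2 (g : E -> R) : measurable_fun setT g ->
  measurable_fun setT (fun p : EL => line_avg j g p.2 p.1).
Proof.
move=> mg.
pose K (q : EL * measurableTypeR R) : R :=
  (if (0 <= q.2) && (q.2 <= q.1.2) then 1 else 0) * g (q.1.1 - q.2 *: e).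
have mK : measurable_fun setT K.
  apply: measurable_funM.
    apply: measurable_fun_ifT => //; apply: measurable_and.
      by apply: measurable_fun_ler => //; exact: measurable_snd.
    apply: measurable_fun_ler; first exact: measurable_snd.
    exact: (measurableT_comp measurable_snd measurable_fst).
  apply: (measurableT_comp mg); apply: measurable_fun_rV => i.
  under eq_fun do rewrite !mxE.
  apply: measurable_funB.
    apply: (measurableT_comp (measurable_coord i)).
    exact: (measurableT_comp measurable_fst measurable_fst).
  by apply: measurable_funM => //; exact: measurable_snd.
pose Kp := (EFin \o K)^\+%E; pose Kn := (EFin \o K)^\-%E.
have mKp : measurable_fun setT Kp.
  by apply: measurable_funepos; exact/measurable_EFinP.
have mKn : measurable_fun setT Kn.
  by apply: measurable_funeneg; exact/measurable_EFinP.
have mp := measurable_fun_fubini_tonelli_F (m2 := leb) _ mKp (fun=> funepos_ge0 _ _).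
have mn := measurable_fun_fubini_tonelli_F (m2 := leb) _ mKn (fun=> funeneg_ge0 _ _).
rewrite (_ : (fun p => _) = fine \o (fun p : EL => fubini_F leb Kp p - fubini_F leb Kn p)%E).
  by apply: (measurableT_comp (fine_measurable measurableT)); exact: emeasurable_funB.
apply/funext => p; rewrite line_avgE /Rintegral.
rewrite (_ : (fun s => _) = (EFin \o K) \o pair p); last first.
  apply/funext => s; rewrite /K /line_kernel /= indicE mem_setE in_itv/=.
  by case: ifP.
by rewrite integralE funepos_comp funeneg_comp.
Qed.

Lemma measurable_fun_neq0 d (T : measurableType d) (f : T -> R) :
  measurable_fun setT f -> measurable [set x | f x != 0].
Proof.
move=> mf; have := mf measurableT _ (measurableC (measurable_set1 (0 : R))).
by rewrite setTI; congr measurable; apply/seteqP; split=> x /= /eqP.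
Qed.

Lemma box_ball (x y : E) (r : R) : 0 < r ->
  ball x r y <-> box (x - const_mx r) (x + const_mx r) y.
Proof.
move=> r0; rewrite rV_ballP; split=> [[_ h] i|h].
  by have := h i; rewrite !mxE ltr_distlC.
by split=> // i; have := h i; rewrite !mxE ltr_distlC.
Qed.

(* By Fubini, along almost every line through [x] the function [w] is an
   indefinite integral of [g], so that the one-dimensional case applies. *)
Lemma weak_partial_eq0 (U : set E) (w g : E -> R) : open U ->
  mu.-integrable setT (EFin \o w) -> mu.-integrable setT (EFin \o g) ->
  weak_partial U j w g -> {ae mu, forall x, U x -> w x = 0 -> g x = 0}.
Proof.
move=> oU iw ig wg.
have mU : measurable U by exact: rV_open_measurable.
have mw : measurable_fun setT w by apply/measurable_EFinP; exact: (measurable_int mu iw).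
have mg : measurable_fun setT g by apply/measurable_EFinP; exact: (measurable_int mu ig).
pose Z := [set x | w x = 0 /\ g x != 0].
suff : mu.-negligible (U `&` Z).
  apply: negligibleS => x /= /not_implyP[Ux] /not_implyP[wx gx]; split=> //.
  by split=> //; exact/eqP.
have mZ : measurable Z.
  rewrite (_ : Z = ~` [set x | w x != 0] `&` [set x | g x != 0]).
    by apply: measurableI; [apply: measurableC|]; exact: measurable_fun_neq0.
  by apply/seteqP; split=> x [/= w0 g0]; split=> //=; [rewrite w0 eqxx|exact/eqP/negPn/negP].
apply: negligible_locally => x0 Ux0.
have /nbhs_ballP[r4 /= r40 rU] := open_nbhs_nbhs (conj oU Ux0).
(* The box [B] below has half-side [2 r] and is stretched backwards by less than [r]; the closed
   result stays inside the ball of radius [4 r]. *)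
have [r r0 r4E] : exists2 r, 0 < r & r4 = 4 * r.
  by exists (r4 / 4); [rewrite divr_gt0|rewrite mulrC divfK].
exists r => //.
set B := box (x0 - const_mx (2 * r)) (x0 + const_mx (2 * r)).
have mB : measurable B by exact: measurable_box.
have mI : measurable (`]0, r[%classic : set (measurableTypeR R)) by [].
have mBI : measurable (B `*` `]0, r[%classic : set EL) by exact: measurableX.
have mline := @measurable_line R N j : measurable_fun setT (fun p : EL => p.1 - p.2 *: e).
(* The pairs [(x, h)] violating the increment identity. The sections at fixed [h] are null by
   [local_identity], hence so are almost all sections at fixed [x]. *)
pose S : set EL := (B `*` `]0, r[%classic) `&`
  [set p : EL | w p.1 - w (p.1 - p.2 *: e) - line_avg j g p.2 p.1 != 0].
have mS : measurable S.
  apply: measurableI => //; apply: measurable_fun_neq0.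
  apply: measurable_funB; last exact: measurable_line_avg2.
  apply: measurable_funB; last exact: (measurableT_comp mw mline).
  exact: (measurableT_comp mw measurable_fst).
have Sy : {ae leb, forall h, mu (ysection S h) = 0%E}.
  apply: aeW => h; apply/measure_negligible; first exact: measurable_ysection.
  have [h0r|h0r] := boolP (0 < h < r); last first.
    rewrite (_ : ysection S h = set0); first exact: negligible_set0.
    apply/seteqP; split=> // x /ysectionP[[_ /=]].
    by rewrite in_itv/= (negbTE h0r).
  have /andP[h0 hr] := h0r.
  have := @local_identity R N j U w g (x0 - const_mx (2 * r)) (x0 + const_mx (2 * r)) h (ltW h0) mU iw ig wg.
  case.
    move=> x xb; apply: rU; apply/rV_ballP; split=> // i; have := xb i.
    rewrite !mxE; case: (i == j); rewrite ?andbF ?andbT /= ?mulr1 ?mulr0;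
    move=> /andP[? ?]; rewrite ltr_distlC r4E; apply/andP; split; lra.
  move=> A [mA A0 subA]; exists A; split=> //.
  apply: subset_trans subA => x /ysectionP[[/= Bx _] /= neq] /(_ Bx) eqx.
  by move: neq; rewrite eqx subrr eqxx.
have Sx := ae_ysection0_xsection0 mS Sy.
have gK := ae_integrable1 (line_kernel_integrable j r ig).
(* The pairs for which the point reached on the line is an exceptional zero. The one-dimensional
   case makes almost all sections at fixed [x] null. *)
pose M : set EL := (B `*` `]0, r[%classic) `&` [set p : EL | Z (p.1 - p.2 *: e)].
have mM : measurable M.
  by apply: measurableI => //; rewrite -[X in measurable X]setTI; exact: mline.
have Mx : {ae mu, forall x, leb (xsection M x) = 0%E}.
  apply: filterS2 Sx gK => x Sx0 igx.
  have mMx : measurable (xsection M x) by exact: measurable_xsection.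
  apply/measure_negligible => //.
  have [Bx|Bx] := pselect (B x); last first.
    rewrite (_ : xsection M x = set0); first exact: negligible_set0.
    by apply/seteqP; split=> // h /xsectionP[[]].
  have := @stampacchia1 R (fun s => line_kernel j g r (x, s)) (fun h => w (x - h *: e)) (w x) r r0 igx.
  case.
    exists (xsection S x); split => //; first exact: measurable_xsection.
    move=> h /= /not_implyP[h0r neq]; apply/xsectionP; split=> /=.
      by rewrite in_itv.
    apply: contra_not_neq neq => eqh.
    rewrite (_ : \int[leb]_(s in `[0, h]) _ = line_avg j g h x); first by lra.
    apply: eq_Rintegral => s; rewrite inE/= in_itv/= => /andP[s0 sh].
    rewrite /line_kernel/= indicE mem_setE in_itv/= s0/= (_ : s <= r) ?mul1r//.
    by move/andP : h0r => [_ /ltW]; exact: le_trans.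
  move=> A [mA A0 subA]; exists A; split=> //.
  apply: subset_trans subA => h /xsectionP[[/= _ h0r] [Z1 Z2]].
  rewrite in_itv/= in h0r; move=> /(_ h0r Z1); have /andP[h0 hr] := h0r.
  rewrite /line_kernel/= indicE mem_setE in_itv/= (ltW h0) (ltW hr) mul1r => gx0.
  by rewrite gx0 eqxx in Z2.
have My := ae_xsection0_ysection0 mM Mx.
(* One such [h] is enough: translating that null section by [h e] covers the exceptional zeros in
   the ball of radius [r]. *)
have [h h0r Mh] : exists2 h, 0 < h < r & mu (ysection M h) = 0%E.
  apply: contrapT => noh.
  have : leb `]0, r[%classic = 0%E.
    apply/measure_negligible; first exact: measurable_itv.
    apply: negligibleS My => h /=; rewrite in_itv/= => h0r Mh.
    by apply: noh; exists h.
  rewrite lebesgue_measure_itv/= lte_fin r0 oppr0 adde0 => -[] rr.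
  by rewrite rr ltxx in r0.
have nM : mu.-negligible (ysection M h).
  by apply/negligibleP => //; exact: measurable_ysection.
apply: negligibleS (negligible_shift (h *: e) nM) => y [/(box_ball _ _ r0) yB Zy].
apply/ysectionP; split; last by rewrite /= addrK.
have /andP[h0 hr] := h0r.
split=> /=; last by rewrite in_itv.
move=> i; have := yB i; rewrite !mxE; case: (i == j); rewrite ?andbF ?andbT /= ?mulr1 ?mulr0;
  move=> /andP[? ?]; apply/andP; split; lra.
Qed.

End stampacchia.

(** * Elementary L^2 theory on a measure space *)

Section square_integrable.
Context {R : realType} d (T : measurableType d) (m : {measure set T -> \bar R}).
Implicit Types f g : T -> R.

Definition L2 f := measurable_fun setT f /\
  m.-integrable setT (EFin \o (fun x => f x ^+ 2)).

Definition sqnorm f : R := \int[m]_x (f x ^+ 2).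

Lemma sqnorm_ge0 f : 0 <= sqnorm f.
Proof. by apply: Rintegral_ge0 => x _; exact: sqr_ge0. Qed.

Lemma L2M f g : L2 f -> L2 g -> m.-integrable setT (EFin \o (fun x => f x * g x)).
Proof.
move=> [mf if2] [mg ig2].
apply: (le_integrable _ _ _ (integrableD_EFin measurableT if2 ig2)) => //.
  by apply/measurable_EFinP; exact: measurable_funM.
move=> x _ /=; rewrite lee_fin [leRHS]ger0_norm ?addr_ge0 ?sqr_ge0//.
rewrite ler_norml; apply/andP; split; nra.
Qed.

Lemma L2D f g : L2 f -> L2 g -> L2 (fun x => f x + g x).
Proof.
move=> Lf Lg; have [mf if2] := Lf; have [mg ig2] := Lg.
split; first exact: measurable_funD.
rewrite (_ : (fun x => _) = fun x => f x ^+ 2 + g x ^+ 2 + 2 * (f x * g x)).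
  apply: integrableD_EFin => //; first exact: integrableD_EFin.
  by apply: integrableZl_EFin => //; exact: L2M.
by apply/funext => x; ring.
Qed.

Lemma L2Z (k : R) f : L2 f -> L2 (fun x => k * f x).
Proof.
move=> [mf if2]; split; first exact: measurable_funM.
rewrite (_ : (fun x => _) = fun x => k ^+ 2 * f x ^+ 2).
  exact: integrableZl_EFin.
by apply/funext => x; ring.
Qed.

Lemma L2B f g : L2 f -> L2 g -> L2 (fun x => f x - g x).
Proof.
move=> Lf Lg; rewrite (_ : (fun x => _) = fun x => f x + (-1) * g x).
  by apply: L2D => //; exact: L2Z.
by apply/funext => x; rewrite mulN1r.
Qed.

(** The measure is not assumed complete, hence the separate measurability of [g]. *)
Lemma L2_ae_eq f g : measurable_fun setT g -> L2 f ->
  {ae m, forall x, f x = g x} -> L2 g /\ sqnorm g = sqnorm f.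
Proof.
move=> mg [mf if2] fg.
have fg2 : ae_eq m setT (EFin \o (fun x => f x ^+ 2)) (EFin \o (fun x => g x ^+ 2)).
  by apply: filterS fg => x /= -> _.
have mg2 : measurable_fun setT (EFin \o (fun x => g x ^+ 2)).
  by apply/measurable_EFinP; exact: measurable_funX.
have mf2 := measurable_int _ if2.
split; last by rewrite /sqnorm /Rintegral; congr fine; apply/esym/ae_eq_integral.
split=> //; apply/integrableP; split=> //.
have /integrableP[_] := if2; apply: le_lt_trans.
rewrite le_eqVlt; apply/orP; left; apply/eqP/esym.
apply: ae_eq_integral => //; [exact: measurableT_comp|exact: measurableT_comp|].
exact: ae_eq_abse.
Qed.

Lemma sqnorm_eq0 f : L2 f -> sqnorm f = 0 -> {ae m, forall x, f x = 0}.
Proof.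
move=> [mf if2] f0.
have mf2 := measurable_int _ if2.
have : (\int[m]_x `|(f x ^+ 2)%:E| = 0)%E.
  under eq_integral do rewrite gee0_abs ?lee_fin ?sqr_ge0//.
  by rewrite -[LHS]fineK ?integrable_fin_num// -/(sqnorm f) -[RHS]/(0%:E) -f0.
move/(ae_eq_integral_abs m measurableT mf2); apply: filterS => x /= /(_ I) [] /eqP.
by rewrite sqrf_eq0 => /eqP.
Qed.

Lemma sqnorm_le f g : L2 f -> L2 g -> (forall x, `|f x| <= `|g x|) ->
  sqnorm f <= sqnorm g.
Proof.
move=> [_ if2] [_ ig2] fg; apply: le_Rintegral => // x _.
by rewrite -[f x ^+ 2]real_normK ?num_real// -[g x ^+ 2]real_normK ?num_real// lerXn2r ?nnegrE.
Qed.

Lemma sqnormD_le f g : L2 f -> L2 g ->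
  sqnorm (fun x => f x + g x) <= 2 * sqnorm f + 2 * sqnorm g.
Proof.
move=> Lf Lg; have [_ if2] := Lf; have [_ ig2] := Lg; have [_ ifg] := L2D Lf Lg.
rewrite /sqnorm -!RintegralZl// -RintegralD//; last 2 first.
- exact: integrableZl_EFin.
- exact: integrableZl_EFin.
apply: le_Rintegral => //; first by apply: integrableD_EFin => //; exact: integrableZl_EFin.
move=> x _; rewrite -subr_ge0 (_ : _ - _ = (f x - g x) ^+ 2) ?sqr_ge0//; ring.
Qed.

Lemma sqnorm_comb (a b : R) f g : L2 f -> L2 g ->
  sqnorm (fun x => a * f x + b * g x) =
  a ^+ 2 * sqnorm f + 2 * a * b * (\int[m]_x (f x * g x)) + b ^+ 2 * sqnorm g.
Proof.
move=> Lf Lg; have ifg := L2M Lf Lg; have [_ if2] := Lf; have [_ ig2] := Lg.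
rewrite /sqnorm -!RintegralZl//.
rewrite -RintegralD//; [|exact: integrableZl_EFin|exact: integrableZl_EFin].
rewrite -RintegralD//; [|by apply: integrableD_EFin => //; exact: integrableZl_EFin|
  exact: integrableZl_EFin].
by apply: eq_Rintegral => x _; ring.
Qed.

Lemma parallelogram f g : L2 f -> L2 g ->
  sqnorm (fun x => (f x + g x) / 2) + sqnorm (fun x => f x - g x) / 4 =
  (sqnorm f + sqnorm g) / 2.
Proof.
move=> Lf Lg.
rewrite (_ : (fun x => f x - g x) = fun x => 1 * f x + (-1) * g x); last first.
  by apply/funext => x; ring.
rewrite (_ : (fun x => (f x + g x) / 2) = fun x => 2^-1 * f x + 2^-1 * g x); last first.
  by apply/funext => x; ring.
by rewrite !sqnorm_comb//; field.
Qed.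

(** The quadratic polynomial [|t f + g|^2] in [t] is nonnegative; it is evaluated at its minimum
    [- b / a]. *)
Lemma cauchy_schwarz f g : L2 f -> L2 g ->
  (\int[m]_x (f x * g x)) ^+ 2 <= sqnorm f * sqnorm g.
Proof.
move=> Lf Lg; set b := \int[m]_x _; set a := sqnorm f; set c := sqnorm g.
have q t : 0 <= t ^+ 2 * a + 2 * t * b + c.
  have := sqnorm_ge0 (fun x => t * f x + 1 * g x).
  by rewrite sqnorm_comb// expr1n mul1r mulr1.
have a0 : 0 <= a by exact: sqnorm_ge0.
have c0 : 0 <= c by exact: sqnorm_ge0.
have [a00|an0] := eqVneq a 0.
  rewrite a00 mul0r; have [->|bn0] := eqVneq b 0; first by rewrite expr0n.
  (* For [a = 0] the polynomial is affine, and it would take the value -1 at this point. *)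
  have := q (- (c + 1) / (2 * b)); rewrite a00 mulr0 add0r.
  rewrite (_ : 2 * _ * b = - (c + 1)); last by field.
  lra.
have {}a0 : 0 < a by rewrite lt_neqAle eq_sym an0.
have := q (- b / a); rewrite (_ : _ + c = c - b ^+ 2 / a); last by field.
by rewrite subr_ge0 ler_pdivrMr// mulrC.
Qed.

End square_integrable.

(** * Euclidean distance and the unit neighborhood *)

Section geometry.
Context {R : realType} {N : nat}.
Local Notation E := 'rV[R]_N.
Local Notation mu := (@lebesgue_rV R N).
Implicit Types (x y : E) (Omega : set E).

Lemma continuous_euclidean_norm y : continuous (fun x : E => euclidean_norm (x - y)).
Proof.
have cs : continuous (fun x : E => \sum_(i < N) ((x - y) ord0 i) ^+ 2).
  elim: (index_enum _) => [|i r IH] x.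
    under eq_fun do rewrite big_nil.
    exact: cst_continuous.
  under eq_fun do rewrite big_cons.
  have ci : {for x, continuous (fun x : E => (x - y) ord0 i)}.
    rewrite (_ : (fun x => _) = fun x : E => x ord0 i - y ord0 i).
      by apply: continuousB; [exact: coord_continuous|exact: cst_continuous].
    by apply/funext => z; rewrite !mxE.
  by apply: (@continuousD _ _ _ _ (fun x : E => \sum_(l <- r) (x - y) ord0 l ^+ 2)) (IH x);
    apply: (@continuousM _ _ (fun x : E => (x - y) ord0 i)).
move=> x; rewrite /euclidean_norm.
by apply: continuous_comp; [exact: cs|exact: sqrt_continuous].
Qed.

Lemma coord_le_euclidean_norm x i : `|x ord0 i| <= euclidean_norm x.
Proof.
rewrite /euclidean_norm -sqrtr_sqr ler_wsqrtr// (bigD1 i)//= lerDl.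
by apply: sumr_ge0 => l _; exact: sqr_ge0.
Qed.

(** Each of the [N] squares is at most [1 / (N + 1)]. Taking [N + 1] in place of [N] makes the final
    inequality strict and covers dimension 0. *)
Lemma euclidean_norm_lt1 x : (forall i, `|x ord0 i| < N.+1%:R^-1) ->
  euclidean_norm x < 1.
Proof.
move=> xN; rewrite /euclidean_norm -[ltRHS]sqrtr1 ltr_sqrt//.
have N0 : 0 < N.+1%:R :> R by rewrite ltr0n.
apply: (@le_lt_trans _ _ (\sum_(i < N) N.+1%:R^-1)).
  apply: ler_sum => i _; rewrite -real_normK ?num_real// expr2.
  have xi := ltW (xN i); apply: (@le_trans _ _ (N.+1%:R^-1 * 1)); last by rewrite mulr1.
  apply: ler_pM => //; apply: le_trans xi _.
  by rewrite invf_le1// ler1n.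
by rewrite sumr_const card_ord -[_ *+ N]mulr_natl ltr_pdivrMr// mul1r ltr_nat.
Qed.

Lemma neighborhood1P Omega x : neighborhood1 Omega x <->
  exists2 y, Omega y & euclidean_norm (x - y) < 1.
Proof.
rewrite /neighborhood1 /set_dist /=; split.
  by move=> /ereal_inf_ltP[_ [_ -> [y Oy <-]]]; rewrite lte_fin => xy; exists y.
move=> [y Oy xy]; apply: (@le_lt_trans _ _ (euclidean_norm (x - y))%:E).
  by apply: ereal_inf_lbound; exists x => //; exists y.
by rewrite lte_fin.
Qed.

Lemma open_neighborhood1 Omega : open (neighborhood1 Omega).
Proof.
rewrite (_ : neighborhood1 Omega =
   \bigcup_(y in Omega) ((fun x => euclidean_norm (x - y)) @^-1` [set t | t < 1])).
  apply: bigcup_open => y _; have /continuousP := @continuous_euclidean_norm y.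
  by apply; exact: open_lt.
by apply/seteqP; split=> x; [move=> /neighborhood1P[y]|move=> [y]];
  [exists y|move=> ? ?; apply/neighborhood1P; exists y].
Qed.

(** The radius is [1 / (N + 1)], written as [4 r] to match the margin that [poincare] asks for. *)
Lemma neighborhood1_ball Omega y : Omega y ->
  ball y (4 * (4 * N.+1%:R)^-1) `<=` neighborhood1 Omega.
Proof.
move=> Oy x /rV_ballP[_ yx]; apply/neighborhood1P; exists y => //.
apply: euclidean_norm_lt1 => i; have := yx i.
by rewrite invfM mulrA mulfV ?mul1r// !mxE distrC.
Qed.

Lemma subset_neighborhood1 Omega : Omega `<=` neighborhood1 Omega.
Proof.
move=> y Oy; apply: (neighborhood1_ball Oy); apply: ballxx.
by rewrite mulr_gt0// invr_gt0 mulr_gt0// ltr0n.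
Qed.

Lemma bounded_set_coord (A : set E) : bounded_set A ->
  exists2 M : R, 0 < M & forall y, A y -> forall i, `|y ord0 i| < M.
Proof.
move=> [M [_ AM]]; exists (`|M| + 2) => [|y Ay i].
  by rewrite ltr_wpDl.
have yM : `|y| <= `|M| + 1 by apply: AM => //; rewrite ltr_pwDr// ler_norm.
have : `|y| < `|M| + 2 by lra.
have -> : `|y| = mx_norm y by [].
by rewrite mx_normrE => /bigmax_ltP[_ /(_ (ord0, i) isT)].
Qed.

Lemma neighborhood1_lty Omega : bounded_set Omega ->
  (mu (neighborhood1 Omega) < +oo)%E.
Proof.
move=> /bounded_set_coord[M M0 OM].
apply: le_lt_trans (lebesgue_rV_box (const_mx (- (M + 1))) (const_mx (M + 1))).
apply: le_measure; rewrite ?inE.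
- by apply: rV_open_measurable; exact: open_neighborhood1.
- exact: measurable_box.
move=> x /neighborhood1P[y Oy xy] i.
have := coord_le_euclidean_norm (x - y) i; have := OM y Oy i.
rewrite !mxE => /ltr_normlP[h1 h2] /ler_normlP[h3 h4]; apply/andP; split; lra.
Qed.

End geometry.

(** * The Poincare inequality in one coordinate direction *)

Section poincare.
Context {R : realType} {N : nat} (j : 'I_N).
Local Notation E := 'rV[R]_N.
Local Notation mu := (@lebesgue_rV R N).
Local Notation leb := (@lebesgue_measure R).
Local Notation e := (delta_mx ord0 j : E).
Implicit Types (w g : E -> R).

Lemma L2_integrable d (T : measurableType d) (m : {measure set T -> \bar R})
    (A : set T) (f : T -> R) : measurable A -> (m A < +oo)%E ->
  (forall x, ~ A x -> f x = 0) -> L2 m f -> m.-integrable setT (EFin \o f).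
Proof.
move=> mA Aoo f0 [mf if2].
have iA : m.-integrable setT (EFin \o (\1_A : T -> R)).
  apply/integrableP; split; first by apply/measurable_EFinP; exact: measurable_indic.
  under eq_integral do rewrite /= ger0_norm//.
  by rewrite integral_indic// setIT.
apply: (le_integrable measurableT _ _ (integrableD_EFin measurableT if2 iA)).
  exact/measurable_EFinP.
move=> x _ /=; rewrite lee_fin [leRHS]ger0_norm ?addr_ge0 ?sqr_ge0//.
rewrite indicE; have [Ax|Ax] := pselect (A x); last first.
  by rewrite f0// normr0 addr_ge0 ?sqr_ge0.
rewrite mem_set//= ler_norml.
have h1 : 0 <= f x ^+ 2 - 2 * f x + 1.
  by rewrite (_ : _ + 1 = (f x - 1) ^+ 2) ?sqr_ge0//; ring.
have h2 : 0 <= f x ^+ 2 + 2 * f x + 1.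
  by rewrite (_ : _ + 1 = (f x + 1) ^+ 2) ?sqr_ge0//; ring.
have h3 := sqr_ge0 (f x); apply/andP; split; lra.
Qed.

Lemma fine_segment (h : R) : 0 <= h -> fine (leb `[0%R, h]%classic) = h.
Proof.
move=> h0; rewrite lebesgue_measure_itv/= lte_fin.
by case: ltP => [_|h0']; rewrite /= ?subr0//; apply/eqP; rewrite eq_le h0 h0'.
Qed.

Lemma line_avg_ge0 g h x : (forall y, 0 <= g y) -> 0 <= line_avg j g h x.
Proof. by move=> g0; apply: Rintegral_ge0. Qed.

(** Cauchy-Schwarz against the indicator of [[0, h]] on each line where the slices are
    integrable. *)
Lemma ae_line_avg_sqr g h : 0 <= h -> mu.-integrable setT (EFin \o g) -> L2 mu g ->
  {ae mu, forall x, line_avg j g h x ^+ 2 <= h * line_avg j (fun y => g y ^+ 2) h x}.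
Proof.
move=> h0 ig [mg ig2].
apply: filterS2 (ae_integrable1 (line_kernel_integrable j h ig))
  (ae_integrable1 (line_kernel_integrable j h ig2)) => x i1 i2.
pose I : measurableTypeR R -> R := \1_(`[0, h]%classic).
have mI : measurable_fun setT I by exact: measurable_indic.
have I2 s : I s ^+ 2 = I s by rewrite /I indicE; case: (_ \in _); rewrite ?expr0n ?expr1n.
have iI : leb.-integrable setT (EFin \o I) by exact: integrable_indic_itv.
have LI : L2 leb I.
  by split=> //; rewrite (_ : (fun s => _) = I)//; apply/funext => s.
pose k (s : measurableTypeR R) := line_kernel j g h (x, s).
have Lk : L2 leb k.
  split; first by apply/measurable_EFinP; exact: (measurable_int _ i1).
  rewrite (_ : (fun s => _) = fun s => line_kernel j (fun y => g y ^+ 2) h (x, s))//.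
  by apply/funext => s; rewrite /k /line_kernel exprMn -/(I s) I2.
have := cauchy_schwarz LI Lk.
rewrite (_ : \int[leb]_s (I s * k s) = line_avg j g h x); last first.
  rewrite line_avgE; apply: eq_Rintegral => s _.
  by rewrite /k /line_kernel /= -/(I s) mulrA -expr2 I2.
rewrite (_ : sqnorm leb k = line_avg j (fun y => g y ^+ 2) h x); last first.
  rewrite line_avgE; apply: eq_Rintegral => s _.
  by rewrite /k /line_kernel exprMn -/(I s) I2.
rewrite (_ : sqnorm leb I = h)//.
rewrite /sqnorm /Rintegral; under eq_integral do rewrite I2.
by rewrite /I integral_indic// setIT; exact: fine_segment.
Qed.

Lemma sqnorm_line_avg g h : 0 <= h -> mu.-integrable setT (EFin \o g) -> L2 mu g ->
  L2 mu (line_avg j g h) /\ sqnorm mu (line_avg j g h) <= h ^+ 2 * sqnorm mu g.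
Proof.
move=> h0 ig Lg; have [mg ig2] := Lg.
have ia := line_avg_integrable j h ig.
have ia2 := line_avg_integrable j h ig2.
have ma : measurable_fun setT (line_avg j g h).
  by apply/measurable_EFinP; exact: (measurable_int mu ia).
have iha2 : mu.-integrable setT (EFin \o (fun x => h * line_avg j (fun y => g y ^+ 2) h x)).
  exact: integrableZl_EFin.
have le2 : (\int[mu]_x (line_avg j g h x ^+ 2)%:E <=
    \int[mu]_x (h * line_avg j (fun y => g y ^+ 2) h x)%:E)%E.
  apply: ae_ge0_le_integral => //.
  - by move=> x _; rewrite lee_fin sqr_ge0.
  - by apply/measurable_EFinP; exact: measurable_funX.
  - by move=> x _; rewrite lee_fin mulr_ge0// line_avg_ge0// => y; exact: sqr_ge0.
  - exact: (measurable_int mu iha2).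
  - by apply: filterS (ae_line_avg_sqr h0 ig Lg) => x /= hx _; rewrite lee_fin.
have La : L2 mu (line_avg j g h).
  split=> //; apply/integrableP; split.
    by apply/measurable_EFinP; exact: measurable_funX.
  under eq_integral do rewrite /= ger0_norm ?sqr_ge0//.
  apply: le_lt_trans le2 _.
  have := integrable_fin_num measurableT iha2.
  by rewrite fin_numE => /andP[_]; rewrite ltey.
split=> //; have [_ iL] := La.
apply: (@le_trans _ _ (\int[mu]_x (h * line_avg j (fun y => g y ^+ 2) h x))).
  by apply: fine_le le2; exact: integrable_fin_num.
rewrite RintegralZl// expr2 -mulrA ler_wpM2l//.
(* With the constant 1 as test function, the adjoint formula says that [line_avg] multiplies the
   total integral by [h]. *)
have := @integral_line_avg R N j (fun y => g y ^+ 2) (cst 1) h 1 ig2.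
move=> /(_ _ _)/=; rewrite normr1 => -/(_ (measurable_cst _) (fun=> lexx _)).
under eq_Rintegral do rewrite mulr1.
move=> ->.
rewrite (_ : \int[mu]_x (g x ^+ 2 * _) = \int[mu]_x (h * g x ^+ 2)).
  by rewrite RintegralZl.
apply: eq_Rintegral => x _; rewrite mulrC; congr (_ * _).
by rewrite Rintegral_cst//= mul1r; exact: fine_segment.
Qed.

Lemma sqr_sum_le n (a : nat -> R) :
  (\sum_(i < n) a i) ^+ 2 <= n%:R * \sum_(i < n) a i ^+ 2.
Proof.
elim: n => [|n IH]; first by rewrite !big_ord0 expr0n mul0r.
rewrite !big_ord_recr/=; move: IH.
set S := \sum_(i < n) a i; set Q := \sum_(i < n) a i ^+ 2 => IH.
have [n0|n0] := eqVneq n 0%N.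
  by rewrite /S /Q n0 !big_ord0 !add0r mul1r.
have n0' : 0 < n%:R :> R by rewrite ltr0n lt0n.
have : 2 * S * a n <= Q + n%:R * a n ^+ 2.
  have h : S ^+ 2 / n%:R <= Q by rewrite ler_pdivrMr// mulrC.
  apply: le_trans (_ : S ^+ 2 / n%:R + n%:R * a n ^+ 2 <= _); last by rewrite lerD2r.
  rewrite -subr_ge0 (_ : _ - _ = (S - n%:R * a n) ^+ 2 / n%:R).
    by rewrite divr_ge0 ?sqr_ge0 ?ltW.
  by field; rewrite gt_eqF.
by rewrite -natr1 mulrDl; nra.
Qed.

Lemma sqnorm_shift (v : E) w : mu.-integrable setT (EFin \o (fun x => w x ^+ 2)) ->
  sqnorm mu (fun x => w (x + v)) = sqnorm mu w.
Proof. by move=> iw; rewrite /sqnorm /Rintegral -(integral_shift v iw). Qed.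

Lemma L2_shift (v : E) w : L2 mu w -> L2 mu (fun x => w (x + v)).
Proof.
move=> [mw iw]; split; first exact: (measurableT_comp mw (measurable_shift v)).
exact: (integrable_shift v iw).
Qed.

(** Near [Omega], on the union [V] of the balls of radius [2 r], [local_identity] applies thanks to
    the margin [4 r]. Outside [V] the whole segment of length [r] misses [Omega], and both sides are
    0. *)
Lemma step_identity (Omega U : set E) w g (r : R) : 0 < r -> open U ->
  (forall y, Omega y -> ball y (4 * r) `<=` U) ->
  mu.-integrable setT (EFin \o w) -> mu.-integrable setT (EFin \o g) ->
  (forall x, ~ Omega x -> w x = 0) -> (forall x, ~ Omega x -> g x = 0) ->
  weak_partial U j w g ->
  {ae mu, forall x, w x - w (x - r *: e) = line_avg j g r x}.
Proof.
move=> r0 oU OU iw ig w0 g0 wg.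
pose V := \bigcup_(y in Omega) ball y (2 * r).
pose Z := [set x | w x - w (x - r *: e) <> line_avg j g r x].
have off x s : ~ V x -> 0 <= s <= r -> ~ Omega (x - s *: e).
  move=> Vx /andP[s0 sr] Os; apply: Vx; exists (x - s *: e) => //.
  apply/rV_ballP; split; first by rewrite mulr_gt0.
  move=> i; rewrite !mxE addrAC subrr sub0r normrN.
  case: (i == j); rewrite ?andbF ?andbT /= ?mulr1 ?mulr0 ?normr0 ?mulr_gt0//.
  by rewrite ger0_norm//; lra.
have : mu.-negligible (V `&` Z).
  apply: negligible_locally => x [y Oy yx].
  have /nbhs_ballP[d /= d0 dy] : nbhs x (ball y (2 * r)).
    by apply: open_nbhs_nbhs; split => //; exact: ball_open.
  exists d => //.
  have r20 : 0 < 2 * r by rewrite mulr_gt0.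
  have := @local_identity R N j U w g (y - const_mx (2 * r)) (y + const_mx (2 * r)) r (ltW r0)
    (rV_open_measurable oU) iw ig wg.
  case.
    move=> z zb; apply: (OU y Oy); apply/rV_ballP; split; first by rewrite mulr_gt0.
    move=> i; have := zb i.
    rewrite !mxE; case: (i == j); rewrite ?andbF ?andbT /= ?mulr1 ?mulr0;
    move=> /andP[? ?]; rewrite ltr_distlC; apply/andP; split; lra.
  move=> A [mA A0 subA]; exists A; split=> // z [xz Zz]; apply: subA => /= h; apply: Zz.
  by apply: h; apply/(box_ball _ _ r20); exact: dy.
apply: negligibleS => x /= Zx; split=> //; apply: contra_notP Zx => Vx.
have := off x 0 Vx; rewrite lexx scale0r subr0 (ltW r0) => /(_ isT)/w0 ->.
have := off x r Vx; rewrite lexx (ltW r0) => /(_ isT)/w0 ->.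
rewrite subr0 /line_avg /Rintegral (eq_integral (cst 0%E)) ?integral0// => s.
by rewrite inE/= in_itv/= => /(off x s Vx)/g0 ->.
Qed.

(** On [Omega], [w] is a telescoping sum of [m] increments of step [r]: as [m r] exceeds the width
    [2 M] of a cube around [Omega], the last point is outside and [w] is 0 there. Each increment has
    norm at most [r |g|], whence the constant [(m r)^2]. *)
Lemma poincare (Omega U : set E) (r : R) : 0 < r -> open U -> open Omega ->
  bounded_set Omega -> (forall y, Omega y -> ball y (4 * r) `<=` U) ->
  exists2 C : R, 0 <= C & forall w g, L2 mu w -> L2 mu g ->
    (forall x, ~ Omega x -> w x = 0) -> (forall x, ~ Omega x -> g x = 0) ->
    weak_partial U j w g -> sqnorm mu w <= C * sqnorm mu g.
Proof.
move=> r0 oU oO bO OU.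
have [M M0 OM] := bounded_set_coord bO.
have mO : measurable Omega by exact: rV_open_measurable.
have Ooo : (mu Omega < +oo)%E.
  apply: le_lt_trans (lebesgue_rV_box (const_mx (- M)) (const_mx M)).
  apply: le_measure; rewrite ?inE//; first exact: measurable_box.
  by move=> y Oy i; have := OM y Oy i; rewrite !mxE ltr_norml.
pose m := (Num.truncn (2 * M / r)).+1.
have mr : 2 * M < m%:R * r.
  by rewrite -ltr_pdivrMr// truncnS_gt.
exists (m%:R ^+ 2 * r ^+ 2) => [|w g Lw Lg w0 g0 wg]; first by rewrite mulr_ge0 ?sqr_ge0.
have iw : mu.-integrable setT (EFin \o w) by exact: (L2_integrable mO Ooo w0).
have ig : mu.-integrable setT (EFin \o g) by exact: (L2_integrable mO Ooo g0).
pose D x := w x - w (x - r *: e).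
have LD : L2 mu D by apply: L2B => //; exact: (L2_shift (- (r *: e)) Lw).
have [La la_le] := sqnorm_line_avg (ltW r0) ig Lg.
have D_le : sqnorm mu D <= r ^+ 2 * sqnorm mu g.
  have [_ ->] := L2_ae_eq (LD.1) La (filterS (fun x h => esym h) (step_identity r0 oU OU iw ig w0 g0 wg)).
  exact: la_le.
pose Di (i : nat) x := D (x - (i%:R * r) *: e).
have LDi i : L2 mu (Di i) by exact: (L2_shift (- ((i%:R * r) *: e)) LD).
have sDi i : sqnorm mu (Di i) = sqnorm mu D by exact: (sqnorm_shift (- ((i%:R * r) *: e)) LD.2).
have tele n x : \sum_(i < n) Di i x = w x - w (x - (n%:R * r) *: e).
  elim: n => [|n IH]; first by rewrite big_ord0 mul0r scale0r subr0 subrr.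
  rewrite big_ord_recr/= IH /Di /D -natr1 mulrDl mul1r scalerDl opprD [x + (_ - _)]addrA.
  by rewrite addrA subrK.
have far x : Omega x -> w (x - (m%:R * r) *: e) = 0.
  move=> Ox; apply: w0 => Oy; have := OM _ Ox j; have := OM _ Oy j.
  rewrite !mxE !eqxx mulr1 !ltr_norml => /andP[? ?] /andP[? ?]; lra.
have isum n : mu.-integrable setT (EFin \o (fun x => \sum_(i < n) Di i x ^+ 2)) /\
    \int[mu]_x (\sum_(i < n) Di i x ^+ 2) = n%:R * sqnorm mu D.
  elim: n => [|n [IH1 IH2]].
    under eq_fun do rewrite big_ord0.
    by rewrite mul0r /Rintegral integral0; split=> //; exact: integrable0.
  under eq_fun do rewrite big_ord_recr/=.
  split; first by apply: integrableD_EFin => //; exact: (LDi n).2.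
  rewrite RintegralD//; last exact: (LDi n).2.
  by rewrite IH2 -[X in _ + X]/(sqnorm mu (Di n)) sDi -natr1 mulrDl mul1r.
have [is1 is2] := isum m.
apply: (@le_trans _ _ (\int[mu]_x (m%:R * \sum_(i < m) Di i x ^+ 2))).
  apply: le_Rintegral => //; first exact: Lw.2.
    exact: integrableZl_EFin.
  move=> x _; have [Ox|Ox] := pselect (Omega x).
    by have := sqr_sum_le m (Di ^~ x); rewrite tele far// subr0.
  rewrite w0// expr0n/= mulr_ge0//; apply: sumr_ge0 => i _; exact: sqr_ge0.
rewrite RintegralZl// is2 mulrA -expr2 -mulrA ler_wpM2l ?sqr_ge0//.
Qed.

End poincare.

(** * Completeness of L^2 at a geometric rate *)

Section L2_complete.
Context {R : realType} d (T : measurableType d) (m : {measure set T -> \bar R}).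

(* The rate [8 ^ -n] leaves room for the weight [4 ^ n]: the sum of
   [4 ^ n (f n.+1 - f n)^2] is a.e. finite, so the increments are [O (2 ^ -n)]. *)
Lemma ae_cvg_of_sqnorm (f : nat -> T -> R) (C : R) : (forall n, L2 m (f n)) ->
  (forall n, sqnorm m (fun x => f n.+1 x - f n x) <= C / 8 ^+ n) ->
  {ae m, forall x, cvgn (fun n => f n x)}.
Proof.
move=> Lf fC; pose D n x := f n.+1 x - f n x.
have LD n : L2 m (D n) by exact: L2B.
pose F n x := (4 ^+ n * D n x ^+ 2)%:E.
have F0 n x : (0 <= F n x)%E by rewrite lee_fin mulr_ge0 ?sqr_ge0// exprn_ge0.
have iF n : m.-integrable setT (F n) by apply: integrableZl_EFin => //; exact: (LD n).2.
have mF n : measurable_fun setT (F n) by exact: (measurable_int m (iF n)).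
(* The bound is [C / 2^n], in the shape of [cvg_geometric_eseries_half]. *)
have intF n : (\int[m]_x F n x <= (2 * C / (2 ^ (n + 1))%:R)%:E)%E.
  rewrite -[leLHS]fineK; last exact: integrable_fin_num.
  rewrite lee_fin -/(Rintegral _ _ _) RintegralZl//; last exact: (LD n).2.
  apply: (@le_trans _ _ (4 ^+ n * (C / 8 ^+ n))).
    by rewrite ler_wpM2l ?exprn_ge0//; exact: fC.
  rewrite (_ : 4 ^+ n = 2 ^+ n * 2 ^+ n :> R); last by rewrite -exprMn; congr (_ ^+ _); lra.
  rewrite (_ : 8 ^+ n = 2 ^+ n * 2 ^+ n * 2 ^+ n :> R); last first.
    by rewrite -!exprMn; congr (_ ^+ _); lra.
  rewrite natrX addn1 exprS.
  have : 2 ^+ n != 0 :> R by rewrite expf_neq0.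
  move: (2 ^+ n) => z z0; rewrite le_eqVlt; apply/orP; left; apply/eqP.
  by field.
have iS : m.-integrable setT (fun x => \sum_(n <oo) F n x)%E.
  apply/integrableP; split.
    by apply: ge0_emeasurable_sum.
  under eq_integral do rewrite gee0_abs ?nneseries_ge0//.
  rewrite integral_nneseries//.
  apply: (@le_lt_trans _ _ (\sum_(n <oo) (2 * C / (2 ^ (n + 1))%:R)%:E)%E).
    by apply: lee_nneseries => [n _ _|n _]; [exact: integral_ge0|exact: intF].
  by have /cvg_lim -> // := @cvg_geometric_eseries_half R (2 * C) 0; rewrite ltry.
apply: filterS (integrable_ae measurableT iS) => x /= /(_ I) Sfin.
set G := fine (\sum_(n <oo) F n x)%E.
have FG n : 4 ^+ n * D n x ^+ 2 <= G.
  rewrite -lee_fin /G fineK//; apply: le_trans (nneseries_lim_ge n.+1 _) => //.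
  by rewrite big_nat_recr//= leeDr// sume_ge0.
have G0 : 0 <= G by apply: le_trans (FG 0%N); rewrite mulr_ge0 ?sqr_ge0 ?exprn_ge0.
have DG n : `|D n x| <= geometric (G + 1) 2^-1 n.
  rewrite /geometric/= exprVn ler_pdivlMr ?exprn_gt0//.
  rewrite -(@ler_pXn2r _ 2)// ?nnegrE; last 2 first.
  - by rewrite mulr_ge0// exprn_ge0.
  - by rewrite addr_ge0.
  rewrite exprMn real_normK ?num_real// -exprM mulrC mulnC exprM.
  apply: (@le_trans _ _ G); last by nra.
  by rewrite (_ : 2 ^+ 2 = 4) ?FG//; lra.
have cD : cvgn (series (fun n => D n x)).
  apply: normed_cvg; apply: (series_le_cvg _ _ DG).
  - by move=> n; exact: normr_ge0.
  - by move=> n; apply: le_trans (DG n).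
  - by apply: is_cvg_geometric_series; rewrite ger0_norm// invf_lt1//; lra.
rewrite (_ : (fun n => f n x) = fun n => f 0%N x + series (fun n => D n x) n).
  by apply: is_cvgD; [exact: is_cvg_cst|exact: cD].
by apply/funext => n; exact: (eq_sum_telescope (f ^~ x)).
Qed.

(** The limit is taken pointwise almost everywhere, and Fatou transfers the rate to it with the same
    constant. *)
Lemma L2_complete (f : nat -> T -> R) (C : R) : (forall n, L2 m (f n)) ->
  (forall n k, (n <= k)%N -> sqnorm m (fun x => f k x - f n x) <= C / 8 ^+ n) ->
  exists2 g, L2 m g & forall n, sqnorm m (fun x => g x - f n x) <= C / 8 ^+ n.
Proof.
move=> Lf fC.
have fcvg := ae_cvg_of_sqnorm Lf (fun n => fC n n.+1 (leqnSn n)).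
(* The upper limit is measurable on the whole space, including where the sequence diverges; [fine]
   assigns 0 to infinite values. *)
pose g x := fine (limn_esup (fun n => (f n x)%:E)).
have mg : measurable_fun setT g.
  apply: (measurableT_comp (fine_measurable measurableT)).
  apply: measurable_fun_limn_esup => n; apply/measurable_EFinP; exact: (Lf n).1.
have fg : {ae m, forall x, f n x @[n --> \oo] --> g x}.
  apply: filterS fcvg => x cfx.
  have cE : (f n x)%:E @[n --> \oo] --> (limn (fun n => f n x))%:E by apply: cvg_EFin => //; exact: nearW.
  by rewrite /g; have [_ ->] := cvg_limn_einf_sup cE.
have fat n : (\int[m]_x ((g x - f n x) ^+ 2)%:E <= (C / 8 ^+ n)%:E)%E.
  have Lfn k : L2 m (fun x => f (n + k)%N x - f n x) by exact: L2B.
  pose F k x := ((f (n + k)%N x - f n x) ^+ 2)%:E.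
  have mF k : measurable_fun setT (F k) by exact: (measurable_int m (Lfn k).2).
  have F0 k x : (0 <= F k x)%E by rewrite lee_fin sqr_ge0.
  have := fatou m measurableT mF (fun k x _ => F0 k x).
  rewrite (_ : (\int[m]_x limn_einf _ = \int[m]_x ((g x - f n x) ^+ 2)%:E)%E).
    move=> /le_trans; apply; rewrite limn_einf_lim; apply: lime_le; first exact: is_cvg_einfs.
    apply: nearW => k; apply: (@le_trans _ _ (\int[m]_x F k x)%E).
      by apply: ereal_inf_lbound; exists k => //=.
    rewrite -[leLHS]fineK; last exact: (integrable_fin_num measurableT (Lfn k).2).
    by rewrite lee_fin; apply: fC; exact: leq_addr.
  apply: ae_eq_integral => //.
  - rewrite /limn_einf; apply: measurableT_comp => //.
    by apply: measurable_fun_limn_esup => k; apply: measurableT_comp.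
  - apply/measurable_EFinP; apply: measurable_funX; apply: measurable_funB => //.
    exact: (Lf n).1.
  - apply: filterS fg => x fgx _.
    have h : f (n + k)%N x @[k --> \oo] --> g x.
      by move: fgx; rewrite -(cvg_shiftn n); under eq_fun do rewrite addnC.
    have hF : F k x @[k --> \oo] --> ((g x - f n x) ^+ 2)%:E.
      apply: cvg_EFin; first exact: nearW.
      rewrite /comp/=; under eq_fun do rewrite expr2.
      by rewrite expr2; apply: cvgM; apply: cvgB => //; exact: cvg_cst.
    by have [-> _] := cvg_limn_einf_sup hF.
have Lgf n : L2 m (fun x => g x - f n x).
  have mgf : measurable_fun setT (fun x => g x - f n x).
    by apply: measurable_funB => //; exact: (Lf n).1.
  split=> //; apply/integrableP; split; first by apply/measurable_EFinP; exact: measurable_funX.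
  under eq_integral do rewrite /= ger0_norm ?sqr_ge0//.
  by apply: le_lt_trans (fat n) _; rewrite ltry.
exists g.
  rewrite (_ : g = fun x => (g x - f 0%N x) + f 0%N x); first exact: L2D.
  by apply/funext => x; rewrite subrK.
move=> n; rewrite -lee_fin /sqnorm /Rintegral fineK//.
by apply: integrable_fin_num => //; exact: (Lgf n).2.
Qed.

End L2_complete.

(** * Linearity, closedness and uniqueness of weak derivatives *)

Section weak_derivatives.
Context {R : realType} {N : nat} (U : set 'rV[R]_N).
Local Notation E := 'rV[R]_N.
Local Notation mu := (@lebesgue_rV R N).
Hypothesis oU : open U.
Hypothesis Uoo : (mu U < +oo)%E.
Implicit Types (u w g phi : E -> R) (j : 'I_N).

Let mU : measurable U. Proof. exact: rV_open_measurable. Qed.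

Lemma patch_in (A : set E) u x : A x -> (u \_ A) x = u x.
Proof. by move=> Ax; rewrite patchE mem_set. Qed.

Lemma patch_out (A : set E) u x : ~ A x -> (u \_ A) x = 0.
Proof. by move=> Ax; rewrite patchE memNset. Qed.

Lemma L2_patch (A : set E) u : measurable A -> L2 mu u -> L2 mu (u \_ A).
Proof.
move=> mA [mu_ iu]; split.
  by apply/(measurable_restrictT _ _).1 => //; exact: measurable_funTS.
apply: (le_integrable measurableT _ _ iu).
  apply/measurable_EFinP; apply: measurable_funX.
  by apply/(measurable_restrictT _ _).1 => //; exact: measurable_funTS.
move=> x _ /=; rewrite lee_fin !ger0_norm ?sqr_ge0// patchE.
by case: ifP => // _; rewrite expr0n sqr_ge0.
Qed.

Lemma square_integrable_patch u : square_integrable U u <-> L2 mu (u \_ U).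
Proof.
have uE : (fun x => ((u x) ^+ 2)%:E) \_ U = EFin \o (fun x => (u \_ U) x ^+ 2).
  by apply/funext => x; rewrite /= !patchE; case: ifP => // _; rewrite expr0n.
split=> [[mu_ iu]|[mu_ iu]]; split.
- exact/(measurable_restrictT _ _).1.
- by rewrite -uE; exact/(integrable_mkcond _ _).1.
- exact/(measurable_restrictT _ _).2.
- by apply/(integrable_mkcond _ _).2 => //; rewrite uE.
Qed.

Lemma eq_weak_partial j w w' g g' : (forall x, U x -> w x = w' x) ->
  (forall x, U x -> g x = g' x) -> weak_partial U j w g -> weak_partial U j w' g'.
Proof.
move=> ww' gg' wg phi tphi; have := wg phi tphi.
rewrite (eq_integral (fun x => (w' x * partial j phi x)%:E)); last first.
  by move=> x /set_mem Ux; rewrite ww'.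
move=> ->; congr (- _)%E; apply: eq_integral => x /set_mem Ux.
by rewrite gg'.
Qed.

Lemma test_function_partial j phi : test_function U phi -> test_function U (partial j phi).
Proof.
move=> [sphi cphi phiU].
have supp_sub : closure [set x | partial j phi x != 0] `<=` closure [set x | phi x != 0].
  set K := closure [set x | phi x != 0].
  apply: (@subset_trans _ (closure K)); last first.
    by have /closure_id <- : closed K by exact: closed_closure.
  apply: closureS => x /=; apply: contra_neqP => Kx.
  rewrite /partial (near_eq_derive (g := cst 0)) ?derive_cst//.
  have : nbhs x (~` K).
    by apply: open_nbhs_nbhs; split=> //; apply: closed_openC; exact: closed_closure.
  apply: filterS => y Ky; apply/eqP; apply: contra_notT Ky => phiy.
  exact: subset_closure.
split.
- move=> s; have := sphi (rcons s j); rewrite -cats1 foldr_cat/=.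
  exact.
- by apply: subclosed_compact cphi supp_sub; exact: closed_closure.
- exact: subset_trans supp_sub phiU.
Qed.

Lemma test_function_bounded phi : test_function U phi ->
  exists M : R, forall x, `|phi x| <= M.
Proof.
move=> [sphi cphi phiU]; have cont : continuous phi by exact: (sphi [::]).1.
have : compact (phi @` closure [set x | phi x != 0]).
  by apply: continuous_compact => //; exact: continuous_subspaceT.
move=> /compact_bounded[M [_ KM]]; exists (`|M| + 1) => x.
have [phi0|phi0] := eqVneq (phi x) 0; first by rewrite phi0 normr0 addr_ge0.
apply: KM; first by rewrite ltr_pwDr// ler_norm.
by exists x => //; apply: subset_closure.
Qed.

Lemma L2_test_function phi : test_function U phi -> L2 mu (phi \_ U).
Proof.
move=> tphi; have [M phiM] := test_function_bounded tphi.
have mphi : measurable_fun setT phi.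
  by apply: rV_continuous_measurable; case: tphi => /(_ [::]) [].
apply/square_integrable_patch; split; first exact: measurable_funTS.
apply: measurable_bounded_integrable => //.
  by apply: measurable_funX; exact: measurable_funTS.
exists (M ^+ 2); split; first exact: num_real.
move=> y My x _ /=; apply: le_trans (ltW My).
rewrite ger0_norm ?sqr_ge0// -real_normK ?num_real// lerXn2r ?nnegrE//.
exact: le_trans (phiM x).
Qed.

(** For L^2 functions all integrals are finite, so the identity can be read in [R], where it is
    linear and Cauchy-Schwarz applies. *)
Lemma weak_partialP j w g : L2 mu w -> L2 mu g ->
  weak_partial U j w g <-> forall phi, test_function U phi ->
    \int[mu]_x (w x * (partial j phi \_ U) x) = - \int[mu]_x (g x * (phi \_ U) x).
Proof.
move=> Lw Lg.
have onU f psi : L2 mu f -> test_function U psi ->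
    (\int[mu]_(x in U) (f x * psi x)%:E = (\int[mu]_x (f x * (psi \_ U) x))%:E)%E.
  move=> Lf tpsi; rewrite /Rintegral fineK; last first.
    by apply: integrable_fin_num => //; exact: L2M (L2_test_function tpsi).
  rewrite [LHS]integral_mkcond; apply: eq_integral => x _; rewrite !patchE.
  by case: ifP => // _; rewrite mulr0.
split=> h phi tphi; have := h phi tphi; rewrite ?onU//; try exact: test_function_partial.
  by move=> -[].
by move=> ->.
Qed.

Lemma weak_partial_comb j (a b : R) w1 w2 g1 g2 :
  L2 mu w1 -> L2 mu w2 -> L2 mu g1 -> L2 mu g2 ->
  weak_partial U j w1 g1 -> weak_partial U j w2 g2 ->
  weak_partial U j (fun x => a * w1 x + b * w2 x) (fun x => a * g1 x + b * g2 x).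
Proof.
move=> Lw1 Lw2 Lg1 Lg2 /(weak_partialP j Lw1 Lg1) h1 /(weak_partialP j Lw2 Lg2) h2.
have L_comb f1 f2 : L2 mu f1 -> L2 mu f2 -> L2 mu (fun x => a * f1 x + b * f2 x).
  by move=> ? ?; apply: L2D; exact: L2Z.
apply/weak_partialP; [exact: L_comb|exact: L_comb|] => phi tphi.
have int_comb f1 f2 psi : L2 mu f1 -> L2 mu f2 -> L2 mu psi ->
    \int[mu]_x ((a * f1 x + b * f2 x) * psi x) =
    a * (\int[mu]_x (f1 x * psi x)) + b * (\int[mu]_x (f2 x * psi x)).
  move=> Lf1 Lf2 Lpsi; have i1 := L2M Lf1 Lpsi; have i2 := L2M Lf2 Lpsi.
  rewrite -!RintegralZl// -RintegralD//; try exact: integrableZl_EFin.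
  by apply: eq_Rintegral => x _; ring.
have L1 := L2_test_function tphi; have L2' := L2_test_function (test_function_partial j tphi).
by rewrite !int_comb// h1// h2//; ring.
Qed.

(** The defect [X] of the identity is a sum of two pairings with [w - w'] and [g - g'], so that
    Cauchy-Schwarz bounds [X^2] by a multiple of [eps]. *)
Lemma weak_partial_lim j w g : L2 mu w -> L2 mu g ->
  (forall eps : R, 0 < eps -> exists w' g', [/\ L2 mu w', L2 mu g',
     weak_partial U j w' g', sqnorm mu (fun x => w x - w' x) <= eps &
     sqnorm mu (fun x => g x - g' x) <= eps]) ->
  weak_partial U j w g.
Proof.
move=> Lw Lg lim; apply/weak_partialP => // phi tphi.
have L0 := L2_test_function tphi; have L1 := L2_test_function (test_function_partial j tphi).
apply/eqP; rewrite -addr_eq0; set X := _ + _.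
set a := sqnorm mu (phi \_ U); set b := sqnorm mu (partial j phi \_ U).
have a0 : 0 <= a by exact: sqnorm_ge0.
have b0 : 0 <= b by exact: sqnorm_ge0.
have X2 eps : 0 < eps -> X ^+ 2 <= eps * (2 * (a + b)).
  move=> /lim[w' [g' [Lw' Lg' /(weak_partialP j Lw' Lg') wg' we ge]]].
  have intB f f' psi : L2 mu f -> L2 mu f' -> L2 mu psi ->
      \int[mu]_x ((f x - f' x) * psi x) =
      \int[mu]_x (f x * psi x) - \int[mu]_x (f' x * psi x).
    move=> Lf Lf' Lpsi; rewrite -RintegralB//; try exact: L2M.
    by apply: eq_Rintegral => x _; ring.
  have XE : X = \int[mu]_x ((w x - w' x) * (partial j phi \_ U) x) +
                \int[mu]_x ((g x - g' x) * (phi \_ U) x).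
    by rewrite !intB// wg'// /X; ring.
  have c1 := cauchy_schwarz (L2B Lw Lw') L1.
  have c2 := cauchy_schwarz (L2B Lg Lg') L0.
  have d1 : sqnorm mu (fun x => w x - w' x) * b <= eps * b by rewrite ler_wpM2r.
  have d2 : sqnorm mu (fun x => g x - g' x) * a <= eps * a by rewrite ler_wpM2r.
  have {}c1 := le_trans c1 d1; have {}c2 := le_trans c2 d2.
  move: c1 c2; rewrite XE; set p := \int[mu]_x _; set q := \int[mu]_x _ => c1 c2.
  have := sqr_ge0 (p - q).
  rewrite (_ : (p + q) ^+ 2 = 2 * p ^+ 2 + 2 * q ^+ 2 - (p - q) ^+ 2); first lra.
  by ring.
rewrite -sqrf_eq0 eq_le sqr_ge0 andbT; apply/ler_addgt0Pr => eps e0.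
rewrite add0r; apply: le_trans (X2 (eps / (2 * (a + b) + 1)) _) _.
  by rewrite divr_gt0// ltr_wpDl// mulr_ge0// addr_ge0.
rewrite mulrAC ler_pdivrMr; last by rewrite ltr_wpDl// mulr_ge0// addr_ge0.
by apply: ler_wpM2l; [exact: ltW|lra].
Qed.

Lemma weak_partial_ae j w w' g g' : L2 mu w -> L2 mu w' -> L2 mu g -> L2 mu g' ->
  {ae mu, forall x, w x = w' x} -> {ae mu, forall x, g x = g' x} ->
  weak_partial U j w g -> weak_partial U j w' g'.
Proof.
move=> Lw Lw' Lg Lg' ww' gg' wg.
have sq0 f f' : L2 mu f -> L2 mu f' -> {ae mu, forall x, f x = f' x} ->
    sqnorm mu (fun x => f' x - f x) = 0.
  move=> Lf Lf' ff'.
  have L0 : L2 mu (cst 0).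
    by split=> //; rewrite (_ : (fun x => _) = cst 0) ?expr0n//;
      [exact: integrable0|apply/funext => x; rewrite expr0n].
  have [_ ->] : L2 mu (fun x => f' x - f x) /\
      sqnorm mu (fun x => f' x - f x) = sqnorm mu (cst 0).
    apply: L2_ae_eq => //; first by have [] := L2B Lf' Lf.
    by apply: filterS ff' => x ->; rewrite subrr.
  rewrite /sqnorm /Rintegral (eq_integral (cst 0%E)) ?integral0// => x _.
  by rewrite expr0n.
by apply: weak_partial_lim => // eps e0; exists w, g; split=> //; rewrite sq0// ltW.
Qed.

(** The difference of the two candidates is a weak derivative of the zero function, and
    [weak_partial_eq0] makes it vanish on the zero set, which is everything. *)
Lemma weak_partial_unique j w g g' : L2 mu w -> L2 mu g -> L2 mu g' ->
  (forall x, ~ U x -> g x = 0) -> (forall x, ~ U x -> g' x = 0) ->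
  weak_partial U j w g -> weak_partial U j w g' -> {ae mu, forall x, g x = g' x}.
Proof.
move=> Lw Lg Lg' g0 g'0 wg wg'.
have := weak_partial_comb 1 (-1) Lw Lw Lg Lg' wg wg'.
rewrite (_ : (fun x => 1 * w x + _) = cst 0); last by apply/funext => x /=; ring.
move=> h; have i0 : mu.-integrable setT (EFin \o (cst 0 : E -> R)) by exact: integrable0.
have igg' : mu.-integrable setT (EFin \o (fun x => 1 * g x + -1 * g' x)).
  have ig := L2_integrable mU Uoo g0 Lg; have ig' := L2_integrable mU Uoo g'0 Lg'.
  by apply: integrableD_EFin => //; exact: integrableZl_EFin.
apply: filterS (weak_partial_eq0 oU i0 igg' h) => x /= gg'.
have [Ux|Ux] := pselect (U x); last by rewrite g0// g'0.
by have := gg' Ux erefl; lra.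
Qed.

End weak_derivatives.

(** * Abstract extraction of a Cauchy minimizing sequence *)

Section minimizing_sequence.
Context {R : realType} (T : Type) (A H : set T) (mid : T -> T -> T).
Context (J : T -> R) (D : T -> T -> R) (I : R).

Definition mid_closed (K : set T) := forall u v, K u -> K v -> K (mid u v).

Hypothesis midA : mid_closed A.
Hypothesis HA : H `<=` A.
Hypothesis J_ge0 : forall u, A u -> 0 <= J u.
Hypothesis JD : forall u v, A u -> A v ->
  J (mid u v) + D u v / 4 <= (J u + J v) / 2.
Hypothesis HI : forall eps, 0 < eps -> exists2 u, H u & J u < I + eps.

(* [H] need not be stable under [mid]; its constraints are disjunctions of stable
   ones, [T1] and [T2], one of which is selected by the ultrafilter. *)
Lemma exists_minimizing_sequence (delta : nat -> R) :
  (forall n, 0 < delta n) -> {homo delta : n k / (n <= k)%N >-> k <= n} ->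
  exists v : nat -> T, [/\ forall n, A (v n), forall n, J (v n) <= I + delta n,
    forall n k, (n <= k)%N -> D (v n) (v k) <= delta n &
    forall T1 T2, mid_closed T1 -> mid_closed T2 -> H `<=` T1 `|` T2 ->
      (exists v', forall n, T1 (v' n) /\ A (v' n) /\ D (v n) (v' n) <= delta n) \/
      (exists v', forall n, T2 (v' n) /\ A (v' n) /\ D (v n) (v' n) <= delta n)].
Proof.
move=> d0 dmono.
pose F := filter_from [set eps : R | 0 < eps] (fun eps => H `&` [set u | J u < I + eps]).
have FF : ProperFilter F.
  apply: filter_from_proper; last first.
    by move=> eps /HI[u Hu Ju]; exists u.
  apply: filter_from_filter; first by exists 1 => /=.
  move=> e1 e2 /= e10 e20; exists (Num.min e1 e2); first by rewrite /= lt_min e10.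
  move=> u [Hu /= Ju]; split; split => //=; apply: (lt_le_trans Ju);
  by rewrite lerD2l ge_min lexx ?orbT.
have [UU [UUu FUU]] := ultraFilterLemma FF.
have UF : ProperFilter UU by exact: ultra_proper.
have UH : UU H.
  by apply: FUU; exists 1 => //= u [].
have Uclose eps : 0 < eps -> UU [set u | J u < I + eps].
  by move=> e0; apply: FUU; exists eps => //= u [].
pose KK (K : set T) := [/\ mid_closed K, K `<=` A & UU K].
have KKI K1 K2 : KK K1 -> KK K2 -> KK (K1 `&` K2).
  move=> [m1 A1 U1] [m2 A2 U2]; split; last exact: filterI.
    by move=> u v [? ?] [? ?]; split; [exact: m1|exact: m2].
  by move=> u [/A1].
have KKA : KK A by split=> //; exact: filterS UH.
pose S := [set c : R | exists2 K, KK K & forall u, K u -> c <= J u].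
have S0 : S !=set0 by exists 0, A.
have SI : ubound S I.
  move=> c [K [_ _ UK] cK]; apply/ler_addgt0Pr => eps e0.
  have [u [Ku /= Ju]] := @filter_ex _ UU UF _ (filterI UK (Uclose _ e0)).
  exact: le_trans (cK u Ku) (ltW Ju).
have supS : has_sup S by split=> //; exists I.
pose M := sup S.
have MI : M <= I by exact: ge_sup.
(* If [J u] and [J v] are at most [M + eta] and [J] is at least [M - eta] at the midpoint, then
   [D u v / 4 <= 2 eta], that is, [D u v <= delta]. *)
pose eta n := delta n / 8.
have eta0 n : 0 < eta n by rewrite divr_gt0.
have low n : exists K, KK K /\ forall u, K u -> M - eta n <= J u.
  have [c [K KKK cK] Mc] := sup_adherent (eta0 n) supS.
  by exists K; split=> // u Ku; exact: le_trans (ltW Mc) (cK u Ku).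
have [K0 K0P] := choice low.
(* Intersecting makes the sets decrease, so that later terms of the sequence can be compared with
   earlier ones inside the same set. *)
pose fix Kn n := if n is n'.+1 then Kn n' `&` K0 n else K0 0%N.
have KnK n : KK (Kn n).
  by elim: n => [|n IH]; [exact: (K0P 0%N).1|apply: KKI => //; exact: (K0P n.+1).1].
have KnS n : Kn n `<=` K0 n by case: n => [|n] //= u [].
have Kn_mono n k : (n <= k)%N -> Kn k `<=` Kn n.
  elim: k => [|k IH]; first by rewrite leqn0 => /eqP ->.
  by rewrite leq_eqVlt => /predU1P[->//|/IH h] u /= [/h].
have high K n : KK K -> exists2 u, K u & J u <= M + eta n.
  move=> KKK; apply: contrapT => noK.
  have : S (M + eta n).
    exists K => // u Ku; rewrite leNgt; apply/negP => /ltW Ju.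
    by apply: noK; exists u.
  move/(sup_upper_bound supS); rewrite -/M; have := eta0 n; lra.
have close n u v : Kn n u -> Kn n v -> J u <= M + eta n -> J v <= M + eta n ->
    D u v <= delta n.
  move=> Ku Kv Ju Jv; have [mK KA _] := KnK n.
  have := (K0P n).2 _ (KnS _ _ (mK _ _ Ku Kv)).
  have := JD (KA _ Ku) (KA _ Kv); rewrite /eta in Ju Jv *; lra.
have vex n : exists u, Kn n u /\ J u <= M + eta n.
  by have [u Ku Ju] := high _ n (KnK n); exists u.
have [v vP] := choice vex.
have near_v (T1 : set T) : mid_closed T1 -> UU T1 ->
    exists v', forall n, T1 (v' n) /\ A (v' n) /\ D (v n) (v' n) <= delta n.
  move=> mT1 UT1.
  (* The smaller set is still one of those entering [M], so it contains almost minimizers at the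
     same level; lying in [Kn n], they are close to [v n]. *)
  have KT1 n : KK (Kn n `&` (T1 `&` A)).
    apply: KKI => //; split; last by apply: filterI => //; case: KKA.
      by move=> a b [? ?] [? ?]; split; [exact: mT1|exact: midA].
    by move=> u [].
  have vex' n : exists u, (Kn n `&` (T1 `&` A)) u /\ J u <= M + eta n.
    by have [u Ku Ju] := high _ n (KT1 n); exists u.
  have [v' v'P] := choice vex'.
  exists v' => n; have [[Kv' [Tv' Av']] Jv'] := v'P n; have [Kv Jv] := vP n.
  by split=> //; split=> //; exact: close.
exists v; split.
- by move=> n; have [_ KA _] := KnK n; apply: KA; exact: (vP n).1.
- move=> n; apply: le_trans (vP n).2 _; apply: lerD => //.
  by rewrite /eta; have := d0 n; lra.
- move=> n k nk; have [Kv Jv] := vP n; have [Kv' Jv'] := vP k.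
  apply: close => //; first exact: Kn_mono nk _ Kv'.
  apply: le_trans Jv' _; rewrite lerD2l /eta; have := dmono _ _ nk; lra.
- move=> T1 T2 mT1 mT2 HT.
  have [UT1|UT1] := in_ultra_setVsetC T1 UUu; [left|right]; first exact: near_v.
  apply: near_v => //; apply: filterS (filterI UH UT1) => u [/HT [|//]] h1 h2.
  by [].
Qed.

End minimizing_sequence.

(** * H^1 functions with the same values outside [Omega] *)

Section dirichlet.
Context {R : realType} {N : nat} (Omega : set 'rV[R]_N).
Hypothesis hOmega : bounded_domain Omega.
Local Notation E := 'rV[R]_N.
Local Notation mu := (@lebesgue_rV R N).
Local Notation U := (neighborhood1 Omega).
Implicit Types (u v w g : E -> R) (j : 'I_N).

Let oU : open U. Proof. exact: open_neighborhood1. Qed.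
Let oO : open Omega. Proof. by case: hOmega. Qed.
Let bO : bounded_set Omega. Proof. by case: hOmega. Qed.
Let Uoo : (mu U < +oo)%E. Proof. exact: neighborhood1_lty. Qed.
Let mU : measurable U. Proof. exact: rV_open_measurable. Qed.
Let mO : measurable Omega. Proof. exact: rV_open_measurable. Qed.
Let OU : Omega `<=` U. Proof. exact: subset_neighborhood1. Qed.

Definition grad u j : E -> R := weak_grad U u j \_ U.

Lemma gradP u j : H1 U u ->
  [/\ L2 mu (u \_ U), L2 mu (grad u j) & weak_partial U j (u \_ U) (grad u j)].
Proof.
move=> [squ hu].
have [sqg wg] := getPex (hu j).
split; [exact/(square_integrable_patch oU _).1|exact/(square_integrable_patch oU _).1|].
by apply: eq_weak_partial wg => x Ux; rewrite /grad patch_in.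
Qed.

Lemma H1_of_L2 w : L2 mu w ->
  (forall j, exists2 g, L2 mu g & weak_partial U j w g) -> H1 U w.
Proof.
have sq f : L2 mu f -> square_integrable U f.
  move=> [mf if2]; split; first exact: measurable_funTS.
  exact: (integrableS measurableT mU (@subsetT _ _) if2).
move=> Lw hw; split; first exact: sq.
by move=> j; have [g Lg wg] := hw j; exists g; split=> //; exact: sq.
Qed.

(** [weak_grad] comes from a choice; this is how a concrete gradient is recognized. *)
Lemma grad_ae_eq u g j : H1 U u -> L2 mu g -> (forall x, ~ U x -> g x = 0) ->
  weak_partial U j (u \_ U) g -> {ae mu, forall x, grad u j x = g x}.
Proof.
move=> Hu Lg g0 wg; have [Lu Lgu wgu] := gradP j Hu.
apply: (weak_partial_unique oU Uoo Lu Lgu Lg _ g0 wgu wg) => x Ux.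
exact: patch_out.
Qed.

Lemma H1_mid u v : H1 U u -> H1 U v -> H1 U (fun x => (u x + v x) / 2) /\
  forall j, {ae mu, forall x, grad (fun x => (u x + v x) / 2) j x =
                              (grad u j x + grad v j x) / 2}.
Proof.
move=> Hu Hv.
have mid_comb f1 f2 : (fun x : E => (f1 x + f2 x) / 2) = fun x => 2^-1 * f1 x + 2^-1 * f2 x :> R.
  by apply/funext => x; lra.
have wm j : weak_partial U j (fun x => (u x + v x) / 2) (fun x => (grad u j x + grad v j x) / 2).
  have [Lu Lgu wu] := gradP j Hu; have [Lv Lgv wv] := gradP j Hv.
  apply: eq_weak_partial (weak_partial_comb oU Uoo 2^-1 2^-1 Lu Lv Lgu Lgv wu wv) => x Ux.
    by rewrite !patch_in//; lra.
  by lra.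
have Lmid f1 f2 : L2 mu f1 -> L2 mu f2 -> L2 mu (fun x => (f1 x + f2 x) / 2).
  by move=> L1 L2'; rewrite mid_comb; apply: L2D; exact: L2Z.
have Hm : H1 U (fun x => (u x + v x) / 2).
  split=> [|j].
    apply/(square_integrable_patch oU _).2.
    rewrite (_ : _ \_ U = fun x => ((u \_ U) x + (v \_ U) x) / 2).
      by apply: Lmid; apply/(square_integrable_patch oU _).1; [case: Hu|case: Hv].
    by apply/funext => x; rewrite !patchE; case: ifP => // _; lra.
  exists (fun x => (grad u j x + grad v j x) / 2); split; last exact: wm.
  have [_ Lgu _] := gradP j Hu; have [_ Lgv _] := gradP j Hv.
  have [mg ig] := Lmid _ _ Lgu Lgv; split; first exact: measurable_funTS.
  exact: (integrableS measurableT mU (@subsetT _ _) ig).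
split=> // j; have [_ Lgu _] := gradP j Hu; have [_ Lgv _] := gradP j Hv.
apply: grad_ae_eq => //; first exact: Lmid.
  by move=> x Ux; rewrite /grad !patch_out//; lra.
by apply: eq_weak_partial (wm j) => x Ux //; rewrite patch_in.
Qed.

Lemma sqnorm_patch_ae (A : set E) w : measurable A -> L2 mu w ->
  {ae mu, forall x, ~ A x -> w x = 0} -> sqnorm mu w = sqnorm mu (w \_ A).
Proof.
move=> mA Lw w0; have LA := L2_patch mA Lw.
have [|_ ->//] := L2_ae_eq LA.1 Lw.
by apply: filterS w0 => x w0; have [Ax|Ax] := pselect (A x);
  [rewrite patch_in|rewrite patch_out// w0].
Qed.

Lemma H1_difference u v j : H1 U u -> H1 U v ->
  [/\ L2 mu (fun x => (u \_ U) x - (v \_ U) x),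
      L2 mu (fun x => grad u j x - grad v j x) &
      weak_partial U j (fun x => (u \_ U) x - (v \_ U) x)
        (fun x => grad u j x - grad v j x)].
Proof.
move=> Hu Hv; have [Lu Lgu wu] := gradP j Hu; have [Lv Lgv wv] := gradP j Hv.
split; [exact: L2B|exact: L2B|].
apply: eq_weak_partial (weak_partial_comb oU Uoo 1 (-1) Lu Lv Lgu Lgv wu wv) => x _; ring.
Qed.

(** The difference is 0 almost everywhere on [U] minus [Omega], boundary of [Omega] included, and
    [weak_partial_eq0] gives the same for its gradient; outside [U] both gradients are extended by
    0. *)
Lemma ae_grad_eq u v j : H1 U u -> H1 U v ->
  {ae mu, forall x, (U `\` Omega) x -> u x = v x} ->
  {ae mu, forall x, ~ Omega x -> grad u j x - grad v j x = 0}.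
Proof.
move=> Hu Hv uv; have [Lw Lg wg] := H1_difference j Hu Hv.
have iw : mu.-integrable setT (EFin \o (fun x => (u \_ U) x - (v \_ U) x)).
  by apply: (L2_integrable mU Uoo) => // x Ux; rewrite !patch_out// subrr.
have ig : mu.-integrable setT (EFin \o (fun x => grad u j x - grad v j x)).
  by apply: (L2_integrable mU Uoo) => // x Ux; rewrite /grad !patch_out// subrr.
apply: filterS2 uv (weak_partial_eq0 oU iw ig wg) => x uvx gx Ox.
have [Ux|Ux] := pselect (U x); last by rewrite /grad !patch_out// subrr.
by apply: gx => //; rewrite !patch_in// uvx// subrr.
Qed.

(** [poincare] wants functions that are 0 everywhere off [Omega]. The difference and its gradient
    are so only almost everywhere; they are replaced by their restrictions to [Omega], which form a
    weak derivative pair by [weak_partial_ae]. *)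
Lemma poincare_difference j : exists2 C : R, 0 <= C & forall u v, H1 U u -> H1 U v ->
  {ae mu, forall x, (U `\` Omega) x -> u x = v x} ->
  sqnorm mu (fun x => (u \_ U) x - (v \_ U) x) <=
    C * sqnorm mu (fun x => grad u j x - grad v j x).
Proof.
have r0 : 0 < (4 * N.+1%:R)^-1 :> R by rewrite invr_gt0 mulr_gt0// ltr0n.
have [C C0 hC] := poincare j r0 oU oO bO (fun y Oy => @neighborhood1_ball R N Omega y Oy).
exists C => // u v Hu Hv uv; have [Lw Lg wg] := H1_difference j Hu Hv.
set w := (fun x => _) in Lw wg *; set g := (fun x => _) in Lg wg *.
have w0 : {ae mu, forall x, ~ Omega x -> w x = 0}.
  apply: filterS uv => x uvx Ox; rewrite /w.
  have [Ux|Ux] := pselect (U x); last by rewrite !patch_out// subrr.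
  by rewrite !patch_in// uvx// subrr.
have g0 : {ae mu, forall x, ~ Omega x -> g x = 0} by exact: ae_grad_eq.
rewrite (sqnorm_patch_ae mO Lw w0) (sqnorm_patch_ae mO Lg g0).
have ae_patch (f : E -> R) : {ae mu, forall x, ~ Omega x -> f x = 0} ->
    {ae mu, forall x, f x = (f \_ Omega) x}.
  apply: filterS => x f0; have [Ox|Ox] := pselect (Omega x); first by rewrite patch_in.
  by rewrite patch_out// f0.
apply: hC; [exact: L2_patch|exact: L2_patch|by move=> x; exact: patch_out|
  by move=> x; exact: patch_out|].
apply: (weak_partial_ae oU Uoo Lw _ Lg _ _ _ wg);
  [exact: L2_patch|exact: L2_patch|exact: ae_patch|exact: ae_patch].
Qed.

Lemma integral_sqr_weak_grad u : H1 U u ->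
  (\int[mu]_(x in Omega) (\sum_(j < N) (weak_grad U u j x) ^+ 2)%R%:E =
   (\sum_(j < N) sqnorm mu (grad u j \_ Omega))%:E)%E.
Proof.
move=> Hu.
have LO j : L2 mu (grad u j \_ Omega) by apply: L2_patch => //; have [] := gradP j Hu.
rewrite (_ : (\int[mu]_(x in Omega) _ = \int[mu]_x \sum_(j < N) (((grad u j \_ Omega) x) ^+ 2)%:E)%E); last first.
  rewrite integral_mkcond; apply: eq_integral => x _; rewrite patchE; case: ifPn => xO.
    rewrite sumEFin; congr (_%:E); apply: eq_bigr => j _.
    have Ox := set_mem xO; rewrite patch_in// /grad patch_in//; exact: OU.
  rewrite big1// => j _; rewrite patch_out ?expr0n//.
  by rewrite notin_setE in xO.
rewrite ge0_integral_sum//; last 2 first.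
- by move=> j; exact: (measurable_int _ (LO j).2).
- by move=> j x _; rewrite lee_fin sqr_ge0.
rewrite -sumEFin; apply: eq_bigr => j _.
by rewrite /sqnorm /Rintegral fineK//; apply: integrable_fin_num => //; exact: (LO j).2.
Qed.

End dirichlet.

Lemma term_le_sum2 {R : realType} {k N : nat} (F : 'I_k -> 'I_N -> R) i j :
  (forall i j, 0 <= F i j) -> F i j <= \sum_(i < k) \sum_(j < N) F i j.
Proof.
move=> F0; rewrite (bigD1 i)//= (bigD1 j)//= -addrA lerDl addr_ge0//.
  by apply: sumr_ge0.
by apply: sumr_ge0 => l _; apply: sumr_ge0.
Qed.

Lemma sum2_midpoint {R : realType} {k N : nat} (F D G H : 'I_k -> 'I_N -> R) :
  (forall i j, F i j + D i j / 4 = (G i j + H i j) / 2) ->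
  \sum_(i < k) \sum_(j < N) F i j + (\sum_(i < k) \sum_(j < N) D i j) / 4 =
  (\sum_(i < k) \sum_(j < N) G i j + \sum_(i < k) \sum_(j < N) H i j) / 2.
Proof.
move=> FDGH; rewrite !pair_big/= -big_split/= !mulr_suml -big_split/=.
by apply: eq_bigr => p _; exact: FDGH.
Qed.

(** * The energy, its distance and midpoints *)

Section energy.
Context {R : realType} {N k : nat} (Omega : set 'rV[R]_N) (f : 'I_k -> 'rV[R]_N -> R).
Hypothesis hOmega : bounded_domain Omega.
Local Notation E := 'rV[R]_N.
Local Notation mu := (@lebesgue_rV R N).
Local Notation U := (neighborhood1 Omega).
Implicit Types (u v : 'I_k -> E -> R).

Let mO : measurable Omega.
Proof. by apply: rV_open_measurable; case: hOmega. Qed.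

(** The cross term of [|h + d|^2] is absorbed by [|t h - d|^2 / t >= 0]. A small [t] keeps the
    factor of [h] close to 1, as needed to compare energies in the limit. *)
Lemma sqnorm_young d (T : measurableType d) (m : {measure set T -> \bar R})
    (t : R) (g h : T -> R) : 0 < t -> L2 m g -> L2 m h ->
  sqnorm m g <= (1 + t) * sqnorm m h + (1 + t^-1) * sqnorm m (fun x => g x - h x).
Proof.
move=> t0 Lg Lh; have Ld := L2B Lg Lh; set d' := (fun x => _) in Ld *.
have -> : sqnorm m g = sqnorm m (fun x => 1 * h x + 1 * d' x).
  by congr (sqnorm m _); apply/funext => x; rewrite /d'; ring.
have := sqnorm_ge0 m (fun x => t * h x + (-1) * d' x).
rewrite !sqnorm_comb//; set b := \int[m]_x _; set A := sqnorm m h; set B := sqnorm m d'.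
move=> h0; have : 0 <= t^-1 * (t ^+ 2 * A + 2 * t * -1 * b + (-1) ^+ 2 * B).
  by rewrite mulr_ge0// invr_ge0 ltW.
rewrite (_ : t^-1 * _ = t * A - 2 * b + t^-1 * B); last by field; rewrite gt_eqF.
nra.
Qed.

(** The part of [Hinfty] that is stable under midpoints: all but the separation of supports. *)
Definition admissible u : Prop := (forall i, H1 U (u i)) /\
  forall i, {ae mu, forall x, (U `\` Omega) x -> u i x = f i x}.

Definition energy u : R :=
  \sum_(i < k) \sum_(j < N) sqnorm mu (grad Omega (u i) j \_ Omega).

Definition energy_dist u v : R := \sum_(i < k) \sum_(j < N)
  sqnorm mu ((fun x => grad Omega (u i) j x - grad Omega (v i) j x) \_ Omega).

Definition midpoint u v : 'I_k -> E -> R := fun i x => (u i x + v i x) / 2.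

Lemma Jinfty_energy u : (forall i, H1 U (u i)) -> Jinfty Omega u = (energy u)%:E.
Proof.
move=> Hu; rewrite /Jinfty /energy -sumEFin; apply: eq_bigr => i _.
exact: integral_sqr_weak_grad.
Qed.

Lemma energy_ge0 u : 0 <= energy u.
Proof. by apply: sumr_ge0 => i _; apply: sumr_ge0 => j _; exact: sqnorm_ge0. Qed.

Lemma energy_dist_ge u v i j :
  sqnorm mu ((fun x => grad Omega (u i) j x - grad Omega (v i) j x) \_ Omega) <=
  energy_dist u v.
Proof.
exact: (term_le_sum2 i j (fun i j => sqnorm_ge0 mu _)).
Qed.

Lemma midpoint_admissible u v : admissible u -> admissible v -> admissible (midpoint u v).
Proof.
move=> [Hu fu] [Hv fv]; split=> i; first exact: (H1_mid hOmega (Hu i) (Hv i)).1.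
apply: filterS2 (fu i) (fv i) => x ux vx Ox; rewrite /midpoint ux// vx//; lra.
Qed.

Lemma energy_midpoint u v : (forall i, H1 U (u i)) -> (forall i, H1 U (v i)) ->
  energy (midpoint u v) + energy_dist u v / 4 = (energy u + energy v) / 2.
Proof.
move=> Hu Hv; apply: sum2_midpoint => i j.
have [_ Lu _] := gradP j (Hu i); have [_ Lv _] := gradP j (Hv i).
have [Hm mid_ae] := H1_mid hOmega (Hu i) (Hv i).
have [_ Lm _] := gradP j Hm.
have LuO := L2_patch mO Lu; have LvO := L2_patch mO Lv; have LmO := L2_patch mO Lm.
rewrite -(parallelogram LuO LvO).
have -> : sqnorm mu (grad Omega (midpoint u v i) j \_ Omega) =
    sqnorm mu (fun x => ((grad Omega (u i) j \_ Omega) x + (grad Omega (v i) j \_ Omega) x) / 2).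
  have mid_patch x : ((grad Omega (u i) j \_ Omega) x + (grad Omega (v i) j \_ Omega) x) / 2 =
      ((fun x => (grad Omega (u i) j x + grad Omega (v i) j x) / 2) \_ Omega) x.
    by rewrite !patchE; case: ifP => // _; lra.
  apply/esym; apply: (L2_ae_eq _ LmO _).2.
    apply: measurable_funM => //; apply: measurable_funD; [exact: LuO.1|exact: LvO.1].
  apply: filterS (mid_ae j) => x mx; rewrite mid_patch !patchE; case: ifP => // _.
congr (_ + sqnorm mu _ / 4); apply/funext => x; rewrite !patchE.
by case: ifP => // _; rewrite subrr.
Qed.

Lemma admissible_ae u v i : admissible u -> admissible v ->
  {ae mu, forall x, (U `\` Omega) x -> u i x = v i x}.
Proof.
by move=> [_ fu] [_ fv]; apply: filterS2 (fu i) (fv i) => x ux vx Ox; rewrite ux// vx.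
Qed.

Lemma grad_dist_le u v i j : admissible u -> admissible v ->
  sqnorm mu (fun x => grad Omega (u i) j x - grad Omega (v i) j x) <= energy_dist u v.
Proof.
move=> au av; apply: le_trans (energy_dist_ge u v i j).
have [_ Lg _] := H1_difference hOmega j (au.1 i) (av.1 i).
rewrite (sqnorm_patch_ae mO Lg)//.
exact: (ae_grad_eq hOmega j (au.1 i) (av.1 i) (admissible_ae i au av)).
Qed.

End energy.

(** * Limits of geometric bounds *)

Section limits.
Context {R : realType}.

Lemma exists_div_exp8 (c eps : R) : 0 < eps -> exists n : nat, c / 8 ^+ n <= eps.
Proof.
move=> eps0.
have : (geometric c (8^-1 : R)) @ \oo --> 0.
  by apply: cvg_geometric; rewrite ger0_norm// invf_lt1//; lra.
move=> /cvgrPdist_le /(_ _ eps0)[n _ /(_ n (leqnn n))] /=.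
by rewrite sub0r normrN exprVn => h; exists n; apply: le_trans h; exact: ler_norm.
Qed.

Lemma le0_div_exp8 (a c : R) : (forall n : nat, a <= c / 8 ^+ n) -> a <= 0.
Proof.
move=> h; apply/ler_addgt0Pr => eps eps0; rewrite add0r.
by have [n cn] := exists_div_exp8 c eps0; exact: le_trans (h n) cn.
Qed.

Lemma sqnormC d (T : measurableType d) (m : {measure set T -> \bar R}) (g h : T -> R) :
  sqnorm m (fun x => g x - h x) = sqnorm m (fun x => h x - g x).
Proof. by apply: eq_Rintegral => x _; rewrite -sqrrN opprB. Qed.

End limits.

(** * Supports and almost everywhere vanishing *)

Section supports.
Context {R : realType} {N : nat}.
Local Notation E := 'rV[R]_N.
Local Notation mu := (@lebesgue_rV R N).
Implicit Types (U B : set E) (v : E -> R).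

(** The complement of the support is a possibly uncountable union of open sets on which [v] is null,
    so the exceptional sets are gathered by [negligible_locally]. *)
Lemma ae_eq0_off_supp U B v : B `<=` U -> (forall x, B x -> ~ supp U v x) ->
  {ae mu, forall x, B x -> v x = 0}.
Proof.
move=> BU Bv.
have : mu.-negligible (B `&` [set x | v x <> 0]).
  apply: negligible_locally => x Bx.
  have [V [oV VU V0] Vx] : (\bigcup_(V in [set V : set E |
      [/\ open V, V `<=` U & {ae mu, forall x, V x -> v x = 0}]]) V) x.
    by apply: contrapT => nV; apply: (Bv x Bx); split=> //; exact: BU.
  have /nbhs_ballP[e /= e0 eV] := open_nbhs_nbhs (conj oV Vx).
  exists e => //; apply: negligibleS V0 => y [/eV Vy vy] /= h.
  exact/vy/h.
by apply: negligibleS => x /= /not_implyP.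
Qed.

Lemma supp_disjoint U B v x : open B -> B `<=` U -> B x ->
  {ae mu, forall x, B x -> v x = 0} -> ~ supp U v x.
Proof. by move=> oB BU Bx v0 [_]; apply; exists B. Qed.

Lemma euclidean_norm_ball (x y : E) : euclidean_norm (x - y) < 1 ->
  exists2 r : R, 0 < r & forall a b, ball x r a -> ball y r b -> euclidean_norm (a - b) < 1.
Proof.
move=> xy1.
have : nbhs (x - y) [set q : E | euclidean_norm (q - 0) < 1].
  apply: open_nbhs_nbhs; split; last by rewrite /= subr0.
  have /continuousP h := @continuous_euclidean_norm R N 0.
  exact: (h [set t : R | t < 1] (@open_lt R 1)).
move=> /nbhs_ballP[e /= e0 he]; exists (e / 2); first by rewrite divr_gt0.
move=> a b /rV_ballP[_ xa] /rV_ballP[_ yb].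
rewrite -[a - b]subr0; apply: he; apply/rV_ballP; split=> // i.
have := xa i; have := yb i; rewrite !mxE !ltr_norml => /andP[? ?] /andP[? ?].
by apply/andP; split; lra.
Qed.

End supports.

(** * The limit of an energy-Cauchy sequence is admissible *)

Section minimizer.
Context {R : realType} {N k : nat} (Omega : set 'rV[R]_N) (f : 'I_k -> 'rV[R]_N -> R).
Hypothesis hOmega : bounded_domain Omega.
Local Notation E := 'rV[R]_N.
Local Notation mu := (@lebesgue_rV R N).
Local Notation U := (neighborhood1 Omega).
Implicit Types (u v : 'I_k -> E -> R).

Let oU : open U. Proof. exact: open_neighborhood1. Qed.
Let mU : measurable U. Proof. exact: rV_open_measurable. Qed.
Let mO : measurable Omega.
Proof. by apply: rV_open_measurable; case: hOmega. Qed.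
Let Uoo : (mu U < +oo)%E.
Proof. by apply: neighborhood1_lty; case: hOmega. Qed.

Lemma Hinfty_admissible u : Hinfty Omega f u -> admissible Omega f u.
Proof. by move=> [Hu _ fu]; split. Qed.

Lemma boundary_data_Hinfty : boundary_data Omega f -> Hinfty Omega f f.
Proof. by move=> [Hf _ _ _ sf]; split=> // i; exact: aeW. Qed.

Lemma energy_young (t : R) u v : 0 < t -> (forall i, H1 U (u i)) -> (forall i, H1 U (v i)) ->
  energy Omega u <= (1 + t) * energy Omega v + (1 + t^-1) * energy_dist Omega u v.
Proof.
move=> t0 Hu Hv; rewrite /energy /energy_dist !mulr_sumr -big_split/=.
apply: ler_sum => i _; rewrite !mulr_sumr -big_split/=; apply: ler_sum => j _.
have [_ Lu _] := gradP j (Hu i); have [_ Lv _] := gradP j (Hv i).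
have := sqnorm_young t0 (L2_patch mO Lu) (L2_patch mO Lv).
congr (_ <= _ + _ * sqnorm mu _); apply/funext => x; rewrite !patchE.
by case: ifP => // _; rewrite subrr.
Qed.

(** Functions and gradients converge separately in L^2, and [weak_partial_lim] ties the limits
    together. A single [C] serves all bounds; the last conclusion passes on the Poincare inequality,
    for estimating elements close to [v n]. *)
Lemma admissible_limit (v : nat -> 'I_k -> E -> R) : (0 < N)%N ->
  (forall n, admissible Omega f (v n)) ->
  (forall n m, (n <= m)%N -> energy_dist Omega (v n) (v m) <= 1 / 8 ^+ n) ->
  exists u (C : R), [/\ 0 <= C, admissible Omega f u,
    forall n, energy_dist Omega u (v n) <= C / 8 ^+ n,
    forall n i, sqnorm mu (fun x => (u i \_ U) x - (v n i \_ U) x) <= C / 8 ^+ n &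
    forall w w' i, admissible Omega f w -> admissible Omega f w' ->
      sqnorm mu (fun x => (w i \_ U) x - (w' i \_ U) x) <= C * energy_dist Omega w w'].
Proof.
move=> N0 av vd; pose j0 : 'I_N := Ordinal N0.
have [C C0 hC] := poincare_difference hOmega j0.
have poinc w w' i : admissible Omega f w -> admissible Omega f w' ->
    sqnorm mu (fun x => (w i \_ U) x - (w' i \_ U) x) <= C * energy_dist Omega w w'.
  move=> aw aw'; apply: le_trans (hC _ _ (aw.1 i) (aw'.1 i) (admissible_ae i aw aw')) _.
  by rewrite ler_wpM2l// (grad_dist_le hOmega i j0 aw aw').
have Lv n i : L2 mu (v n i \_ U) by have [] := gradP j0 ((av n).1 i).
have Lg n i j : L2 mu (grad Omega (v n i) j) by have [] := gradP j ((av n).1 i).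
have /choice[W WP] i : exists W, L2 mu W /\
    forall n, sqnorm mu (fun x => W x - (v n i \_ U) x) <= C / 8 ^+ n.
  have [|W LW hW] := L2_complete (f := fun n => v n i \_ U) (C := C) (Lv ^~ i).
    move=> n m nm; rewrite sqnormC; apply: le_trans (poinc _ _ i (av n) (av m)) _.
    by rewrite ler_wpM2l// -[8 ^- n]mul1r vd.
  by exists W.
have /choice[G GP] (p : 'I_k * 'I_N) : exists G, L2 mu G /\
    forall n, sqnorm mu (fun x => G x - grad Omega (v n p.1) p.2 x) <= 1 / 8 ^+ n.
  have [|G LG hG] := L2_complete (f := fun n => grad Omega (v n p.1) p.2) (C := 1)
      (fun n => Lg n p.1 p.2).
    move=> n m nm; rewrite sqnormC.
    exact: le_trans (grad_dist_le hOmega p.1 p.2 (av n) (av m)) (vd n m nm).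
  by exists G.
(* The L^2 limits vanish outside [U] only up to a null set; [grad_ae_eq] wants it everywhere. *)
pose u i := W i \_ U; pose H i j := G (i, j) \_ U.
have Lu i : L2 mu (u i) by apply: L2_patch => //; exact: (WP i).1.
have LH i j : L2 mu (H i j) by apply: L2_patch => //; exact: (GP (i, j)).1.
have uU i : u i \_ U = u i.
  by apply/funext => x; rewrite /u !patchE; case: (x \in U).
have uv n i : sqnorm mu (fun x => u i x - (v n i \_ U) x) <= C / 8 ^+ n.
  apply: le_trans ((WP i).2 n); apply: sqnorm_le; [exact: L2B|apply: L2B => //; exact: (WP i).1|].
  move=> x; rewrite /u !patchE; case: ifP => // _; by rewrite subrr normr0.
have Hv n i j : sqnorm mu (fun x => H i j x - grad Omega (v n i) j x) <= 1 / 8 ^+ n.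
  apply: le_trans ((GP (i, j)).2 n); apply: sqnorm_le;
    [exact: L2B|apply: L2B => //; exact: (GP (i, j)).1|].
  move=> x; rewrite /H /grad !patchE; case: ifP => // _; by rewrite subrr normr0.
have wuH i j : weak_partial U j (u i) (H i j).
  apply: weak_partial_lim => // eps eps0.
  have [n Cn] := exists_div_exp8 (C + 1) eps0.
  exists (v n i \_ U), (grad Omega (v n i) j).
  have e8 : 0 <= 8 ^- n :> R by rewrite invr_ge0 exprn_ge0.
  split; [exact: Lv|exact: Lg| | |].
  - by have [_ _ wp] := gradP j ((av n).1 i); exact: wp.
  - by apply: le_trans (uv n i) _; apply: le_trans Cn; rewrite mulrDl; lra.
  - by apply: le_trans (Hv n i j) _; apply: le_trans Cn; rewrite mulrDl lerDr mulr_ge0.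
have HU i : H1 U (u i) by apply: H1_of_L2 => // j; exists (H i j).
have gu i j : {ae mu, forall x, grad Omega (u i) j x = H i j x}.
  by apply: grad_ae_eq => //; [move=> x; exact: patch_out|rewrite uU].
have au : admissible Omega f u.
  split=> // i.
  pose A0 := U `\` Omega.
  have mA0 : measurable A0 by exact: measurableD.
  (* Restricted to [A0], where every [v n] equals [f], this does not depend on [n] up to a null set,
     while its norm tends to 0. *)
  pose F n x := (u i x - (v n i \_ U) x).
  have LF n : L2 mu (F n \_ A0) by apply: L2_patch => //; exact: L2B.
  have FF0 n : {ae mu, forall x, (F n \_ A0) x = (F 0%N \_ A0) x}.
    apply: filterS2 ((av n).2 i) ((av 0%N).2 i) => x vn v0; rewrite !patchE.
    case: ifPn => // /set_mem A0x; rewrite /F !patch_in ?vn ?v0//; exact: A0x.1.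
  have F00 : sqnorm mu (F 0%N \_ A0) = 0.
    apply/eqP; rewrite eq_le sqnorm_ge0 andbT; apply: (le0_div_exp8 (c := C)) => n.
    have [_ ->] := L2_ae_eq (LF 0%N).1 (LF n) (FF0 n).
    apply: le_trans (uv n i); apply: sqnorm_le => //; first exact: L2B.
    by move=> x; rewrite patchE; case: ifP => // _; rewrite normr0.
  apply: filterS2 (sqnorm_eq0 (LF 0%N) F00) ((av 0%N).2 i) => x Fx v0x A0x.
  move: Fx; rewrite patch_in// /F patch_in; last exact: A0x.1.
  by move/eqP; rewrite subr_eq0 => /eqP ->; exact: v0x.
have ud n : energy_dist Omega u (v n) <= (k%:R * N%:R) / 8 ^+ n.
  rewrite /energy_dist; apply: (@le_trans _ _ (\sum_(i < k) \sum_(j < N) 8 ^- n)).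
    apply: ler_sum => i _; apply: ler_sum => j _.
    have Ld : L2 mu (fun x => grad Omega (u i) j x - grad Omega (v n i) j x).
      by have [] := H1_difference hOmega j (HU i) ((av n).1 i).
    rewrite -[8 ^- n]mul1r; apply: le_trans (Hv n i j).
    apply: (@le_trans _ _ (sqnorm mu (fun x => grad Omega (u i) j x - grad Omega (v n i) j x))).
      apply: sqnorm_le => //; first exact: L2_patch.
      by move=> x; rewrite patchE; case: ifP => // _; rewrite normr0.
    rewrite le_eqVlt; apply/orP; left; apply/eqP/esym.
    apply: (L2_ae_eq _ Ld _).2; first by have [] := L2B (LH i j) (Lg n i j).
    by apply: filterS (gu i j) => x ->.
  by rewrite !sumr_const !card_ord -[_ *+ k]mulr_natl -[8 ^- n *+ N]mulr_natl mulrA.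
exists u, (C + k%:R * N%:R); have kN0 : 0 <= k%:R * N%:R :> R by rewrite mulr_ge0.
split=> //.
- by rewrite addr_ge0.
- move=> n; apply: le_trans (ud n) _; rewrite ler_wpM2r ?invr_ge0 ?exprn_ge0//; lra.
- move=> n i; rewrite uU; apply: le_trans (uv n i) _.
  rewrite ler_wpM2r ?invr_ge0 ?exprn_ge0//; lra.
- move=> w w' i aw aw'; apply: le_trans (poinc w w' i aw aw') _; rewrite ler_wpM2r.
    by [].
  by apply: sumr_ge0 => l _; apply: sumr_ge0 => l' _; exact: sqnorm_ge0.
  lra.
Qed.

End minimizer.

Lemma exists_small_factor {R : realType} (a eps : R) : 0 <= a -> 0 < eps ->
  exists2 t, 0 < t & t * a <= eps / 2.
Proof.
move=> a0 eps0; have a1 : 0 < a + 1 by lra.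
exists (eps / (2 * (a + 1))); first by rewrite divr_gt0// mulr_gt0.
rewrite mulrAC ler_pdivrMr ?mulr_gt0// mulrA divfK// ler_wpM2l ?ltW//; lra.
Qed.

(** One half of [eps] pays for the factor [1 + t] on [I], the other for the terms proportional to
    [z], which stands for [8^-n]. *)
Lemma young_chain {R : realType} (I C t t' z e ev d eps : R) : 0 <= t -> 0 <= t' ->
  t * I <= eps / 2 -> (1 + t + (1 + t') * C) * z <= eps / 2 ->
  e <= (1 + t) * ev + (1 + t') * d -> ev <= I + z -> d <= C * z -> e <= I + eps.
Proof.
move=> t0 t'0 tI cz le_e le_ev le_d; apply: le_trans le_e _.
have {}le_ev : (1 + t) * ev <= (1 + t) * (I + z) by apply: ler_wpM2l => //; rewrite addr_ge0.
have {}le_d : (1 + t') * d <= (1 + t') * (C * z) by apply: ler_wpM2l => //; rewrite addr_ge0.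
apply: le_trans (lerD le_ev le_d) _.
have -> : (1 + t) * (I + z) + (1 + t') * (C * z) =
  I + (t * I + (1 + t + (1 + t') * C) * z) by ring.
by rewrite lerD2l [leRHS]splitr lerD.
Qed.

(** * The separation of supports in the limit, and the minimizer *)

Section existence.
Context {R : realType} {N k : nat} (Omega : set 'rV[R]_N) (f : 'I_k -> 'rV[R]_N -> R).
Hypothesis hOmega : bounded_domain Omega.
Local Notation E := 'rV[R]_N.
Local Notation mu := (@lebesgue_rV R N).
Local Notation U := (neighborhood1 Omega).
Implicit Types (u v : 'I_k -> E -> R).

Let oU : open U. Proof. exact: open_neighborhood1. Qed.
Let mU : measurable U. Proof. exact: rV_open_measurable. Qed.

Definition vanishing (B : set E) (i : 'I_k) : set ('I_k -> E -> R) :=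
  [set u | {ae mu, forall x, B x -> u i x = 0}].

Lemma mid_closed_vanishing B i : mid_closed (@midpoint R N k) (vanishing B i).
Proof.
move=> u v u0 v0; apply: filterS2 u0 v0 => x u0 v0 Bx.
by rewrite /midpoint u0// v0// addr0 mul0r.
Qed.

(** Were both supports met, a point of each would give two points at distance less than 1. *)
Lemma vanishing_or u (B B' : set E) i j : separated_supports Omega u -> i != j ->
  B `<=` U -> B' `<=` U ->
  (forall a b, B a -> B' b -> euclidean_norm (a - b) < 1) ->
  vanishing B i u \/ vanishing B' j u.
Proof.
move=> su ij BU B'U BB'.
have [h|h] := pselect (forall x, B x -> ~ supp U (u i) x); first by left; exact: ae_eq0_off_supp h.
right; apply: ae_eq0_off_supp B'U _ => b B'b sb; apply: h => a Ba sa.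
have := su i j ij; rewrite leNgt => /negP; apply.
apply: (@le_lt_trans _ _ (euclidean_norm (a - b))%:E).
  by apply: ereal_inf_lbound; exists a => //; exists b.
by rewrite lte_fin; exact: BB'.
Qed.

(** On [B] the component [u i] equals [(u i - v n i) + (v n i - v' n i)], because [v' n i] is 0
    there; both terms are [O(8^-n)] in squared norm. The sequence [v] itself need not vanish on
    [B]. *)
Lemma vanishing_limit (B : set E) i (C : R) u (v v' : nat -> 'I_k -> E -> R) :
  open B -> B `<=` U -> (forall i, H1 U (u i)) ->
  (forall n, H1 U (v n i)) -> (forall n, H1 U (v' n i)) ->
  (forall n, vanishing B i (v' n)) ->
  (forall n, sqnorm mu (fun x => (u i \_ U) x - (v n i \_ U) x) <= C / 8 ^+ n) ->
  (forall n, sqnorm mu (fun x => (v n i \_ U) x - (v' n i \_ U) x) <= C / 8 ^+ n) ->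
  vanishing B i u.
Proof.
move=> oB BU Hu Hv Hv' v'0 uv vv'.
have mB : measurable B by exact: rV_open_measurable.
have L w : H1 U w -> L2 mu (w \_ U).
  by case=> sq _; exact/(square_integrable_patch oU _).1.
have LB : L2 mu ((u i \_ U) \_ B) by apply: L2_patch => //; exact: L.
have sq0 : sqnorm mu ((u i \_ U) \_ B) = 0.
  apply/eqP; rewrite eq_le sqnorm_ge0 andbT; apply: (le0_div_exp8 (c := 4 * C)) => n.
  have Luv := L2B (L _ (Hu i)) (L _ (Hv n)).
  have Lvv' := L2B (L _ (Hv n)) (L _ (Hv' n)).
  apply: (@le_trans _ _ (2 * (C / 8 ^+ n) + 2 * (C / 8 ^+ n))); last by lra.
  apply: le_trans (lerD (ler_wpM2l _ (uv n)) (ler_wpM2l _ (vv' n))) => //.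
  apply: le_trans (sqnormD_le Luv Lvv').
  have Lsum := L2D Luv Lvv'; set s := (fun x => _) in Lsum *.
  have -> : sqnorm mu ((u i \_ U) \_ B) = sqnorm mu (s \_ B).
    apply/esym; apply: (L2_ae_eq _ LB _).2; first exact: (L2_patch mB Lsum).1.
    apply: filterS (v'0 n) => x v'x; rewrite [LHS]patchE [RHS]patchE; case: ifPn => // /set_mem Bx.
    rewrite /s [in RHS]patch_in; last exact: BU.
    by rewrite (patch_in (v' n i)) ?v'x//; [|exact: BU]; rewrite patch_in; [ring|exact: BU].
  apply: sqnorm_le => //; first exact: L2_patch.
  by move=> x; rewrite patchE; case: ifP => // _; rewrite normr0.
apply: filterS (sqnorm_eq0 LB sq0) => x + Bx.
by rewrite patch_in// patch_in//; exact: BU.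
Qed.

End existence.

Theorem theorem1p1 (R : realType) (N k : nat) (hN : (2 <= N)%N)
    (hk : (2 <= k)%N) (Omega : set 'rV[R]_N) (f : 'I_k -> 'rV[R]_N -> R)
    (hOmega : bounded_domain Omega) (hf : boundary_data Omega f) :
  exists2 u : 'I_k -> 'rV[R]_N -> R, Hinfty Omega f u &
    Jinfty Omega u = ereal_inf [set Jinfty Omega v | v in Hinfty Omega f].
Proof.
have N0 : (0 < N)%N by apply: leq_trans hN.
have Hf := boundary_data_Hinfty hf.
have JE u : Hinfty Omega f u -> Jinfty Omega u = (energy Omega u)%:E.
  by move=> [Hu _ _]; exact: Jinfty_energy.
set S := [set Jinfty Omega v | v in Hinfty Omega f].
(* The datum [f] is itself a competitor of finite energy. *)
have S_fin : ereal_inf S \is a fin_num.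
  rewrite ge0_fin_numE.
    apply: (@le_lt_trans _ _ (Jinfty Omega f)); last by rewrite JE// ltry.
    by apply: ereal_inf_lbound; exists f.
  by apply: le_ereal_inf_tmp => _ [v Hv <-]; rewrite JE// lee_fin energy_ge0.
pose I := fine (ereal_inf S); have IE : ereal_inf S = I%:E by rewrite /I fineK.
have HI eps : 0 < eps -> exists2 u, Hinfty Omega f u & energy Omega u < I + eps.
  move=> eps0; have [_ [v Hv <-]] := lb_ereal_inf_adherent eps0 S_fin.
  by rewrite IE JE// -EFinD lte_fin => ?; exists v.
(* The tolerances follow the rate required by [L2_complete]. *)
have d0 n : 0 < 1 / 8 ^+ n :> R by rewrite divr_gt0// exprn_gt0.
have dmono : {homo (fun n => 1 / 8 ^+ n : R) : n m / (n <= m)%N >-> m <= n}.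
  move=> n m nm; rewrite ler_pdivrMr ?exprn_gt0// mulrAC ler_pdivlMr ?exprn_gt0//.
  by rewrite !mul1r ler_weXn2l//; lra.
have midJ u w : admissible Omega f u -> admissible Omega f w ->
    energy Omega (midpoint u w) + energy_dist Omega u w / 4 <=
    (energy Omega u + energy Omega w) / 2.
  by move=> [Hu _] [Hw _]; rewrite le_eqVlt; apply/orP; left; apply/eqP; exact: energy_midpoint.
have midA : mid_closed (@midpoint R N k) (admissible Omega f).
  by move=> u w; exact: midpoint_admissible.
have HA : Hinfty Omega f `<=` admissible Omega f by move=> u; exact: Hinfty_admissible.
have [v [av vI vd vT]] := exists_minimizing_sequence midA HA
  (fun u _ => energy_ge0 Omega u) midJ HI d0 dmono.
have [u [C [C0 au ud uv poinc]]] := admissible_limit hOmega N0 av vd.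
have su : separated_supports Omega u.
  move=> i j ij; apply: le_ereal_inf_tmp => _ [x sx [y sy <-]].
  rewrite lee_fin leNgt; apply/negP => /euclidean_norm_ball[r r0 xyr].
  have shrink z : neighborhood1 Omega z -> exists2 e, 0 < e & e <= r /\
      ball z e `<=` neighborhood1 Omega.
    move=> Uz; have /nbhs_ballP[e /= e0 eU] :=
      open_nbhs_nbhs (conj (@open_neighborhood1 R N Omega) Uz).
    exists (Num.min e r); first by rewrite lt_min e0.
    split; first by rewrite ge_min lexx orbT.
    by apply: subset_trans eU; apply: le_ball; rewrite ge_min lexx.
  have [e e0 [er eU]] := shrink x sx.1.
  have [e' e'0 [e'r e'U]] := shrink y sy.1.
  have ball_dist a b : ball x e a -> ball y e' b -> euclidean_norm (a - b) < 1.
    by move=> xa yb; apply: xyr; [exact: le_ball er _ xa|exact: le_ball e'r _ yb].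
  have lim i' (B : set 'rV[R]_N) : open B -> B `<=` neighborhood1 Omega ->
      (exists v', forall n, vanishing B i' (v' n) /\ admissible Omega f (v' n) /\
         energy_dist Omega (v n) (v' n) <= 1 / 8 ^+ n) -> vanishing B i' u.
    move=> oB BU [v' v'P].
    apply: (vanishing_limit (C := C) (v := v) (v' := v') oB BU au.1) => n.
    - exact: (av n).1.
    - exact: (v'P n).2.1.1.
    - exact: (v'P n).1.
    - exact: uv.
    - apply: le_trans (poinc _ _ i' (av n) (v'P n).2.1) _.
      by rewrite ler_wpM2l// -[8 ^- n]mul1r; exact: (v'P n).2.2.
  (* Whichever alternative is selected holds for [u] on a ball around a point of the corresponding
     support, which is absurd. *)
  have [] := vT (vanishing (ball x e) i) (vanishing (ball y e') j)
    (@mid_closed_vanishing R N k _ i) (@mid_closed_vanishing R N k _ j).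
  - move=> w [_ sw _].
    exact: vanishing_or sw ij eU e'U ball_dist.
  - move/(lim i _ (ball_open x e) eU) => ui0.
    by apply: (supp_disjoint (ball_open x e) eU (ballxx _ e0) ui0).
  - move/(lim j _ (ball_open y e') e'U) => uj0.
    by apply: (supp_disjoint (ball_open y e') e'U (ballxx _ e'0) uj0).
have Hu : Hinfty Omega f u by case: au => au1 au2; split.
have uI : energy Omega u <= I.
  have I0 : 0 <= I.
    by rewrite -lee_fin -IE; apply: le_ereal_inf_tmp => _ [w Hw <-]; rewrite JE// lee_fin energy_ge0.
  apply/ler_addgt0Pr => eps eps0.
  (* [t] is fixed before [n], because [8^-n] has to beat the large factor [1 + t^-1]. *)
  have [t t0 tI] := exists_small_factor I0 eps0.
  have e2 : 0 < eps / 2 by rewrite divr_gt0.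
  have [n n_small] := exists_div_exp8 (1 + t + (1 + t^-1) * C) e2.
  have t'0 : 0 <= t^-1 by rewrite invr_ge0 ltW.
  have {}vI : energy Omega (v n) <= I + 8 ^- n by rewrite -[8 ^- n]mul1r; exact: vI.
  have yng := energy_young hOmega t0 au.1 (av n).1.
  have h := young_chain (ltW t0) t'0 tI n_small yng vI (ud n).
  exact: h.
exists u => //; apply/eqP; rewrite eq_le; apply/andP; split.
  by rewrite IE JE// lee_fin.
by apply: ereal_inf_lbound; exists u.
Qed.
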